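(* Let $d\le n$ and let $A$ be a based quasi-hereditary graded $\Bbbk$-superalgebra with $\mathfrak a$-conforming heredity data $I,X,Y$. Then $T^A_{\mathfrak a}(n,d)$ is a based quasi-hereditary graded $\Bbbk$-superalgebra with heredity data $\Lambda^I_+(n,d),\mathcal X,\mathcal Y$ and initial elements $e_{\boldsymbol\lambda}$ $(\boldsymbol\lambda\in\Lambda^I_+(n,d))$, where $\Lambda_+^I(n,d)$ is partially ordered by $\le$, $\mathcal X=\bigsqcup_{\boldsymbol\lambda}\mathcal X(\boldsymbol\lambda)$ with $\mathcal X(\boldsymbol\lambda)=\{\mathcal X_{\boldsymbol S}\mid \boldsymbol S\in\mathrm{Std}^X(\boldsymbol\lambda)\}$, and $\mathcal Y=\bigsqcup_{\boldsymbol\lambda}\mathcal Y(\boldsymbol\lambda)$ with $\mathcal Y(\boldsymbol\lambda)=\{\mathcal Y_{\boldsymbol T}\mid \boldsymbol T\in\mathrm{Std}^Y(\boldsymbol\lambda)\}$.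
   Context: $\Bbbk$ is a commutative integral domain of characteristic $0$, $n\in\mathbb Z_{>0}$, $d\in\mathbb Z_{\ge0}$. Based quasi-hereditary algebras. A graded $\Bbbk$-supermodule is $V=\bigoplus_{m\in\mathbb Z,\varepsilon\in\mathbb Z/2}V^m_\varepsilon$, with $V_\varepsilon=\bigoplus_mV^m_\varepsilon$; elements of the $V^m_\varepsilon$ are homogeneous (even if $\varepsilon=\bar 0$, odd if $\varepsilon=\bar1$); for a set $S$ of homogeneous elements, $S_\varepsilon=S\cap V_\varepsilon$. A graded $\Bbbk$-superalgebra is a (not necessarily unital) associative algebra $A$ with $A^m_\varepsilon A^l_\delta\subseteq A^{m+l}_{\varepsilon+\delta}$. Heredity data on $A$ consist of a finite poset $I$ and finite sets $X=\bigsqcup_{i\in I}X(i)$, $Y=\bigsqcup_{i\in I}Y(i)$ of homogeneous elements of $A$ with distinguished initial elements $e_i\in X(i)\cap Y(i)$ such that, with $A^{>i}=\mathrm{span}(xy\mid j>i,\ x\in X(j),\ y\in Y(j))$: (a) $B=\{xy\mid i\in I,x\in X(i),y\in Y(i)\}$ is a $\Bbbk$-basis of $A$ (the listed products being distinct); (b) for $x\in X(i)$, $y\in Y(i)$, $a\in A$, $ax$ is congruent mod $A^{>i}$ to a linear combination of elements of $X(i)$ and $ya$ to a linear combination of elements of $Y(i)$, with coefficients depending only on $(a,x)$, resp. $(a,y)$; (c) for $i,j\in I$, $x\in X(i)$, $y\in Y(i)$: $xe_i=x$, $e_ix=\delta_{x,e_i}x$, $e_iy=y$, $ye_i=\delta_{y,e_i}y$,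 $e_jx\in\{x,0\}$, $ye_j\in\{y,0\}$. If $A$ has heredity data it is called based quasi-hereditary. For a subalgebra $\mathfrak a\subseteq A_{\bar0}$ the data is $\mathfrak a$-conforming if $I,X_{\bar0},Y_{\bar0}$ is heredity data for $\mathfrak a$. Write $I=\{0,\dots,\ell\}$, numbered so that $0\prec 1\prec\dots\prec\ell$ refines the partial order of $I$. The algebra $T^A_{\mathfrak a}(n,d)$. Let $B(i)=\{xy\mid x\in X(i),y\in Y(i)\}$, $B_{\mathfrak c}=\{xy\mid i\in I,\ x\in X(i)_{\bar1},\ y\in Y(i)_{\bar1}\}$. Let $H$ be the set of nonzero homogeneous elements of $A$. For $P\subseteq H$, $\mathrm{Tri}^P(n,d)$ is the set of triples $(\boldsymbol p,\boldsymbol r,\boldsymbol s)\in P^d\times[1,n]^d\times[1,n]^d$ such that for $k\ne l$ one has $(p_k,r_k,s_k)=(p_l,r_l,s_l)$ only if $p_k$ is even. $\mathfrak S_d$ acts on words by $(z_1\cdots z_d)\sigma=z_{\sigma1}\cdots z_{\sigma d}$, and diagonally on triples. Put $\xi^a_{r,s}=aE_{r,s}\in M_n(A)$. $\mathfrak S_d$ acts on the right on the superalgebra $M_n(A)^{\otimes d}$ by $(\xi^{a_1}_{r_1,s_1}\otimes\cdots\otimes\xi^{a_d}_{r_d,s_d})^\sigma=(-1)^{\langle\sigma;\boldsymbol a\rangle}\xi^{a_{\sigma1}}_{r_{\sigma1},s_{\sigma1}}\otimes\cdots\otimes\xi^{a_{\sigma d}}_{r_{\sigma d},s_{\sigma d}}$,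 with $\langle\sigma;\boldsymbol a\rangle=\#\{k<l\mid\sigma^{-1}k>\sigma^{-1}l,\ a_k,a_l\text{ odd}\}$; $S^A(n,d)$ is the algebra of invariants. For $(\boldsymbol a,\boldsymbol r,\boldsymbol s)\in\mathrm{Tri}^H(n,d)$, $\xi^{\boldsymbol a}_{\boldsymbol r,\boldsymbol s}=\sum_\sigma(\xi^{a_1}_{r_1,s_1}\otimes\cdots\otimes\xi^{a_d}_{r_d,s_d})^\sigma$, over shortest representatives $\sigma$ of the cosets $\mathrm{Stab}(\boldsymbol a,\boldsymbol r,\boldsymbol s)\backslash\mathfrak S_d$. For $(\boldsymbol b,\boldsymbol r,\boldsymbol s)\in\mathrm{Tri}^B(n,d)$, $\eta^{\boldsymbol b}_{\boldsymbol r,\boldsymbol s}=[\boldsymbol b,\boldsymbol r,\boldsymbol s]^!_{\mathfrak c}\,\xi^{\boldsymbol b}_{\boldsymbol r,\boldsymbol s}$, where $[\boldsymbol b,\boldsymbol r,\boldsymbol s]^!_{\mathfrak c}=\prod_{b\in B_{\mathfrak c},\,r,s\in[1,n]}\#\{k\mid(b_k,r_k,s_k)=(b,r,s)\}!$. Then $T^A_{\mathfrak a}(n,d)=\mathrm{span}_{\Bbbk}(\eta^{\boldsymbol b}_{\boldsymbol r,\boldsymbol s})$ is a subalgebra of $S^A(n,d)$. Combinatorics. $\Lambda(n)$ is the set of $n$-tuples of non-negative integers, $|\lambda|$ the sum of parts; $\Lambda(n,d)=\{\lambda\in\Lambda(n):|\lambda|=d\}$. $\Lambda^I(n,d)$ is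 the set of $\boldsymbol\lambda=(\lambda^{(0)},\dots,\lambda^{(\ell)})$ with $\lambda^{(i)}\in\Lambda(n)$ and $\sum_i|\lambda^{(i)}|=d$; $\Lambda_+^I(n,d)$ is the subset where all $\lambda^{(i)}$ are partitions. $\|\boldsymbol\lambda\|=(|\lambda^{(0)}|,\dots,|\lambda^{(\ell)}|)$. For tuples $\alpha,\beta$ of non-negative integers indexed by $I$ with sum $d$: $\alpha\unlhd_I\beta$ iff $\sum_{j\ge i}\alpha_j\le\sum_{j\ge i}\beta_j$ for all $i\in I$. $\unlhd$ is the dominance order on $\Lambda(n,c)$. The order: $\boldsymbol\lambda\le\boldsymbol\mu$ iff either $\|\boldsymbol\lambda\|\lhd_I\|\boldsymbol\mu\|$, or $\|\boldsymbol\lambda\|=\|\boldsymbol\mu\|$ and $\lambda^{(i)}\unlhd\mu^{(i)}$ for all $i$. Tableaux. Let $\mathscr A_{X(i)}=[1,n]\times X(i)$, writing $r^x$ for $(r,x)$, with colour $x$. Fix a total order on each $\mathscr A_{X(i)}$ with $r^x<s^x$ if $r<s$. An $X(i)$-colored $\lambda^{(i)}$-tableau is a map $T:[\lambda^{(i)}]\to\mathscr A_{X(i)}$ on the Young diagram such that equal entries in distinct nodes of the same row have even colour. It is row standard if entries weakly increase along rows, column standard if entries weakly increase down columns with equality only allowed for odd colours, standard if both. $\mathrm{Std}^X(\boldsymbol\lambda)$ is the set of tuples $\boldsymbol S=(S^{(0)},\dots,S^{(\ell)})$ with $S^{(i)}$ a standard $X(i)$-colored $\lambda^{(i)}$-tableau.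 Similarly for $Y$. Reading the entries of $S^{(0)},S^{(1)},\dots,S^{(\ell)}$ successively, each along rows from left to right, top to bottom, gives $r_1^{x_1}\cdots r_d^{x_d}$; put $\boldsymbol x^{\boldsymbol S}=x_1\cdots x_d$, $\boldsymbol l^{\boldsymbol S}=r_1\cdots r_d$ (and $\boldsymbol y^{\boldsymbol T},\boldsymbol l^{\boldsymbol T}$ for $Y$-colored $\boldsymbol T$). Put $\boldsymbol l^{\lambda}=1^{\lambda_1}\cdots n^{\lambda_n}$ and $\boldsymbol l^{\boldsymbol\lambda}=\boldsymbol l^{\lambda^{(0)}}\cdots\boldsymbol l^{\lambda^{(\ell)}}$. Then $\mathcal X_{\boldsymbol S}=\xi^{\boldsymbol x^{\boldsymbol S}}_{\boldsymbol l^{\boldsymbol S},\boldsymbol l^{\boldsymbol\lambda}}$, $\mathcal Y_{\boldsymbol T}=\xi^{\boldsymbol y^{\boldsymbol T}}_{\boldsymbol l^{\boldsymbol\lambda},\boldsymbol l^{\boldsymbol T}}$, and $e_{\boldsymbol\lambda}=\xi^{e_0^{d_0}\cdots e_\ell^{d_\ell}}_{\boldsymbol l^{\boldsymbol\lambda},\boldsymbol l^{\boldsymbol\lambda}}$ with $d_i=|\lambda^{(i)}|$; one has $e_{\boldsymbol\lambda}=\mathcal X_{\boldsymbol T^{\boldsymbol\lambda}}=\mathcal Y_{\boldsymbol T^{\boldsymbol\lambda}}$ for the tableau $\boldsymbol T^{\boldsymbol\lambda}$ with entry $r^{e_i}$ in every node of row $r$ of $[\lambda^{(i)}]$. *)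

(* Defs.v *)
From mathcomp Require Import all_boot all_order all_fingroup all_algebra.
From mathcomp Require Import boolp classical_sets functions cardinality fsbigop.

Set Implicit Arguments.
Unset Strict Implicit.
Unset Printing Implicit Defensive.

Import GRing.Theory.
Local Open Scope classical_set_scope.
Local Open Scope ring_scope.

Section LinearAlgebra.
Variables (k : comNzRingType) (V : lmodType k).
Implicit Types (S P : set V).

Definition lspan S : set V :=
  [set v | exists s : seq (k * V),
     (forall p, p \in s -> S p.2) /\ v = \sum_(p <- s) p.1 *: p.2].

Definition linearly_independent S : Prop :=
  forall (s : seq V) (c : V -> k), uniq s -> (forall u, u \in s -> S u) ->
    \sum_(u <- s) c u *: u = 0 -> forall u, u \in s -> c u = 0.

Definition submodule P : Prop :=
  P 0 /\ forall (c : k) u v, P u -> P v -> P (c *: u + v).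

End LinearAlgebra.

(* Degrees (m, eps) in Z x Z/2; they are added componentwise. *)
Definition deg : zmodType := (int * 'Z_2)%type.

(* Graded superalgebras, associative but not necessarily unital.  The
   homogeneous component V^m_eps is [gr (m, eps)]; the last two axioms say
   that V is the direct sum of these components. *)
Record superalg (k : comNzRingType) := Superalg {
  superalg_mod :> lmodType k;
  smul : superalg_mod -> superalg_mod -> superalg_mod;
  gr : deg -> set superalg_mod;
  smul_linl : forall (c : k) u v w, smul (c *: u + v) w = c *: smul u w + smul v w;
  smul_linr : forall (c : k) u v w, smul u (c *: v + w) = c *: smul u v + smul u w;
  smulA : forall u v w, smul u (smul v w) = smul (smul u v) w;
  gr_submodule : forall g, submodule (gr g);
  gr_smul : forall g h u v, gr g u -> gr h v -> gr (g + h) (smul u v);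
  gr_span : lspan (\bigcup_g gr g) = setT;
  gr_indep : forall (s : seq deg) (v : deg -> superalg_mod),
    uniq s -> (forall g, gr g (v g)) -> \sum_(g <- s) v g = 0 ->
    forall g, g \in s -> v g = 0
}.

Arguments smul {k _} u v.
Arguments gr {k _} g.

Section Superalgebras.
Variables (k : comNzRingType) (V : superalg k).

Definition homogeneous : set V := \bigcup_g gr g.

(* V_eps, the direct sum over m of the V^m_eps *)
Definition parity_part (eps : 'Z_2) : set V :=
  lspan (\bigcup_(m : int) gr (m, eps)).

Definition evenE : set V := parity_part 0.
Definition oddE : set V := parity_part 1.

Definition graded_subalgebra (P : set V) : Prop :=
  [/\ submodule P,
      forall u v, P u -> P v -> P (smul u v)
    & P `<=` lspan (P `&` homogeneous)].

Definition partial_order_rel (I : finType) (le : rel I) : Prop :=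
  [/\ reflexive le, antisymmetric le & transitive le].

Section Heredity.
Variables (I : finType) (le : rel I) (X Y : I -> set V) (e : I -> V).

Definition prods (i : I) : set V := [set smul x y | x in X i & y in Y i].

Definition hered_basis : set V := \bigcup_(i : I) prods i.

Definition hered_above (i : I) : set V :=
  lspan (\bigcup_(j in [set j | le i j && (i != j)]) prods j).

(* Heredity data on a graded subalgebra P of V (P = setT for V itself).  The
   products are indexed by triples (i, x, y), so that distinctness of the listed
   products is hd_distinct and the basis property hd_indep and hd_span.  In
   hd_left and hd_right the linear combination u is chosen after (a, x), resp.
   (a, y), only. *)
Record heredity_data (P : set V) : Prop := HeredityData {
  hd_subalg : graded_subalgebra P;
  hd_poset : partial_order_rel le;
  hd_finX : forall i, finite_set (X i);
  hd_finY : forall i, finite_set (Y i);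
  hd_homX : forall i, X i `<=` P `&` homogeneous;
  hd_homY : forall i, Y i `<=` P `&` homogeneous;
  hd_disjX : forall i j x, X i x -> X j x -> i = j;
  hd_disjY : forall i j y, Y i y -> Y j y -> i = j;
  hd_init : forall i, X i (e i) /\ Y i (e i);
  hd_distinct : forall i j x x' y y',
    X i x -> Y i y -> X j x' -> Y j y' -> smul x y = smul x' y' ->
    [/\ i = j, x = x' & y = y'];
  hd_indep : linearly_independent hered_basis;
  hd_span : lspan hered_basis = P;
  hd_left : forall i x a, X i x -> P a ->
    exists2 u, lspan (X i) u & hered_above i (smul a x - u);
  hd_right : forall i y a, Y i y -> P a ->
    exists2 u, lspan (Y i) u & hered_above i (smul y a - u);
  hd_xe : forall i x, X i x -> smul x (e i) = x;
  hd_ex : forall i x, X i x -> smul (e i) x = if x == e i then x else 0;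
  hd_ey : forall i y, Y i y -> smul (e i) y = y;
  hd_ye : forall i y, Y i y -> smul y (e i) = if y == e i then y else 0;
  hd_ejx : forall i j x, X i x -> smul (e j) x = x \/ smul (e j) x = 0;
  hd_yej : forall i j y, Y i y -> smul y (e j) = y \/ smul y (e j) = 0
}.

End Heredity.

Definition conforming (I : finType) (le : rel I) (X Y : I -> set V)
    (e : I -> V) (P : set V) : Prop :=
  P `<=` evenE /\
  heredity_data le (fun i => X i `&` evenE) (fun i => Y i `&` evenE) e P.

End Superalgebras.

Arguments homogeneous {k V}.
Arguments evenE {k V}.
Arguments oddE {k V}.

Section MatrixSuperalgebra.
Variables (k : comNzRingType) (A : superalg k) (n : nat).

Definition mat : lmodType k := {ffun 'I_n * 'I_n -> A}.

Definition mat_mul (M N : mat) : mat :=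
  [ffun p => \sum_(t < n) smul (M (p.1, t)) (N (t, p.2))].

Definition mat_gr (g : deg) : set mat := [set M | forall p, gr g (M p)].

Definition xi1 (a : A) (r s : 'I_n) : mat :=
  [ffun p => if p == (r, s) then a else 0].

Fact smul0l (u : A) : smul 0 u = 0.
Proof.
by have := smul_linl 1 0 0 u; rewrite !scale1r addr0 => /eqP;
   rewrite -subr_eq0 opprD addrA subrr sub0r oppr_eq0 => /eqP.
Qed.

Fact smul0r (u : A) : smul u 0 = 0.
Proof.
by have := smul_linr 1 u 0 0; rewrite !scale1r addr0 => /eqP;
   rewrite -subr_eq0 opprD addrA subrr sub0r oppr_eq0 => /eqP.
Qed.

Fact smul_suml (J : finType) (F : J -> A) u :
  smul (\sum_j F j) u = \sum_j smul (F j) u.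
Proof.
apply: (big_morph (smul^~ u)) => [x y|]; last exact: smul0l.
by have := smul_linl 1 x y u; rewrite !scale1r.
Qed.

Fact smul_sumr (J : finType) (F : J -> A) u :
  smul u (\sum_j F j) = \sum_j smul u (F j).
Proof.
apply: (big_morph (smul u)) => [x y|]; last exact: smul0r.
by have := smul_linr 1 u x y; rewrite !scale1r.
Qed.

Fact gr_sum (J : finType) (F : J -> A) g :
  (forall j, gr g (F j)) -> gr g (\sum_j F j).
Proof.
have [g0 gD] := @gr_submodule k A g.
move=> gF; apply: (big_ind (gr g)) => // x y gx gy.
by rewrite -[x]scale1r; apply: gD.
Qed.

Fact mat_mul_linl (c : k) u v w :
  mat_mul (c *: u + v) w = c *: mat_mul u w + mat_mul v w.
Proof.
apply/ffunP => p; rewrite !ffunE scaler_sumr -big_split /=.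
by apply: eq_bigr => t _; rewrite !ffunE smul_linl.
Qed.

Fact mat_mul_linr (c : k) u v w :
  mat_mul u (c *: v + w) = c *: mat_mul u v + mat_mul u w.
Proof.
apply/ffunP => p; rewrite !ffunE scaler_sumr -big_split /=.
by apply: eq_bigr => t _; rewrite !ffunE smul_linr.
Qed.

Fact mat_mulA u v w : mat_mul u (mat_mul v w) = mat_mul (mat_mul u v) w.
Proof.
apply/ffunP => p; rewrite !ffunE.
under eq_bigr => t _ do rewrite ffunE smul_sumr.
under [RHS]eq_bigr => t _ do rewrite ffunE smul_suml.
rewrite exchange_big /=; apply: eq_bigr => i _; apply: eq_bigr => j _.
exact: smulA.
Qed.

Fact mat_gr_submodule g : submodule (mat_gr g).
Proof.
have [g0 gD] := @gr_submodule k A g.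
split=> [p|c u v gu gv p]; rewrite !ffunE //; exact: gD.
Qed.

Fact mat_gr_mul g h u v : mat_gr g u -> mat_gr h v -> mat_gr (g + h) (mat_mul u v).
Proof. by move=> gu hv p; rewrite ffunE; apply: gr_sum => t; apply: gr_smul. Qed.

Fact lspan_submodule (V : lmodType k) (S : set V) : submodule (lspan S).
Proof.
split=> [|c u v [s [Ss ->]] [s' [Ss' ->]]]; first by exists [::]; rewrite big_nil.
exists ([seq (c * p.1, p.2) | p <- s] ++ s'); split.
  by move=> p; rewrite mem_cat => /orP[/mapP[q /Ss ? ->] //|/Ss'].
rewrite big_cat big_map /= scaler_sumr; congr (_ + _).
by apply: eq_bigr => p _; rewrite scalerA.
Qed.

Fact mat_gr_span : lspan (\bigcup_g mat_gr g) = setT.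
Proof.
apply/seteqP; split=> // M _.
have [S0 SD] := @lspan_submodule mat (\bigcup_g mat_gr g).
have -> : M = \sum_p xi1 (M p) p.1 p.2.
  apply/ffunP => p; rewrite sum_ffunE (bigD1 p) //= big1 => [|q qp].
    by rewrite ffunE -surjective_pairing eqxx addr0.
  by rewrite ffunE -surjective_pairing eq_sym (negPf qp).
apply: (big_ind (lspan _)) => // [x y Sx Sy|p _].
  by rewrite -[x]scale1r; apply: SD.
have : lspan (\bigcup_g gr g) (M p) by rewrite gr_span.
move=> [s [gs ->]].
exists [seq (q.1, xi1 q.2 p.1 p.2) | q <- s]; split.
  move=> _ /mapP[q /gs[g _ gq] ->]; exists g => // r; rewrite ffunE.
  by case: eqP => // _; case: (@gr_submodule k A g).
apply/ffunP => q; rewrite big_map sum_ffunE ffunE.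
under [RHS]eq_bigr => u _ do rewrite !ffunE.
by case: eqP => // _; rewrite big1 // => u _; rewrite scaler0.
Qed.

Fact mat_gr_indep (s : seq deg) (v : deg -> mat) :
  uniq s -> (forall g, mat_gr g (v g)) -> \sum_(g <- s) v g = 0 ->
  forall g, g \in s -> v g = 0.
Proof.
move=> us gv v0 g gs; apply/ffunP => p; rewrite ffunE.
apply: (@gr_indep k A s (fun g => v g p)) => // [h|]; first exact: gv.
by have /ffunP/(_ p) := v0; rewrite sum_ffunE ffunE.
Qed.

Definition matA : superalg k :=
  Superalg mat_mul_linl mat_mul_linr mat_mulA mat_gr_submodule mat_gr_mul
    mat_gr_span mat_gr_indep.

End MatrixSuperalgebra.

Section TensorPower.
Variables (k : comNzRingType) (M : superalg k) (d : nat).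

Definition multilinear (U : lmodType k) (f : {ffun 'I_d -> M} -> U) : Prop :=
  forall (v : {ffun 'I_d -> M}) (i : 'I_d) (c : k) (x y : M),
    f (finfun [eta v with i |-> c *: x + y])
    = c *: f (finfun [eta v with i |-> x]) + f (finfun [eta v with i |-> y]).

(* W, with t v = v_1 (x) ... (x) v_d, is the d-th tensor power of the
   superalgebra M: the universal property of the tensor power of modules,
   the product given by the sign rule (the i-th factor of the left term is
   moved past the j-th factor of the right one for all j < i), and the total
   grading. *)
Record tensor_power (W : superalg k) (t : {ffun 'I_d -> M} -> W) : Prop :=
  TensorPower {
  tp_multilinear : multilinear t;
  tp_universal : forall (U : lmodType k) (f : {ffun 'I_d -> M} -> U),
    multilinear f ->
    exists h : {linear W -> U}, (forall v, h (t v) = f v) /\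
      forall h' : {linear W -> U}, (forall v, h' (t v) = f v) -> h' =1 h;
  tp_mul : forall (g h : 'I_d -> deg) (u v : {ffun 'I_d -> M}),
    (forall i, gr (g i) (u i)) -> (forall i, gr (h i) (v i)) ->
    smul (t u) (t v)
    = (-1) ^+ (\sum_(i < d) \sum_(j < d | (j < i)%N) (g i).2 * (h j).2)%N
        *: t [ffun i => smul (u i) (v i)];
  tp_gr : forall g0 : deg, gr g0 =
    lspan [set t u | u in [set u : {ffun 'I_d -> M} | exists g : 'I_d -> deg,
                             (forall i, gr (g i) (u i)) /\ \sum_i g i = g0]]
}.

End TensorPower.

Section Words.
Variables (k : comNzRingType) (A : superalg k) (n d : nat).
Implicit Types (a : d.-tuple A) (r s : d.-tuple 'I_n) (sg : 'S_d).

Definition Tri (P : set A) a r s : Prop :=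
  (forall i, P (tnth a i)) /\
  forall i j, i != j ->
    (tnth a i, tnth r i, tnth s i) = (tnth a j, tnth r j, tnth s j) ->
    evenE (tnth a i).

(* The exponent of the sign in the action of sg on a tensor with colours a. *)
Definition sgn_count sg a : nat :=
  #|[pred p : 'I_d * 'I_d | [&& (p.1 < p.2)%N, ((sg^-1)%g p.2 < (sg^-1)%g p.1)%N,
       `[< oddE (tnth a p.1) >] & `[< oddE (tnth a p.2) >]]]|.

Definition perm_length sg : nat :=
  #|[pred p : 'I_d * 'I_d | (p.1 < p.2)%N && (sg p.2 < sg p.1)%N]|.

Definition stab a r s : {pred 'S_d} :=
  [pred ta : 'S_d | [forall i, (tnth a (ta i), tnth r (ta i), tnth s (ta i))
                              == (tnth a i, tnth r i, tnth s i)]].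

(* The elements of minimal length of the cosets Stab sg.  The product of
   permutations is here composition of functions, which is the product of
   mathcomp in the opposite order: (sg * ta)%g i = ta (sg i). *)
Definition shortest_reps a r s : {pred 'S_d} :=
  [pred sg : 'S_d | [forall ta in stab a r s,
                      (perm_length sg <= perm_length (sg * ta)%g)%N]].

Section Tensors.
Variables (W : superalg k) (t : {ffun 'I_d -> matA A n} -> W).

Definition tensor_act a r s sg : W :=
  (-1) ^+ sgn_count sg a
    *: t [ffun i => xi1 (tnth a (sg i)) (tnth r (sg i)) (tnth s (sg i))].

Definition xi a r s : W := \sum_(sg in shortest_reps a r s) tensor_act a r s sg.

Variables (I : finType) (X Y : I -> set A).

Definition odd_odd_basis : set A :=
  \bigcup_(i : I) [set smul x y | x in X i `&` oddE & y in Y i `&` oddE].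

Definition c_factorial a r s : nat :=
  (\big[muln/1]_(b \in odd_odd_basis) \prod_(p < n) \prod_(q < n)
    (#|[pred i : 'I_d | (tnth a i, tnth r i, tnth s i) == (b, p, q)]|)`!)%N.

Definition eta_elt a r s : W := xi a r s *+ c_factorial a r s.

(* T^A_a(n,d); the subalgebra a does not occur in the formula, it only constrains
   X and Y (see [conforming]). *)
Definition TA : set W :=
  lspan [set w | exists a r s, Tri (hered_basis X Y) a r s /\ w = eta_elt a r s].

End Tensors.
End Words.

Section Multipartitions.
Variables (l n d : nat) (leI : rel 'I_l.+1).

(* Lambda_+^I(n,d) for I = {0, ..., l}; since the sizes sum to d, the parts
   are at most d, which makes this a finite type. *)
Definition is_multipart (lam : {ffun 'I_l.+1 -> {ffun 'I_n -> 'I_d.+1}}) : bool :=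
  (\sum_i \sum_r lam i r == d)%N &&
  [forall i, forall r : 'I_n, forall s : 'I_n, (r <= s)%N ==> (lam i s <= lam i r)%N].

Definition multipart := {lam | is_multipart lam}.

Definition mpart (lam : multipart) (i : 'I_l.+1) (r : 'I_n) : nat := val lam i r.

Definition mnorm (lam : multipart) : {ffun 'I_l.+1 -> nat} :=
  [ffun i => \sum_(r < n) mpart lam i r]%N.

(* The sums run over the upper sets {j | j >= i} for the partial order of I,
   not for its linear refinement 0, ..., l. *)
Definition domI (al be : {ffun 'I_l.+1 -> nat}) : bool :=
  [forall i, (\sum_(j | leI i j) al j <= \sum_(j | leI i j) be j)%N].

Definition dominates (mu la : 'I_n -> nat) : bool :=
  [forall r : 'I_n, (\sum_(q < n | (q <= r)%N) la q <= \sum_(q < n | (q <= r)%N) mu q)%N].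

Definition multipart_le (la mu : multipart) : bool :=
  (domI (mnorm la) (mnorm mu) && (mnorm la != mnorm mu)) ||
  ((mnorm la == mnorm mu) && [forall i, dominates (mpart mu i) (mpart la i)]).

Section Reading.
Variables (L : Type) (lam : multipart).

(* The reading word of a filling F of the nodes (i, r, c), where c is a column
   of row r of [lam^(i)]: component by component, each by rows from left to right
   and top to bottom. *)
Definition reading_seq (F : forall i r, 'I_(mpart lam i r) -> L) : seq L :=
  flatten [seq flatten [seq [seq F i r c | c <- enum 'I_(mpart lam i r)]
                       | r <- enum 'I_n] | i <- enum 'I_l.+1].

Fact size_reading_seq F : size (reading_seq F) == d.
Proof.
have /andP[/eqP sz _] := valP lam.
apply/eqP; rewrite -[RHS]sz size_flatten /shape sumnE 2!big_map big_enum /=.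
apply: eq_bigr => i _; rewrite size_flatten /shape sumnE 2!big_map big_enum /=.
by apply: eq_bigr => r _; rewrite size_map -cardE card_ord.
Qed.

Definition reading F : d.-tuple L := Tuple (size_reading_seq F).

End Reading.
End Multipartitions.

Section Tableaux.
Variables (k : comNzRingType) (A : superalg k) (l n d : nat).

(* A letter r^x is the pair (r, x).  [le] is a total order on the letters with
   colours in C, with r^x < s^x if r < s. *)
Definition letter_order (C : set A) (le : rel ('I_n * A)) : Prop :=
  [/\ forall p, C p.2 -> le p p,
      forall p q, C p.2 -> C q.2 -> le p q -> le q p -> p = q,
      forall p q u, C p.2 -> C q.2 -> C u.2 -> le p q -> le q u -> le p u,
      forall p q, C p.2 -> C q.2 -> le p q || le q p
    & forall (r s : 'I_n) x, C x -> (r < s)%N -> le (r, x) (s, x)].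

Definition filling (sh : 'I_n -> nat) := forall r : 'I_n, 'I_(sh r) -> 'I_n * A.

Definition colored_tableau (C : set A) sh (T : filling sh) : Prop :=
  (forall r c, C (T r c).2) /\
  (forall r (c c' : 'I_(sh r)), c != c' -> T r c = T r c' -> evenE (T r c).2).

Definition row_standard (le : rel ('I_n * A)) sh (T : filling sh) : Prop :=
  forall r (c c' : 'I_(sh r)), (c <= c')%N -> le (T r c) (T r c').

Definition column_standard (le : rel ('I_n * A)) sh (T : filling sh) : Prop :=
  forall (r r' : 'I_n) (c : 'I_(sh r)) (c' : 'I_(sh r')),
    (r < r')%N -> c = c' :> nat ->
    le (T r c) (T r' c') /\ (T r c = T r' c' -> oddE (T r c).2).

Definition multifilling (lam : multipart l n d) :=
  forall i : 'I_l.+1, filling (mpart lam i).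

Definition Std (X : 'I_l.+1 -> set A) (le : 'I_l.+1 -> rel ('I_n * A))
    (lam : multipart l n d) : set (multifilling lam) :=
  [set S | forall i, [/\ colored_tableau (X i) (S i),
                         row_standard (le i) (S i)
                       & column_standard (le i) (S i)]].

Definition color_word (lam : multipart l n d) (S : multifilling lam) : d.-tuple A :=
  reading (fun i r c => (S i r c).2).

Definition row_word (lam : multipart l n d) (S : multifilling lam) : d.-tuple 'I_n :=
  reading (fun i r c => (S i r c).1).

(* l^lam and e_0^{d_0} ... e_l^{d_l}, as reading words of fillings constant
   on rows, resp. on components. *)
Definition lword (lam : multipart l n d) : d.-tuple 'I_n :=
  reading (fun i r (_ : 'I_(mpart lam i r)) => r).

Definition eword (e : 'I_l.+1 -> A) (lam : multipart l n d) : d.-tuple A :=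
  reading (fun i r (_ : 'I_(mpart lam i r)) => e i).

Variables (W : superalg k) (t : {ffun 'I_d -> matA A n} -> W).

Definition calX (X : 'I_l.+1 -> set A) (le : 'I_l.+1 -> rel ('I_n * A))
    (lam : multipart l n d) : set W :=
  [set xi t (color_word S) (row_word S) (lword lam) | S in Std X le (lam := lam)].

Definition calY (Y : 'I_l.+1 -> set A) (le : 'I_l.+1 -> rel ('I_n * A))
    (lam : multipart l n d) : set W :=
  [set xi t (color_word S) (lword lam) (row_word S) | S in Std Y le (lam := lam)].

Definition e_lam (e : 'I_l.+1 -> A) (lam : multipart l n d) : W :=
  xi t (eword e lam) (lword lam) (lword lam).

End Tableaux.

(* Main.v *)
Require Import Defs.
From mathcomp Require Import all_boot all_order all_fingroup all_algebra.
From mathcomp Require Import boolp classical_sets functions cardinality fsbigop.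
From mathcomp Require Import zify ring.

Set Implicit Arguments.
Unset Strict Implicit.
Unset Printing Implicit Defensive.
Import GRing.Theory.
Local Open Scope ring_scope.

(** Why the theorem holds.

    The matrix superalgebra over [A] has the basis [xyE_(r,s)], where [x] and [y] are
    colours of the same component. Such an element is a product of two halves
    [xE_(r,t)] and [yE_(t,s)], and it is named by the two letters [r^x] and [s^y]. So a
    tensor of degree [d] is a function on pairs of words of length [d], one in each kind
    of letters, and it is invariant iff this function is equivariant for the signed
    action of the symmetric group. A row tableau is a word [p] of letters together with
    the word [u] of the rows in which they stand; its tensor is the signed indicator
    function of the orbit of [(p, u)]. Up to signs, the product of an X-tableau [(p, u)]
    and a Y-tableau [(q, u)] is the kernel
      [K(p1, q1) = sum over u1 of [p,u](p1, u1) [q,u](q1, u1)],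
    see [mul_XYw]. The basis property thus becomes a statement on such kernels.

    Subalgebra. A symmetrised word in arbitrary homogeneous elements of the matrix
    superalgebra lies in [TA] as soon as its repeated elements are combinations of
    products of two even halves: expanding it in the basis, permutations of equal
    products of two odd halves act freely on the terms, which yields the factorials
    ([symm_div]). This class is closed under products, because the products of even
    halves span the conforming subalgebra ([divspan_mul]).

    Spanning. A generator eta is a product of two row tableaux: equal letters are put in
    one row, except that odd halves keep rows of their own, and the factorial counts the
    terms that coincide ([factor_word]). If two entries of a column violate
    standardness, the offending parts of their two rows are gathered in one longer row.
    An element of the Schur algebra maps this longer tableau to the given one plus
    tableaux of smaller weight, and it can be moved to the other factor of the product;
    so the violation is traded for products of larger shape or smaller weight
    ([straighten], [standard_span]). Both steps need enough rows, which is where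
    [d <= n] enters.

    Independence. To a pair of standard tableaux is attached a functional which
    antisymmetrises along columns. By the easy half of the Gale-Ryser theorem it is
    nonzero on the product of another pair only if the latter is smaller in a partial
    order, and on its own product it takes a positive integer value up to sign, which is
    nonzero in characteristic 0 ([capelli_support], [capelli_diag], [standard_indep]).

    Heredity. Each [e_j] fixes or kills a colour, and it fixes [x] of component [i] only
    if [j <= i], with equality only for [x = e_i] ([weightX]). Hence the idempotent of
    [nu] fixes or kills a standard tableau of shape [lam]; it can fix it only if
    [nu <= lam], and for [nu = lam] only the initial tableau ([weight_le]). Expanding
    [b x] in the basis and multiplying by the idempotent of the shape of [x] on the right
    leaves the elements [X_S] of this shape and products of larger shapes
    ([left_cell], [right_cell]). *)

(** * Signs of permutations of words *)

Section Signs.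
Variable d : nat.
Implicit Types (s u : 'S_d) (e f : 'I_d -> bool).

Definition pair_parity (h : 'I_d -> 'I_d -> bool) : bool :=
  \big[addb/false]_(p : 'I_d * 'I_d | (p.1 < p.2)%N) h p.1 p.2.

Lemma eq_pair_parity h h' :
  (forall i j : 'I_d, (i < j)%N -> h i j = h' i j) -> pair_parity h = pair_parity h'.
Proof. by move=> hh; apply: eq_bigr => -[i j] /= /hh. Qed.

Lemma pair_parityD h h' :
  pair_parity (fun i j => h i j (+) h' i j) = pair_parity h (+) pair_parity h'.
Proof. exact: big_split. Qed.

Lemma pair_parity0 h :
  (forall i j : 'I_d, (i < j)%N -> h i j = false) -> pair_parity h = false.
Proof. by move=> h0; apply: big1 => -[i j] /= /h0. Qed.

(** Reindexing by [s] may reverse the order of the two places of a pair. *)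
Lemma pair_parity_perm s h :
  pair_parity (fun i j => h (s i) (s j))
  = pair_parity (fun i j => if (s^-1%g i < s^-1%g j)%N then h i j else h j i).
Proof.
pose phi (p : 'I_d * 'I_d) := (s^-1%g p.1, s^-1%g p.2).
have phi_bij : bijective phi.
  by exists (fun p => (s p.1, s p.2)) => -[i j]; rewrite /phi /= ?permK ?permKV.
rewrite /pair_parity (reindex phi) /=; last exact: onW_bij.
under eq_bigr => p _ do rewrite !permKV.
rewrite (bigID (fun p : 'I_d * 'I_d => (p.1 < p.2)%N)) /=.
rewrite [RHS](bigID (fun p : 'I_d * 'I_d => (s^-1%g p.1 < s^-1%g p.2)%N)) /=.
congr (_ (+) _).
  rewrite (eq_bigl (fun p : 'I_d * 'I_d => (p.1 < p.2)%N && (s^-1%g p.1 < s^-1%g p.2)%N)).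
    by apply: eq_bigr => p /andP[_ ->].
  by move=> p; rewrite andbC.
pose sw (p : 'I_d * 'I_d) := (p.2, p.1).
rewrite (reindex sw) /=; last by apply: onW_bij; exists sw => -[].
rewrite (eq_bigl (fun p : 'I_d * 'I_d => (p.1 < p.2)%N && ~~ (s^-1%g p.1 < s^-1%g p.2)%N)).
  by apply: eq_bigr => p /andP[_ /negbTE ->].
move=> [i j] /=; rewrite -!leqNgt andbC.
have [->|ij] := eqVneq i j; first by rewrite !leqnn !ltnn.
have sij : s^-1%g j != s^-1%g i by rewrite (inj_eq perm_inj) eq_sym.
by rewrite [(i <= j)%N]leq_eqVlt [(s^-1%g j <= _)%N]leq_eqVlt !val_eqE (negbTE ij) (negbTE sij).
Qed.

(** The exponent of the sign by which [s] acts on a tensor with odd places [e]. *)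
Definition sperm s e : bool :=
  pair_parity (fun i j => [&& (s^-1%g j < s^-1%g i)%N, e i & e j]).

Lemma eq_sperm s e e' : e =1 e' -> sperm s e = sperm s e'.
Proof. by move=> ee; apply: eq_pair_parity => i j _; rewrite !ee. Qed.

Lemma ltn_permV s (i j : 'I_d) :
  i != j -> (s^-1%g j < s^-1%g i)%N = ~~ (s^-1%g i < s^-1%g j)%N.
Proof.
move=> ij; rewrite -leqNgt ltn_neqAle; case: eqP => // /val_inj/perm_inj ji.
by rewrite ji eqxx in ij.
Qed.

(** A product inverts a pair iff exactly one of its two factors, applied in turn, does. *)
Lemma spermM s u e : sperm (u * s)%g e = sperm s e (+) sperm u (e \o s).
Proof.
pose h i j := [&& (u^-1%g (s^-1%g j) < u^-1%g (s^-1%g i))%N, e i & e j].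
have -> : sperm u (e \o s) = pair_parity (fun i j => h (s i) (s j)).
  by apply: eq_pair_parity => i j _; rewrite /h !permK.
rewrite pair_parity_perm -pair_parityD; apply: eq_pair_parity => i j ij.
have nij : i != j by rewrite neq_ltn ij.
rewrite /h !invMg !permM (ltn_permV s nij).
have nij' : s^-1%g i != s^-1%g j by rewrite (inj_eq perm_inj).
rewrite (ltn_permV u nij').
by case: (e i); case: (e j); do 2 case: ltnP => _.
Qed.

(** Two fixed places are not inverted. *)
Lemma sperm_fix s e : (forall i, e i -> s i = i) -> sperm s e = false.
Proof.
move=> fe; apply: pair_parity0 => i j ij; apply/negbTE/negP => /and3P[sij ei ej].
by move: sij; rewrite -{1}(fe _ ei) -{1}(fe _ ej) !permK ltnNge ltnW.
Qed.

(** Ranking [i] and [j] before all other places makes them adjacent, and an adjacent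
    transposition inverts a single pair. *)
Lemma sperm_tperm (i j : 'I_d) e : i != j -> e i -> e j -> sperm (tperm i j) e.
Proof.
wlog ij : i j / (i < j)%N => [hw nij ei ej|nij ei ej].
  by have [?|?|/val_inj eij] := ltngtP i j; [|rewrite tpermC|];
    [apply: hw| apply: hw; rewrite 1?eq_sym| rewrite eij eqxx in nij].
(* Under the ranking that puts i first and j second, the only pair whose order
   the transposition changes is (i, j) itself. *)
pose rk x : nat := if x == i then 0 else if x == j then 1 else (val x).+2.
have nji : j == i = false by rewrite eq_sym (negbTE nij).
pose h a b := [&& e a, e b & (rk b < rk a)%N].
have et x : e (tperm i j x) = e x by case: tpermP => [->|->|//]; rewrite ei ej.
have rkt x : rk (tperm i j x) = if x == i then 1%N else if x == j then 0%N else (val x).+2.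
  by rewrite /rk; case: tpermP => [->|->|/eqP/negbTE -> /eqP/negbTE ->]; rewrite ?eqxx ?nji.
have rkE x y : ~~ ((x \in [:: i; j]) && (y \in [:: i; j])) ->
    (rk (tperm i j y) < rk (tperm i j x))%N = (rk y < rk x)%N.
  rewrite !inE !rkt /rk.
  by case: (x == i); case: (x == j); case: (y == i); case: (y == j).
have E1 : pair_parity (fun a b => h (tperm i j a) (tperm i j b)) =
          pair_parity h (+) pair_parity (fun a b => (a == i) && (b == j)).
  rewrite -pair_parityD; apply: eq_pair_parity => a b ab.
  have nab : a != b by rewrite neq_ltn ab.
  rewrite /h !et; have [/andP[]|sab] := boolP ((a \in [:: i; j]) && (b \in [:: i; j])).
    rewrite !inE => /orP[]/eqP ? /orP[]/eqP ?; subst a b; rewrite ?eqxx // in nab *.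
      by rewrite tpermL tpermR ei ej /rk !eqxx nji.
    by rewrite ltnNge ltnW in ab.
  rewrite rkE //; move: sab; rewrite !inE.
  by case: (a == i); case: (b == j); rewrite ?orbT ?addbF.
have E2 : pair_parity (fun a b => (a == i) && (b == j)).
  rewrite /pair_parity (bigD1 (i, j)) //= !eqxx big1 // => -[a b] /andP[_].
  by rewrite xpair_eqE => /negbTE.
move: E1; rewrite pair_parity_perm E2 tpermV => E1.
suff : sperm (tperm i j) e (+) pair_parity h = ~~ pair_parity h.
  by case: (sperm _ _) => //; case: (pair_parity h).
rewrite -[~~ _]addbT -{}E1 -pair_parityD; apply: eq_pair_parity => a b ab.
have nab : a != b by rewrite neq_ltn ab.
rewrite tpermV -[in X in X (+) _](tpermV i j) (ltn_permV _ nab) tpermV /h.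
have rki : injective rk.
  move=> x y; rewrite /rk; do 2!case: eqP => [->|?] //; do 2!case: eqP => [->|?] //.
  by move=> [] /val_inj.
have rab : (rk a < rk b)%N = ~~ (rk b < rk a)%N.
  by rewrite -leqNgt ltn_neqAle (inj_eq rki) nab.
by rewrite rab; case: (e a); case: (e b); do 2 case: ltnP.
Qed.

(** When two tensors are multiplied, the parity of the number of odd factors of the
    right one that are moved past odd factors of the left one. *)
Definition theta e f : bool := pair_parity (fun j i => e i && f j).

Lemma eq_theta e e' f f' : e =1 e' -> f =1 f' -> theta e f = theta e' f'.
Proof. by move=> ee ff; apply: eq_pair_parity => i j _; rewrite ee ff. Qed.

(** The product of a super tensor power is equivariant for the signed action of
    the symmetric group: this is that fact for the exponents of the signs. *)
Lemma theta_perm s e f :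
  theta (e \o s) (f \o s)
  = theta e f (+) (sperm s e (+) sperm s f (+) sperm s (fun i => e i (+) f i)).
Proof.
rewrite /theta (pair_parity_perm s (fun j i => e i && f j)) -!pair_parityD.
apply: eq_pair_parity => i j ij.
have nij : i != j by rewrite neq_ltn ij.
rewrite (ltn_permV s nij).
by case: (e i); case: (e j); case: (f i); case: (f j); case: ltnP.
Qed.

End Signs.

(** * Equivariant functions on words *)

Section Words.
Variables (k : idomainType) (d : nat).
Hypothesis k_char0 : [pchar k] =i pred0.

Lemma natr_neq0 (m : nat) : (0 < m)%N -> m%:R != 0 :> k.
Proof. by move=> m0; rewrite (pcharf0P _).1 // -lt0n. Qed.

Lemma eqN_eq0 (x : k) : x = - x -> x = 0.
Proof.
move=> xN; have /eqP := congr1 (+%R x) xN; rewrite subrr -mulr2n -mulr_natr mulf_eq0.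
by rewrite (negbTE (natr_neq0 (isT : 0 < 2)%N)) orbF => /eqP.
Qed.

Section Letters.
Variable L : finType.
Notation word := {ffun 'I_d -> L}.
Implicit Types (g h : word) (s : 'S_d).

Definition wperm g s : word := [ffun i => g (s i)].

Lemma wpermM g s u : wperm (wperm g s) u = wperm g (u * s)%g.
Proof. by apply/ffunP => i; rewrite !ffunE permM. Qed.

Lemma wpermE g s i : wperm g s i = g (s i).
Proof. exact: ffunE. Qed.

Lemma wperm1 g : wperm g 1%g = g.
Proof. by apply/ffunP => i; rewrite ffunE perm1. Qed.

Lemma wpermK s : cancel (wperm^~ s) (wperm^~ s^-1%g).
Proof. by move=> g; rewrite wpermM mulVg wperm1. Qed.

Lemma wpermKV s : cancel (wperm^~ s^-1%g) (wperm^~ s).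
Proof. by move=> g; rewrite wpermM mulgV wperm1. Qed.

Lemma wperm_bij s : bijective (wperm^~ s).
Proof. exact: Bijective (wpermK s) (wpermKV s). Qed.

Definition samew g h : bool := [exists s, h == wperm g s].

Lemma samewP g h : reflect (exists s, h = wperm g s) (samew g h).
Proof. by apply: (iffP existsP) => -[s] => [/eqP|->]; exists s. Qed.

Lemma samew_perm g s : samew g (wperm g s).
Proof. by apply/samewP; exists s. Qed.

Lemma samew_refl g : samew g g.
Proof. by apply/samewP; exists 1%g; rewrite wperm1. Qed.

Lemma samew_sym g h : samew g h = samew h g.
Proof.
by apply/idP/idP => /samewP[s ->]; apply/samewP; exists s^-1%g; rewrite wpermK.
Qed.

Lemma samew_trans : transitive samew.
Proof. by move=> h g m /samewP[s ->] /samewP[u ->]; rewrite wpermM samew_perm. Qed.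

Lemma samew_count g h :
  reflect (forall l, #|[pred i | g i == l]| = #|[pred i | h i == l]|) (samew g h).
Proof.
apply: (iffP idP) => [/samewP[s ->] l|gh].
  rewrite -(card_imset (mem [pred i | wperm g s i == l]) (@perm_inj _ s)); apply: eq_card => i.
  rewrite !inE; apply/idP/imsetP => [gl|[j]]; last by rewrite inE ffunE => gl ->.
  by exists (s^-1%g i); rewrite ?permKV // inE ffunE permKV.
have cnt m l : count_mem l [tuple m i | i < d] = #|[pred i | m i == l]|.
  by rewrite -sum1_count /= big_map big_enum_cond sum1_card.
have : perm_eq [tuple h i | i < d] [tuple g i | i < d].
  rewrite /perm_eq; apply/allP => l _; apply/eqP.
  by have := gh l; rewrite -!cnt => ->.
move/tuple_permP => [s hs]; apply/samewP; exists s; apply/ffunP => i.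
have {}hs : [tuple h i | i < d] = [tuple tnth [tuple g i | i < d] (s i) | i < d].
  exact: val_inj.
by have := congr1 (fun x => tnth x i) hs; rewrite !tnth_mktuple ffunE.
Qed.

Variable par : L -> bool.

(** The words on which an equivariant function may be nonzero, by [eqv_bad]: no odd
    letter is repeated. *)
Definition goodw g : Prop := forall i j, g i = g j -> par (g i) -> i = j.

Lemma goodw_perm g s : goodw g -> goodw (wperm g s).
Proof. by move=> gg i j; rewrite !ffunE => + + => /gg /[apply] /perm_inj. Qed.

Lemma goodw_same g h : samew g h -> goodw g -> goodw h.
Proof. by move=> /samewP[s ->]; apply: goodw_perm. Qed.

Definition sgn g s : k := (-1) ^+ sperm s (par \o g).

Lemma sgnM g s u : sgn g (u * s)%g = sgn g s * sgn (wperm g s) u.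
Proof.
rewrite /sgn spermM signr_addb; congr (_ * (-1) ^+ (nat_of_bool _)).
by apply: eq_sperm => i /=; rewrite ffunE.
Qed.

(** The stabiliser of a good word moves even letters only. *)
Lemma sgn_stab g s : goodw g -> wperm g s = g -> sgn g s = 1.
Proof.
move=> gg gs; rewrite /sgn sperm_fix // => i /= pi; apply/esym/gg => //.
by rewrite -{1}gs ffunE.
Qed.

Lemma sgnK g s : sgn g s * sgn g s = 1.
Proof. by rewrite -expr2 sqrr_sign. Qed.

Lemma sgn_eq g s u : goodw g -> wperm g s = wperm g u -> sgn g s = sgn g u.
Proof.
move=> gg su; rewrite -{1}(mulgKV u s) sgnM [sgn (wperm g u) _]sgn_stab ?mulr1 //.
  exact: goodw_perm.
by rewrite wpermM mulgKV.
Qed.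

Definition eqv (F : word -> k) : Prop := forall g s, F (wperm g s) = sgn g s * F g.

(** The signed indicator function of the orbit of a word; by [sgn_eq] its values on
    the orbit of a good word do not depend on the permutation that is picked. *)
Definition orb g0 g : k := if [pick s | g == wperm g0 s] is Some s then sgn g0 s else 0.

Lemma orb_perm g0 s : goodw g0 -> orb g0 (wperm g0 s) = sgn g0 s.
Proof.
move=> gg; rewrite /orb; case: pickP => [u /eqP su|/(_ s)]; last by rewrite eqxx.
exact: sgn_eq.
Qed.

Lemma orb_id g0 : goodw g0 -> orb g0 g0 = 1.
Proof. by move=> gg; rewrite -{2}(wperm1 g0) orb_perm // (sgn_stab gg) ?wperm1. Qed.

Lemma orb_out g0 g : ~~ samew g0 g -> orb g0 g = 0.
Proof.
by rewrite /orb; case: pickP => // s /eqP -> /negP[]; apply: samew_perm.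
Qed.

Lemma orb_neq0 g0 g : orb g0 g != 0 -> samew g0 g.
Proof. by apply: contra_neqT => /orb_out. Qed.

Lemma orb_eqv g0 : goodw g0 -> eqv (orb g0).
Proof.
move=> gg g s; have [/samewP[u ->]|ng] := boolP (samew g0 g).
  by rewrite wpermM !orb_perm // sgnM mulrC.
rewrite !orb_out ?mulr0 //; apply: contra ng => /samew_trans; apply.
by rewrite samew_sym samew_perm.
Qed.

(** An equivariant function on a single orbit is determined by one value. *)
Lemma eqv_orb F g0 : eqv F -> goodw g0 -> (forall g, F g != 0 -> samew g0 g) ->
  forall g, F g = F g0 * orb g0 g.
Proof.
move=> eF gg F0 g; have [/samewP[s ->]|ng] := boolP (samew g0 g).
  by rewrite eF orb_perm // mulrC.
by rewrite orb_out // mulr0; apply/eqP; apply: contraNT ng => /F0.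
Qed.

(** Exchanging two equal odd letters changes the sign of an equivariant function
    but not its argument. *)
Lemma eqv_bad F g : eqv F -> ~ goodw g -> F g = 0.
Proof.
move=> eF /existsNP[i /existsNP[j /not_implyP[gij /not_implyP[pi nij]]]].
have {}nij : i != j by apply/eqP.
apply: eqN_eq0; rewrite -mulN1r.
have -> : -1 = sgn g (tperm i j).
  by rewrite /sgn sperm_tperm //= -gij.
rewrite -eF; congr F; apply/ffunP => x; rewrite ffunE.
by case: tpermP => [->|->|].
Qed.

Lemma eqv_good F g : eqv F -> F g != 0 -> goodw g.
Proof. by move=> eF; apply: contra_neqP => ng; apply: eqv_bad. Qed.

Definition wrep g : word := odflt g [pick h | samew g h].

Lemma wrep_same g : samew g (wrep g).
Proof. by rewrite /wrep; case: pickP => //= _; apply: samew_refl. Qed.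

Lemma wrep_eq g h : samew g h -> wrep g = wrep h.
Proof.
move=> gh; rewrite /wrep; have e : samew g =1 samew h.
  by move=> m; apply/idP/idP; apply: samew_trans; rewrite // samew_sym.
rewrite (eq_pick e); case: pickP => // /(_ h); by rewrite samew_refl.
Qed.

Lemma eqv_decomp F g : eqv F ->
  F g = \sum_(h | (wrep h == h) && (F h != 0)) F h * orb h g.
Proof.
move=> eF; pose r := wrep g.
have Fr : samew r g by rewrite samew_sym wrep_same.
have rr : wrep r == r by rewrite -(wrep_eq (wrep_same g)).
have ez : forall h, (wrep h == h) && (F h != 0) -> h != r -> F h * orb h g = 0.
  move=> h /andP[/eqP hh _] nhr; rewrite orb_out ?mulr0 //.
  by apply: contra nhr => /wrep_eq; rewrite hh => ->.
have [F0|F0] := eqVneq (F g) 0.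
  rewrite F0 big1 // => h hP; have [hr|/(ez _ hP)//] := eqVneq h r.
  move: hP Fr => /andP[_ Fh]; rewrite -hr => /samewP[s gs]; move: F0; rewrite gs eF.
  by move/eqP; rewrite mulf_eq0 signr_eq0 (negbTE Fh).
have gr : goodw r by apply: goodw_same (wrep_same g) (eqv_good eF F0).
have /samewP[s gs] := Fr.
have Fg : F g = sgn r s * F r by rewrite gs eF.
rewrite (bigD1 r) /=; last by rewrite rr; apply: contra_neq F0; rewrite Fg => ->; rewrite mulr0.
rewrite big1 => [|h /andP[hP nhr]]; last exact: ez.
by rewrite addr0 {2}gs orb_perm // Fg mulrC.
Qed.

End Letters.

(** Words over a product alphabet are pairs of words. *)
Definition wzip (L M : finType) (g : {ffun 'I_d -> L}) (h : {ffun 'I_d -> M}) :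
  {ffun 'I_d -> L * M} := [ffun i => (g i, h i)].

Section Zip.
Variables (L M : finType).
Implicit Types (g : {ffun 'I_d -> L}) (h : {ffun 'I_d -> M}).

Lemma wzipE g h i : wzip g h i = (g i, h i).
Proof. exact: ffunE. Qed.

Lemma wzip_perm g h s : wperm (wzip g h) s = wzip (wperm g s) (wperm h s).
Proof. by apply/ffunP => i; rewrite !ffunE. Qed.

Lemma wzip_inj g h g' h' : wzip g h = wzip g' h' -> g = g' /\ h = h'.
Proof.
by move=> /ffunP e; split; apply/ffunP => i; have := e i; rewrite !ffunE => -[].
Qed.

Lemma samew_zipP g h g' h' :
  reflect (exists2 s, g' = wperm g s & h' = wperm h s) (samew (wzip g h) (wzip g' h')).
Proof.
apply: (iffP (samewP _ _)) => -[s]; first by rewrite wzip_perm => /wzip_inj[]; exists s.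
by move=> -> ->; exists s; rewrite wzip_perm.
Qed.

Lemma wunzip (w : {ffun 'I_d -> L * M}) : exists g h, w = wzip g h.
Proof.
exists [ffun i => (w i).1], [ffun i => (w i).2]; apply/ffunP => i.
by rewrite !ffunE -surjective_pairing.
Qed.

Lemma big_wzip (V : nmodType) (F : {ffun 'I_d -> L * M} -> V) :
  \sum_w F w = \sum_g \sum_h F (wzip g h).
Proof.
rewrite pair_bigA (reindex (fun p : {ffun 'I_d -> L} * {ffun 'I_d -> M} => wzip p.1 p.2)) //=.
exists (fun w => ([ffun i => (w i).1], [ffun i => (w i).2])) => [[g h] _|w _].
  by congr (_, _); apply/ffunP => i; rewrite !ffunE.
by apply/ffunP => i; rewrite !ffunE -surjective_pairing.
Qed.

End Zip.
End Words.

(** * Row tableaux and their products *)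

Section Submodules.
Variables (k : comNzRingType) (V : lmodType k) (S : set V).
Hypothesis sS : submodule S.
Implicit Types (v w : V).

Lemma submodule_sum (J : Type) (s : seq J) (f : J -> V) (P : pred J) :
  (forall j, P j -> S (f j)) -> S (\sum_(j <- s | P j) f j).
Proof.
move=> Sf; apply: (big_ind S) => //; first exact: sS.1.
by move=> x y Sx Sy; rewrite -[x]scale1r; apply: sS.2.
Qed.

Lemma submoduleZ c v : S v -> S (c *: v).
Proof. by move=> Sv; rewrite -[_ *: _]addr0; apply: sS.2 => //; apply: sS.1. Qed.

Lemma submoduleD v w : S v -> S w -> S (v + w).
Proof. by move=> Sv Sw; rewrite -[v]scale1r; apply: sS.2. Qed.

Lemma submoduleB v w : S v -> S w -> S (v - w).
Proof. by move=> Sv Sw; rewrite -scaleN1r addrC; apply: sS.2. Qed.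

Lemma submodule_sum_seq (J : eqType) (s : seq J) (f : J -> V) :
  (forall j, j \in s -> S (f j)) -> S (\sum_(j <- s) f j).
Proof. by move=> Sf; rewrite big_seq; apply: submodule_sum. Qed.

End Submodules.

(** The letters [r^x] of all components at once, each with the parity and the
    component of its colour; the injective ranking is the total order on letters. *)
Record alphabet (I : Type) := Alphabet {
  letter :> finType;
  par : letter -> bool;
  co : letter -> I;
  rk : letter -> nat;
  rk_inj : injective rk
}.

Lemma sum_neq0 (V : nmodType) (J : finType) (f : J -> V) :
  \sum_j f j != 0 -> exists j, f j != 0.
Proof.
move=> nz; apply: contrapT => /forallNP f0; move/eqP: nz; apply.
by apply: big1 => j _; apply/eqP/negPn/negP/f0.
Qed.

Section OrbitScalars.
Variables (k : idomainType) (d : nat) (L : finType) (pa : L -> bool).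

Lemma orb_same (g0 g1 : {ffun 'I_d -> L}) : goodw pa g0 -> samew g0 g1 ->
  exists2 c : k, c != 0 & forall g, orb k pa g0 g = c * orb k pa g1 g.
Proof.
move=> gg s01; exists (orb k pa g0 g1) => [|g].
  by have /samewP[s ->] := s01; rewrite orb_perm // signr_eq0.
apply: eqv_orb (orb_eqv _ gg) (goodw_same s01 gg) _ g => g /orb_neq0.
by apply: samew_trans; rewrite samew_sym.
Qed.

End OrbitScalars.

Section Products.
Variables (k : idomainType) (d n : nat) (I : finType).
Hypothesis k_char0 : [pchar k] =i pred0.
Notation R := (I * 'I_n)%type.
Notation word L := {ffun 'I_d -> L}.
Implicit Types (u v : word R).

Section OneAlphabet.
Variable X : alphabet I.
Implicit Types (p : word X).

Definition rpar (xv : X * R) : bool := par xv.1.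

(** A row tableau, encoded by the word [p] of its entries and the word [u] of
    the rows in which they lie; permuting the two words simultaneously does not
    change it. *)
Definition rowword p u : Prop :=
  (forall i, co (p i) = (u i).1) /\ goodw rpar (wzip p u).

(** Upper rows have larger factors, so that moving large letters down lowers the
    weight. *)
Definition wt p u : nat := (\sum_i rk (p i) * (n - (u i).2))%N.

Lemma wt_perm p u s : wt (wperm p s) (wperm u s) = wt p u.
Proof.
rewrite /wt [RHS](reindex_inj (@perm_inj _ s)).
by apply: eq_bigr => i _; rewrite !ffunE.
Qed.

(** In each orbit that meets the support, a representative can be chosen whose word
    of rows is [u]. *)
Lemma eqv_span_row (F : word (X * R) -> k) u : eqv rpar F ->
    (forall p v, F (wzip p v) != 0 -> (forall i, co (p i) = (v i).1) /\ samew u v) ->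
  exists s : seq (k * word X),
    (forall x, x \in s -> rowword x.2 u /\ F (wzip x.2 u) != 0) /\
    forall g, F g = \sum_(x <- s) x.1 * orb k rpar (wzip x.2 u) g.
Proof.
move=> eF sF.
pose P (h : word (X * R)) := (wrep h == h) && (F h != 0).
have ex (h : word (X * R)) : exists x : k * word X, P h ->
    (rowword x.2 u /\ F (wzip x.2 u) != 0) /\
    forall g, F h * orb k rpar h g = x.1 * orb k rpar (wzip x.2 u) g.
  have [/andP[_ Fh]|] := boolP (P h); last by exists (0, [ffun i => (h i).1]).
  have [p [v hE]] := wunzip h; rewrite hE in Fh *.
  have [cpv /samewP[s vE]] := sF _ _ Fh.
  have gh := eqv_good k_char0 eF Fh.
  have hs : wzip (wperm p s^-1%g) u = wperm (wzip p v) s^-1%g by rewrite wzip_perm vE wpermK.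
  have [c c0 cE] := @orb_same k d _ rpar _ _ gh (samew_perm (wzip p v) s^-1%g).
  exists (F (wzip p v) * c, wperm p s^-1%g) => _ /=; rewrite !hs; split; last first.
    by move=> g; rewrite cE mulrA.
  split; last by rewrite eF mulf_neq0 // signr_eq0.
  split=> [i|]; last by rewrite hs; apply: goodw_perm.
  by rewrite ffunE cpv vE ffunE permKV.
have {ex} [f fP] := choice ex.
exists [seq f h | h <- index_enum _ & P h]; split.
  by move=> x /mapP[h]; rewrite mem_filter => /andP[/fP[? _] _] ->.
move=> g; rewrite (eqv_decomp k_char0 g eF) big_map big_filter.
by apply: eq_bigr => h /fP[_ ->].
Qed.

Definition wfst (L M : finType) (g : word (L * M)) : word L := [ffun i => (g i).1].
Definition wsnd (L M : finType) (g : word (L * M)) : word M := [ffun i => (g i).2].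

Lemma wfst_zip (L M : finType) (g : word L) (h : word M) : wfst (wzip g h) = g.
Proof. by apply/ffunP => i; rewrite !ffunE. Qed.

Lemma wsnd_zip (L M : finType) (g : word L) (h : word M) : wsnd (wzip g h) = h.
Proof. by apply/ffunP => i; rewrite !ffunE. Qed.

(** The action on row tableaux of an invariant relation between words of rows,
    i.e. of an element of the Schur algebra. *)
Definition rowact (Z : rel (word R)) (F : word (X * R) -> k) (g : word (X * R)) : k :=
  \sum_v (Z (wsnd g) v)%:R * F (wzip (wfst g) v).

Lemma rowact_eqv Z F : (forall v w s, Z (wperm v s) (wperm w s) = Z v w) ->
  eqv rpar F -> eqv rpar (rowact Z F).
Proof.
move=> Zs eF g s; have [p [v ->]] := wunzip g.
rewrite wzip_perm /rowact !wfst_zip !wsnd_zip mulr_sumr.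
rewrite (reindex (@wperm d R ^~ s)) /=; last exact/onW_bij/wperm_bij.
apply: eq_bigr => w _; rewrite Zs -wzip_perm eF mulrCA; congr (_ * _).
by congr (_ ^+ nat_of_bool _); apply: eq_sperm => i; rewrite /rpar /= !ffunE.
Qed.

End OneAlphabet.

(** Rows are the column indices of the left factor and the row indices of the right
    one, so the product of two tensors sums over them. *)
Definition kerG (X Y : alphabet I) (F : word (X * R) -> k) (G : word (Y * R) -> k) :
    {ffun word X * word Y -> k^o} :=
  [ffun pq => \sum_u F (wzip pq.1 u) * G (wzip pq.2 u)].

(** The kernel of the product of the row tableaux [(p, u)] and [(q, u)]. *)
Definition tabker (X Y : alphabet I) (p : word X) u (q : word Y) :=
  kerG (orb k (@rpar X) (wzip p u)) (orb k (@rpar Y) (wzip q u)).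

Section TwoAlphabets.
Variables (X Y : alphabet I).
Implicit Types (p : word X) (q : word Y).

Lemma kerG_sumr F (J : Type) (s : seq J) (c : J -> k) (G : J -> word (Y * R) -> k) G0 :
  (forall g, G0 g = \sum_(j <- s) c j * G j g) ->
  kerG F G0 = \sum_(j <- s) c j *: @kerG X Y F (G j).
Proof.
move=> GE; apply/ffunP => pq; rewrite sum_ffunE !ffunE.
under [RHS]eq_bigr => j _ do rewrite !ffunE scaler_sumr.
rewrite exchange_big /=; apply: eq_bigr => u _; rewrite GE mulr_sumr.
by apply: eq_bigr => j _; rewrite mulrCA.
Qed.

Lemma kerG_suml G (J : Type) (s : seq J) (c : J -> k) (F : J -> word (X * R) -> k) F0 :
  (forall g, F0 g = \sum_(j <- s) c j * F j g) ->
  kerG F0 G = \sum_(j <- s) c j *: @kerG X Y (F j) G.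
Proof.
move=> FE; apply/ffunP => pq; rewrite sum_ffunE !ffunE.
under [RHS]eq_bigr => j _ do rewrite !ffunE scaler_sumr.
rewrite exchange_big /=; apply: eq_bigr => u _; rewrite FE mulr_suml.
by apply: eq_bigr => j _; rewrite -mulrA.
Qed.

(** The Schur algebra acts on the words of rows, which are summed over, so its action
    on one factor can be moved to the other as its transpose. *)
Lemma kerG_rowact (Z Z' : rel (word R)) (F : word (X * R) -> k) (G : word (Y * R) -> k) :
  (forall v w, Z' w v = Z v w) -> kerG (rowact Z F) G = kerG F (rowact Z' G).
Proof.
move=> ZZ; apply/ffunP => pq; rewrite !ffunE /rowact.
under eq_bigr => u _ do rewrite mulr_suml.
rewrite exchange_big /=; apply: eq_bigr => v _; rewrite mulr_sumr.
apply: eq_bigr => w _; rewrite !wfst_zip !wsnd_zip ZZ.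
by rewrite -mulrA mulrCA.
Qed.

End TwoAlphabets.

(** * Straightening *)

Section Violation.
Variables (X : alphabet I) (p : word X) (u : word R).
Variables (r1 r2 r3 : R) (a b : X).
Hypotheses (rwpu : rowword p u) (co12 : r1.1 = r2.1) (co13 : r1.1 = r3.1).
Hypothesis lt12 : (r1.2 < r2.2)%N.
Hypotheses (leba : (rk b <= rk a)%N) (eqab : a = b -> ~~ par a).

Definition rowlen v (r : R) : nat := #|[pred i | v i == r]|.

(** The analogue of a Garnir belt: the entries of the upper row from the violation to
    the right, and those of the lower row from the violation to the left. *)
Definition mid i : bool :=
  (u i == r1) && (rk a <= rk (p i))%N || (u i == r2) && (rk (p i) <= rk b)%N.

Hypothesis fresh : forall i, u i = r2 -> ~~ mid i -> r1 != r3 /\ forall j, u j != r3.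
Hypothesis mid_long : (rowlen u r1 < #|[pred i | mid i]|)%N.
Hypothesis len12 : (rowlen u r2 <= rowlen u r1)%N.

(** The letters of rows [r1] and [r2] around the violation are gathered in the
    single row [r1]; the others go to [r2] and to the empty row [r3]. *)
Definition gather : word R :=
  [ffun i => if mid i then r1 else if u i == r1 then r2 else if u i == r2 then r3 else u i].

Lemma ne12 : r1 != r2.
Proof. by apply: contraTneq lt12 => ->; rewrite ltnn. Qed.

Lemma mid_rows i : mid i -> u i = r1 \/ u i = r2.
Proof. by move=> /orP[]/andP[/eqP ? _]; [left|right]. Qed.

Lemma gather1 i : (gather i == r1) = mid i.
Proof.
rewrite ffunE; case: ifP => [_|nm]; first by rewrite eqxx.
case: (eqVneq (u i) r1) => [_|n1]; first by rewrite eq_sym (negbTE ne12).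
case: (eqVneq (u i) r2) => [u2|_]; last by rewrite (negbTE n1).
by have [ne13 _] := fresh u2 (negbT nm); rewrite eq_sym (negbTE ne13).
Qed.

Lemma gather2 i : (gather i == r2) = (u i == r1) && ~~ mid i.
Proof.
rewrite ffunE; case: ifP => [m|nm]; first by rewrite (negbTE ne12) andbF.
case: (eqVneq (u i) r1) => [_|_]; first by rewrite eqxx.
case: (eqVneq (u i) r2) => [u2|n2]; last by rewrite (negbTE n2).
by have [_ /(_ i)] := fresh u2 (negbT nm); rewrite u2 eq_sym => /negbTE.
Qed.

Lemma gather3 i : (u i == r2) && ~~ mid i -> gather i == r3.
Proof.
case/andP => /eqP ui2 nm; rewrite ffunE (negbTE nm) ui2.
by rewrite [r2 == r1]eq_sym (negbTE ne12) !eqxx.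
Qed.

Lemma gather3r i j : u j = r2 -> ~~ mid j -> gather i = r3 -> (u i == r2) && ~~ mid i.
Proof.
move=> uj nmj; have [ne13 fr] := fresh uj nmj.
rewrite ffunE; case: ifP => [_ /eqP|nm]; first by rewrite (negbTE ne13).
case: (eqVneq (u i) r1) => [_ /eqP|_]; first by rewrite -uj (negbTE (fr j)).
by case: (eqVneq (u i) r2) => [//|_ /eqP]; rewrite (negbTE (fr i)).
Qed.

Lemma gather_other i : u i != r1 -> u i != r2 -> gather i = u i.
Proof.
move=> n1 n2; rewrite ffunE (negbTE n1) (negbTE n2); case: ifP => // /mid_rows[]e.
  by rewrite e eqxx in n1.
by rewrite e eqxx in n2.
Qed.

Lemma gather_co i : (gather i).1 = (u i).1.
Proof.
have [m|nm] := boolP (mid i).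
  have /eqP -> : gather i == r1 by rewrite gather1.
  by case: (mid_rows m) => ->.
rewrite ffunE (negbTE nm).
case: (eqVneq (u i) r1) => [->|_] //; case: (eqVneq (u i) r2) => [->|_] //.
by rewrite -co13.
Qed.

Lemma gather_same i j :
  gather i = gather j -> u i = u j \/ mid i /\ mid j.
Proof.
move=> gij.
have [mi|nmi] := boolP (mid i); first by right; rewrite -!gather1 -gij gather1 mi.
have nmj : ~~ mid j by rewrite -gather1 -gij gather1.
left; have [ui|ui1] := eqVneq (u i) r1.
  have : gather j == r2 by rewrite -gij gather2 ui eqxx.
  by rewrite gather2 => /andP[/eqP -> _].
have [uj|uj1] := eqVneq (u j) r1.
  have : gather i == r2 by rewrite gij gather2 uj eqxx.
  by rewrite gather2 (negbTE ui1).
have [ui|ui2] := eqVneq (u i) r2.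
  have /eqP g3 : gather i == r3 by apply: gather3; rewrite ui eqxx.
  by rewrite gij in g3; have /andP[/eqP -> _] := gather3r ui nmi g3.
have [uj|uj2] := eqVneq (u j) r2.
  have /eqP g3 : gather j == r3 by apply: gather3; rewrite uj eqxx.
  by rewrite -gij in g3; have /andP[/eqP -> _] := gather3r uj nmj g3.
by rewrite -(gather_other ui1 ui2) gij gather_other.
Qed.

(** Letters of the two rows that are gathered can agree only if [a = b], and then they
    are even. *)
Lemma rowword_gather : rowword p gather.
Proof.
have [cpu gpu] := rwpu; split=> [i|i j]; first by rewrite gather_co.
rewrite [wzip _ _ i]ffunE [wzip _ _ j]ffunE => -[pij gij]; rewrite /rpar /= => odd_i.
have gu : u i = u j -> i = j.
  by move=> uij; apply: gpu; rewrite !ffunE ?pij ?uij // -pij.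
have clash x y : u x = r1 -> u y = r2 -> mid x -> mid y -> p x = p y -> ~~ par (p x).
  rewrite /mid => -> ->; rewrite !eqxx [r2 == r1]eq_sym (negbTE ne12) /= orbF => ax yb pxy.
  have ra : rk a = rk (p x).
    by apply/eqP; rewrite eqn_leq ax pxy (leq_trans yb).
  have rb : rk b = rk (p x).
    by apply/eqP; rewrite eqn_leq {2}pxy yb andbT (leq_trans leba) ?ra.
  have -> : p x = a by apply: rk_inj.
  by apply: eqab; apply: rk_inj; rewrite ra rb.
case: (gather_same gij) => [//|[mi mj]].
case: (mid_rows mi) (mid_rows mj) => ui [] uj; try by apply: gu; rewrite ui uj.
  by have := clash _ _ ui uj mi mj pij; rewrite odd_i.
by have := clash _ _ uj ui mj mi (esym pij); rewrite -pij odd_i.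
Qed.

(** Hence a single term contributes to the coefficient of [(p, u)] in [straighten]. *)
Lemma gather_unique v :
  samew (wzip gather u) (wzip v u) -> samew (wzip p gather) (wzip p v) -> v = gather.
Proof.
move=> s1 s2; have /samewP[s /ffunP e1] := s1; have /samewP[s' /ffunP e2] := s2.
have {}e1 i : v i = gather (s i) /\ u i = u (s i) by have := e1 i; rewrite !ffunE => -[].
have {}e2 i : p i = p (s' i) /\ v i = gather (s' i) by have := e2 i; rewrite !ffunE => -[].
have tr (r r' : R) : (forall i, v i = r -> u i = r' -> gather i = r) ->
    forall i, u i = r' -> (v i == r) = (gather i == r).
  move=> sub i ui; have /samew_count/(_ (r, r')) := s1.
  move/esym/subset_cardP => cardP.
  have /cardP vg : [pred i | wzip v u i == (r, r')] \subset [pred i | wzip gather u i == (r, r')].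
    apply/fintype.subsetP => j; rewrite !inE [wzip v u j]ffunE [wzip gather u j]ffunE.
    by rewrite !xpair_eqE => /andP[/eqP vj /eqP uj]; rewrite uj sub ?eqxx.
  have := vg i; rewrite !inE [wzip v u i]ffunE [wzip gather u i]ffunE.
  by rewrite !xpair_eqE ui eqxx !andbT.
apply/ffunP => i; have [vi ui] := e1 i.
have [u1|n1] := eqVneq (u i) r1.
  have key : (v i == r2) = (gather i == r2).
    apply: tr u1 => j vj uj; have [pj vj'] := e2 j; rewrite vj in vj'.
    have : gather (s' j) == r2 by rewrite -vj'.
    rewrite gather2 => /andP[/eqP us nms].
    apply/eqP; rewrite gather2 uj eqxx /=; apply: contra nms.
    by rewrite /mid uj us pj.
  have two x : u x = r1 -> gather x = if gather x == r2 then r2 else r1.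
    move=> ux; case: ifP => [/eqP //|]; rewrite gather2 ux eqxx /= => /negbFE.
    by rewrite -gather1 => /eqP.
  by rewrite (two i u1) -key vi -two // -ui.
have [u2|n2] := eqVneq (u i) r2.
  have [/existsP[j0 /andP[/eqP uj0 nm0]]|/existsPn nex] :=
    boolP [exists j, (u j == r2) && ~~ mid j]; last first.
    have g1 x : u x = r2 -> gather x = r1.
      by move=> ux; apply/eqP; have := nex x; rewrite gather1 ux eqxx negbK.
    by rewrite vi !g1 -?ui.
  have [ne13 fr] := fresh uj0 nm0.
  have key : (v i == r3) = (gather i == r3).
    apply: tr u2 => j vj uj; have [pj vj'] := e2 j; rewrite vj in vj'.
    have /andP[/eqP us nms] := gather3r uj0 nm0 (esym vj').
    apply/eqP/gather3; rewrite uj eqxx /=; apply: contra nms.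
    by rewrite /mid uj us pj.
  have two x : u x = r2 -> gather x = if gather x == r3 then r3 else r1.
    move=> ux; have [m|nm] := boolP (mid x).
      by move: (m); rewrite -gather1 => /eqP ->; rewrite (negbTE ne13).
    by have /eqP -> : gather x == r3; [apply: gather3; rewrite ux eqxx|rewrite eqxx].
  by rewrite (two i u2) -key vi -two // -ui.
by rewrite vi !gather_other -?ui.
Qed.

Definition shapewt v : nat := (\sum_(r : R) 2 ^ rowlen v r)%N.

(** A row of length at least [m + 1] contributes at least as much as two rows of length at
    most [m], and the rows that receive the other letters add to this. *)
Lemma shapewt_gather : (shapewt u < shapewt gather)%N.
Proof.
have n21 : r2 != r1 by rewrite eq_sym ne12.
rewrite /shapewt (bigD1 r1) // (bigD1 r2) //= [X in (_ < X)%N](bigD1 r1) // [X in (_ < _ + X)%N](bigD1 r2) //=.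
rewrite !addnA -addSn leq_add //; last first.
  apply: leq_sum => r /andP[rn1 rn2]; rewrite leq_exp2l //; apply: subset_leq_card.
  by apply/fintype.subsetP => i; rewrite !inE => /eqP ui; rewrite gather_other ui.
have -> : rowlen gather r1 = #|[pred i | mid i]|.
  by apply: eq_card => i; rewrite !inE gather1.
rewrite -addn1 leq_add ?expn_gt0 //.
apply: leq_trans (_ : 2 ^ (rowlen u r1).+1 <= _)%N; last by rewrite leq_exp2l.
by rewrite expnS mul2n -addnn leq_add2l leq_exp2l.
Qed.

(** Letters other than [a] do not move, so their numbers in a row agree, and then the
    number of letters [a] is fixed by the length of the row. *)
Lemma rowlen_split (v w : word R) r :
  (forall i, p i = a \/ v i = w i) -> rowlen v r = rowlen w r ->
  forall x, #|[pred i | (p i == x) && (v i == r)]| = #|[pred i | (p i == x) && (w i == r)]|.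
Proof.
move=> vw rvw x.
have other y : y != a ->
    #|[pred i | (p i == y) && (v i == r)]| = #|[pred i | (p i == y) && (w i == r)]|.
  move=> ya; apply: eq_card => i; rewrite !inE.
  by case: (vw i) => [->|->//]; rewrite eq_sym (negbTE ya).
have [->|/other //] := eqVneq x a.
have split v' : rowlen v' r = \sum_y #|[pred i | (p i == y) && (v' i == r)]|.
  rewrite /rowlen -sum1_card (partition_big p predT) //=.
  by apply: eq_bigr => y _; rewrite -sum1_card; apply: eq_bigl => i; rewrite !inE andbC.
move: rvw; rewrite !split (bigD1 a) //= [in RHS](bigD1 a) //=.
by rewrite (eq_bigr _ other) => /addIn.
Qed.

(** Permuting the gathered letters trades large letters of the upper row for
    small letters of the lower one, so that the weight can only drop. *)
Lemma wt_gather s : wperm gather s = gather ->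
  samew (wzip p u) (wzip (wperm p s) u) \/ (wt (wperm p s) u < wt p u)%N.
Proof.
move=> gs; pose y := wperm u s^-1%g.
have gsi i : gather (s^-1%g i) = gather i by rewrite -{1}gs ffunE permKV.
have moved i : y i = u i \/ mid i /\ ((u i = r1 /\ y i = r2) \/ (u i = r2 /\ y i = r1)).
  rewrite ffunE; case: (gather_same (gsi i)) => [|[m1 m2]]; first by left.
  by case: (mid_rows m1) (mid_rows m2) => -> [] ->; auto.
pose D i := (u i == r1) && (y i == r2); pose U i := (u i == r2) && (y i == r1).
have n21 : r2 == r1 = false by rewrite eq_sym (negbTE ne12).
have leny r : rowlen y r = rowlen u r.
  rewrite /rowlen; have /samew_count/(_ r) := samew_perm u s^-1%g.
  by move=> ->.
have cardDU : #|[pred i | D i]| = #|[pred i | U i]|.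
  have both (v w : word R) : rowlen v r1 = (#|[pred i | (v i == r1) && (w i == r1)]| +
      #|[pred i | (v i == r1) && (w i != r1)]|)%N.
    by rewrite /rowlen -(cardID [pred i | w i == r1]); congr addn;
       apply: eq_card => i; rewrite !inE // andbC.
  have := leny r1; rewrite (both u y) (both y u) => e.
  have {}e : #|[pred i | (y i == r1) && (u i != r1)]| = #|[pred i | (u i == r1) && (y i != r1)]|.
    move: e; set P := #|_|; set Q := #|_|; set P' := #|_| => e.
    have PP : P = P' by apply: eq_card => i; rewrite !inE andbC.
    by move: e; rewrite PP => /addnI.
  rewrite (_ : #|[pred i | D i]| = #|[pred i | (u i == r1) && (y i != r1)]|); last first.
    apply: eq_card => i; rewrite !inE /D; case: (moved i) => [->|[_ [][-> ->]]].
    - by case: (eqVneq (u i) r1) => [->|_] //=; rewrite (negbTE ne12).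
    - by rewrite !eqxx n21.
    - by rewrite n21.
  rewrite -e; apply: eq_card => i; rewrite !inE /U andbC; case: (moved i) => [->|[_ [][-> ->]]].
  - by case: (eqVneq (u i) r1) => [->|_] //=; rewrite ?(negbTE ne12) ?andbF // eqxx.
  - by rewrite n21 ?andbF.
  - by rewrite !eqxx n21.
have wty : wt (wperm p s) u = (\sum_i rk (p i) * (n - (y i).2))%N.
  rewrite /wt (reindex_inj (@perm_inj _ s^-1%g)); apply: eq_bigr => i _.
  by rewrite !ffunE permKV.
pose dl := ((r2.2 : nat) - r1.2)%N.
have bal : (wt (wperm p s) u + dl * \sum_(i | D i) rk (p i)
            = wt p u + dl * \sum_(i | U i) rk (p i))%N.
  rewrite wty /wt !big_distrr /= (big_mkcond D) (big_mkcond U) -!big_split /=.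
  apply: eq_bigr => i _; rewrite /D /U /dl.
  have r1n := ltn_ord r1.2; have r2n := ltn_ord r2.2.
  case: (moved i) => [->|[_ [][-> ->]]].
  - by case: (eqVneq (u i) r1) => [->|_]; rewrite ?(negbTE ne12) ?andbF.
  - rewrite !eqxx n21 (negbTE ne12) /= addn0 [(_ * rk _)%N]mulnC -mulnDr; congr (_ * _)%N.
    by move: lt12; lia.
  - rewrite !eqxx n21 (negbTE ne12) /= addn0 [X in (_ = _ + X)%N]mulnC -mulnDr; congr (_ * _)%N.
    by move: lt12; lia.
pose A := rk a.
have hD : (\sum_(i | D i) rk (p i) = #|[pred i | D i]| * A + \sum_(i | D i) (rk (p i) - A))%N.
  rewrite -sum_nat_const -big_split /=; apply: eq_bigr => i Di.
  rewrite subnKC //; move: Di => /andP[/eqP ui /eqP yi].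
  case: (moved i) => [yu|[m _]]; first by move: ne12; rewrite -ui -yu yi eqxx.
  by move: m; rewrite /mid ui eqxx (negbTE ne12) orbF.
have hU : (\sum_(i | U i) rk (p i) + \sum_(i | U i) (A - rk (p i)) = #|[pred i | U i]| * A)%N.
  rewrite -sum_nat_const -big_split /=; apply: eq_bigr => i Ui.
  rewrite subnKC //; move: Ui => /andP[/eqP ui /eqP yi].
  case: (moved i) => [yu|[m _]]; first by move: ne12; rewrite -ui -yu yi eqxx.
  by move: m; rewrite /mid ui eqxx n21 /= => /leq_trans; apply.
have dl0 : (0 < dl)%N by rewrite subn_gt0.
case: (posnP (\sum_(i | D i) (rk (p i) - A) + \sum_(i | U i) (A - rk (p i)))%N) => [/eqP|pos]; last first.
  right; have : (dl * \sum_(i | U i) rk (p i) < dl * \sum_(i | D i) rk (p i))%N.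
    by rewrite ltn_pmul2l // hD cardDU -hU -addnA -[X in (X < _)%N]addn0 ltn_add2l addnC.
  by move: bal; lia.
rewrite addn_eq0 !sum_nat_eq0 => /andP[/forallP zD /forallP zU]; left.
have pa i : p i = a \/ y i = u i.
  case: (moved i) => [|[m [] [ui yi]]]; [by right|left..]; apply: rk_inj; apply/eqP.
    have := zD i; rewrite /D ui yi !eqxx /= subn_eq0 eqn_leq => ->.
    by move: m; rewrite /mid ui eqxx (negbTE ne12) orbF.
  have := zU i; rewrite /U ui yi !eqxx /= subn_eq0 eqn_leq => ->; rewrite andbT.
  by move: m; rewrite /mid ui eqxx n21 /= => /leq_trans; apply.
have -> : wzip (wperm p s) u = wperm (wzip p y) s by rewrite wzip_perm wpermKV.
apply: (samew_trans _ (samew_perm _ s)).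
apply/samew_count => -[x r].
have := rowlen_split pa (leny r) x => e.
transitivity #|[pred i | (p i == x) && (u i == r)]|.
  by apply: eq_card => i; rewrite !inE ffunE xpair_eqE.
by rewrite -e; apply: eq_card => i; rewrite !inE [wzip _ _ i]ffunE xpair_eqE.
Qed.

(** Straightening. The Schur algebra maps the row tableau [(p, gather)], whose shape is
    larger, to [(p, u)] plus row tableaux of shape [u] and smaller weight; moving its
    action to the other factor leaves products of shape [gather]. *)
Lemma straighten (Y : alphabet I) (S : set {ffun word X * word Y -> k^o})
    (G : word (Y * R) -> k) :
    submodule S -> eqv (@rpar Y) G ->
    (forall q v, G (wzip q v) != 0 -> (forall i, co (q i) = (v i).1) /\ samew u v) ->
    (forall q, rowword q gather -> S (tabker p gather q)) ->
    (forall p', rowword p' u -> (wt p' u < wt p u)%N ->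
      S (kerG (orb k (@rpar X) (wzip p' u)) G)) ->
  S (kerG (orb k (@rpar X) (wzip p u)) G).
Proof.
move=> sS eG sG IHg IHw.
have [cpu gpu] := rwpu; have [cpg gpg] := rowword_gather.
pose Z v w := samew (wzip gather u) (wzip w v).
pose F := rowact Z (orb k (@rpar X) (wzip p gather)).
have Zs v w s : Z (wperm v s) (wperm w s) = Z v w.
  rewrite /Z -wzip_perm; apply/idP/idP; last by move/samew_trans; apply; apply: samew_perm.
  by move/samew_trans; apply; rewrite samew_sym samew_perm.
have eF : eqv (@rpar X) F by apply: rowact_eqv => //; apply: orb_eqv.
have Fpu : F (wzip p u) = 1.
  rewrite /F /rowact wfst_zip wsnd_zip (bigD1 gather) //= /Z samew_refl mul1r orb_id //.
  rewrite big1 ?addr0 // => v; apply: contra_neqP => /eqP nz; apply: gather_unique.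
    by apply: contraNT nz => /negbTE ->; rewrite mul0r.
  by apply: (@orb_neq0 k _ _ (@rpar X)); apply: contra nz => /eqP ->; rewrite mulr0.
have Fsup p' v : F (wzip p' v) != 0 -> exists2 w,
    samew (wzip gather u) (wzip w v) & samew (wzip p gather) (wzip p' w).
  rewrite /F /rowact wfst_zip wsnd_zip => /sum_neq0[w].
  rewrite mulf_eq0 negb_or => /andP[Zvw /orb_neq0 pw]; exists w => //.
  by move: Zvw; rewrite /Z; case: samew; rewrite ?eqxx.
pose F' g := F g - orb k (@rpar X) (wzip p u) g.
have eF' : eqv (@rpar X) F'.
  by move=> g s; rewrite /F' eF orb_eqv // mulrBr.
have F'sup p' v : F' (wzip p' v) != 0 -> (forall i, co (p' i) = (v i).1) /\ samew u v.
  have supo : orb k (@rpar X) (wzip p u) (wzip p' v) != 0 ->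
      (forall i, co (p' i) = (v i).1) /\ samew u v.
    move=> /orb_neq0/samew_zipP[s -> ->]; split; last exact: samew_perm.
    by move=> i; rewrite !ffunE.
  move=> nz; have [o0|/supo//] := eqVneq (orb k (@rpar X) (wzip p u) (wzip p' v)) 0.
  have {nz}: F (wzip p' v) != 0 by move: nz; rewrite /F' o0 subr0.
  case/Fsup => w /samew_zipP[s wE ->] /samew_zipP[s' p'E wE']; split; last exact: samew_perm.
  move=> i; rewrite p'E [wperm p s' i]ffunE [wperm u s i]ffunE cpu.
  have := congr1 (fun x : word R => (x i).1) wE.
  by rewrite wE' [wperm _ _ i]ffunE [wperm _ s i]ffunE !gather_co.
have [s [sP F'E]] := eqv_span_row eF' F'sup.
have oE g : orb k (@rpar X) (wzip p u) g = F g - F' g by rewrite /F' subKr.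
have -> : kerG (orb k (@rpar X) (wzip p u)) G = kerG F G - kerG F' G.
  apply/ffunP => pq; rewrite !ffunE -sumrB; apply: eq_bigr => v _.
  by rewrite -mulrBl -oE.
apply: submoduleB => //; last first.
  rewrite (kerG_suml G F'E); apply: submodule_sum_seq => // x xs.
  apply: submoduleZ => //; have [rx nz] := sP x xs; apply: IHw => //.
  have npx : ~~ samew (wzip p u) (wzip x.2 u).
    apply: contraNN nz => /samewP[s' ->]; rewrite eF' /F' Fpu orb_id //.
    by rewrite subrr mulr0.
  have : F (wzip x.2 u) != 0 by move: nz; rewrite /F' orb_out // subr0.
  case/Fsup => w /samew_zipP[s' wE uE] /samew_zipP[s2 xE wE'].
  have gs : wperm gather (s'^-1 * s2)%g = gather.
    by rewrite -wpermM -wE' wE wpermK.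
  have us : wperm u s'^-1%g = u by rewrite {1}uE wpermK.
  have xs' : wperm p (s'^-1 * s2)%g = wperm x.2 s'^-1%g by rewrite -wpermM -xE.
  case: (wt_gather gs); rewrite xs'; last by rewrite -{1}us wt_perm.
    rewrite -{2}us -wzip_perm => pu; case/negP: npx; apply: samew_trans pu _.
    by rewrite samew_sym samew_perm.
rewrite (@kerG_rowact X Y Z (fun w v => Z v w)) //.
have eG' : eqv (@rpar Y) (rowact (fun w v => Z v w) G) by apply: rowact_eqv.
have sG' q v : rowact (fun w v => Z v w) G (wzip q v) != 0 ->
    (forall i, co (q i) = (v i).1) /\ samew gather v.
  rewrite /rowact wfst_zip wsnd_zip => /sum_neq0[w].
  rewrite mulf_eq0 negb_or => /andP[Zvw /sG[cq _]].
  have /samew_zipP[s' vE wE] : Z w v by move: Zvw; case: (Z w v); rewrite ?eqxx.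
  split; last by rewrite vE samew_perm.
  by move=> i; rewrite cq vE wE [wperm _ _ i]ffunE [wperm gather _ i]ffunE gather_co.
have [s' [s'P G'E]] := eqv_span_row eG' sG'.
rewrite (kerG_sumr _ G'E); apply: submodule_sum_seq => // x /s'P[rx _].
by apply: submoduleZ => //; apply: IHg.
Qed.

End Violation.
End Products.

(** * Standard tableaux span *)

Section StandardWords.
Variables (d n : nat) (I : finType).
Notation R := (I * 'I_n)%type.
Notation word L := {ffun 'I_d -> L}.

Section OneAlphabet.
Variable X : alphabet I.
Implicit Types (p : word X) (u : word R) (w : word 'I_d).

(** Standard tableaux: [(u i, w i)] is the node carrying the entry [p i]. *)
Record stdw p u w : Prop := Stdw {
  std_co : forall i, co (p i) = (u i).1;
  std_inj : forall i j, u i = u j -> w i = w j -> i = j;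
  std_left : forall i c, (c < w i)%N -> exists2 j, u j = u i & w j = c :> nat;
  std_up : forall i (r : 'I_n), (r < (u i).2)%N -> exists2 j, u j = ((u i).1, r) & w j = w i;
  std_row : forall i j, u i = u j -> (w i < w j)%N ->
    (rk (p i) <= rk (p j))%N /\ (p i = p j -> ~~ par (p i));
  std_col : forall i j, (u i).1 = (u j).1 -> ((u i).2 < (u j).2)%N -> w i = w j ->
    (rk (p i) <= rk (p j))%N /\ (p i = p j -> par (p i))
}.

(** Rows repeat even letters only, so equal odd letters lie in different rows. *)
Lemma stdw_rowword p u w : stdw p u w -> rowword p u.
Proof.
move=> S; split=> [i|i j]; first exact: std_co S i.
rewrite !ffunE => -[pij uij]; rewrite /rpar /= => odd_i.
have [wij|wij|wij] := ltngtP (w i) (w j).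
- by have [_ /(_ pij)] := std_row S uij wij; rewrite odd_i.
- by have [_ /(_ (esym pij))] := std_row S (esym uij) wij; rewrite -pij odd_i.
- by apply: std_inj S _ _ uij (val_inj wij).
Qed.

Variables (p : word X) (u : word R).

(** The entries to the left of a given one when its row is sorted; equal letters
    are kept in the order of their positions. *)
Definition before j i : bool :=
  (u j == u i) && ((rk (p j) < rk (p i)) || (p j == p i) && (j < i))%N.

Lemma before_irr i : before i i = false.
Proof. by rewrite /before eqxx !ltnn andbF. Qed.

Lemma before_trans : transitive before.
Proof.
move=> j i m; rewrite /before => /andP[/eqP -> ij] /andP[/eqP -> jm]; rewrite eqxx /=.
case/orP: ij jm => [ij|/andP[/eqP -> ij]] /orP[jm|/andP[/eqP <- jm]].
- by rewrite (ltn_trans ij jm).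
- by rewrite ij.
- by rewrite jm.
- by rewrite eqxx (ltn_trans ij jm) orbT.
Qed.

Lemma before_total i j : u i = u j -> i != j -> before i j || before j i.
Proof.
move=> uij nij; rewrite /before uij eqxx /=.
have [_|_|rij] := ltngtP (rk (p i)) (rk (p j)); rewrite ?orbT //= (rk_inj rij) eqxx /=.
by move: nij; rewrite -val_eqE /=; case: ltngtP.
Qed.

Lemma before_rk i j : before i j -> (rk (p i) <= rk (p j))%N.
Proof. by case/andP=> _ /orP[/ltnW //|/andP[/eqP -> _]]. Qed.

Fact colpos_subproof i : (#|[pred j | before j i]| < d)%N.
Proof.
rewrite -[X in (_ < X)%N]card_ord; apply: proper_card.
apply/properP; split; first exact/fintype.subsetP.
by exists i => //; rewrite inE before_irr.
Qed.

Definition colpos : word 'I_d := [ffun i => Ordinal (colpos_subproof i)].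

Lemma colposE i : colpos i = #|[pred j | before j i]| :> nat.
Proof. by rewrite ffunE. Qed.

Lemma before_colpos i j : before i j -> (colpos i < colpos j)%N.
Proof.
move=> ij; rewrite !colposE; apply: proper_card; apply/properP; split.
  by apply/fintype.subsetP => m; rewrite !inE => /before_trans; apply.
by exists i; rewrite !inE ?before_irr.
Qed.

Lemma colpos_inj i j : u i = u j -> colpos i = colpos j -> i = j.
Proof.
move=> uij cij; have [//|nij] := eqVneq i j.
by case/orP: (before_total uij nij) => /before_colpos; rewrite cij ltnn.
Qed.

Lemma colpos_before i j : u i = u j -> (colpos i < colpos j)%N -> before i j.
Proof.
move=> uij cij; have [eij|nij] := eqVneq i j; first by rewrite eij ltnn in cij.
case/orP: (before_total uij nij) => // /before_colpos.
by rewrite ltnNge (ltnW cij).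
Qed.

Lemma colpos_rowlen i : (colpos i < rowlen u (u i))%N.
Proof.
rewrite colposE; apply: proper_card; apply/properP; split.
  by apply/fintype.subsetP => j; rewrite !inE => /andP[].
by exists i; rewrite !inE ?before_irr.
Qed.

Lemma card_ord_lt m : (#|[pred c : 'I_d | c < m]| <= m)%N.
Proof.
rewrite -[X in (_ <= X)%N]card_ord.
case: m => [|m]; first by rewrite (eq_card (B := pred0)) ?card0.
apply: (@leq_card_in _ _ (fun c : 'I_d => inord c : 'I_m.+1)) => // i j; rewrite !inE => im jm e.
by apply: val_inj; have := congr1 val e; rewrite /= !inordK.
Qed.

Lemma colpos_onto v c : (c < rowlen u v)%N -> exists2 i, u i = v & colpos i = c :> nat.
Proof.
move=> cv; pose A := [set colpos i | i in [pred i | u i == v]]%SET.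
have cA : #|A| = rowlen u v.
  rewrite card_in_imset // => i j; rewrite !inE => /eqP ui /eqP uj.
  by apply: colpos_inj; rewrite ui.
have sA : A \subset [pred c : 'I_d | c < rowlen u v]%N.
  apply/fintype.subsetP => _ /imsetP[i ui ->]; move: ui; rewrite !inE => /eqP <-.
  exact: colpos_rowlen.
have cd : (c < d)%N.
  by apply: leq_trans cv _; rewrite -[X in (_ <= X)%N]card_ord max_card.
have : Ordinal cd \in A.
  have := subset_leq_card sA => le.
  have /subset_cardP/(_ sA) -> // : #|A| = #|[pred c : 'I_d | c < rowlen u v]%N|.
  by apply/eqP; rewrite eqn_leq le cA card_ord_lt.
by case/imsetP => i; rewrite inE => /eqP ui ci; exists i => //; rewrite -ci.
Qed.

Definition partw : Prop :=
  forall (c : I) (r r' : 'I_n), (r < r')%N -> (rowlen u (c, r') <= rowlen u (c, r))%N.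

(** When the rows are sorted, standardness can only fail at two entries of one column. *)
Definition violation i j : Prop :=
  [/\ (u i).1 = (u j).1, ((u i).2 < (u j).2)%N, colpos i = colpos j,
      (rk (p j) <= rk (p i))%N & p i = p j -> ~~ par (p i)].

Lemma std_or_violation : rowword p u -> partw ->
  stdw p u colpos \/ exists i j, violation i j.
Proof.
move=> [cpu gpu] pu.
have [|nv] := pselect (exists i j, violation i j); [by right|left].
split=> //.
- exact: colpos_inj.
- move=> i c ci; have := ltn_trans ci (colpos_rowlen i).
  by move=> /colpos_onto[j uj cj]; exists j.
- move=> i r ri; have [j uj cj] : exists2 j, u j = ((u i).1, r) & colpos j = colpos i :> nat.
    apply: colpos_onto; apply: leq_trans (colpos_rowlen i) _.
    by rewrite [u i]surjective_pairing; apply: pu.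
  by exists j => //; apply: val_inj.
- move=> i j uij cij; have b := colpos_before uij cij.
  split=> [|pij]; first exact: before_rk.
  apply/negP => odd_i; have ij : i = j.
    by apply: gpu; rewrite /rpar !ffunE ?pij ?uij // -pij.
  by rewrite ij before_irr in b.
- move=> i j uij rij cij; have /not_andP nvij : ~ ((rk (p j) <= rk (p i))%N /\ (p i = p j -> ~~ par (p i))).
    by move=> [rji ev]; apply: nv; exists i, j; split.
  case: nvij => [/negP|nev]; first by rewrite -ltnNge => rlt; split; [exact: ltnW | move=> pij; rewrite pij ltnn in rlt].
  move/not_implyP: nev => [pij /negP]; rewrite negbK => odd_i.
  by split; rewrite // pij.
Qed.

(** Either the component has an empty row, or by [d <= n] each of its rows holds exactly
    one letter, and then the whole row [u j] is gathered. *)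
Lemma violation_fresh i j : (d <= n)%N -> violation i j -> exists r3 : R,
  (u i).1 = r3.1 /\ forall m, u m = u j -> ~~ mid p u (u i) (u j) (p i) (p j) m ->
    u i != r3 /\ forall m', u m' != r3.
Proof.
move=> dn [cij lij wij rij ev].
have [[r3 [c3 nr3]]|nex] := pselect (exists r3 : R, (u i).1 = r3.1 /\ forall m, u m != r3).
  by exists r3; split=> // m _ _; split.
exists (u i); split=> // m um nm; exfalso; apply: nex.
apply: contrapT => /forallNP all_r.
have occ r : exists m', u m' == ((u i).1, r).
  have /not_andP[//|/existsNP[m' /negP]] := all_r ((u i).1, r).
  by rewrite negbK => um'; exists m'.
have {occ} [f fE] := choice occ.
have f_inj : injective f.
  by move=> r r' e; have := fE r; rewrite e (eqP (fE r')) => /eqP[].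
(* With all rows occupied and d <= n, every row has a single letter. *)
have f_onto m' : exists r, f r = m'.
  have cardf : #|codom f| = #|'I_d|.
    apply/eqP; rewrite eqn_leq max_card card_codom // !card_ord.
    by move: dn.
  have /subset_cardP/(_ (fintype.subset_predT _))/(_ m') := cardf.
  by rewrite inE => /codomP[r ->]; exists r.
have [r fr] := f_onto m; have [r' fr'] := f_onto j.
have : r = r'.
  have := fE r; have := fE r'; rewrite fr fr' um => /eqP -> /eqP e.
  by have := congr1 snd e.
move=> rr; move: nm; rewrite -fr rr fr' /mid eqxx leqnn orbT //.
Qed.

(** The belt consists of the upper row from the column of the violation on and of the
    lower row up to that column, which is counted twice. *)
Lemma violation_long i j : violation i j ->
  (rowlen u (u i) < #|[pred m | mid p u (u i) (u j) (p i) (p j) m]|)%N.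
Proof.
move=> [cij lij wij rij ev].
have nij : u i != u j by apply: contraTneq lij => ->; rewrite ltnn.
pose P1 := [pred m | (u m == u i) && (rk (p i) <= rk (p m))%N].
pose P2 := [pred m | (u m == u j) && (rk (p m) <= rk (p j))%N].
have -> : #|[pred m | mid p u (u i) (u j) (p i) (p j) m]| = (#|P1| + #|P2|)%N.
  rewrite -cardUI [X in (_ = _ + X)%N](eq_card (B := pred0)) ?card0 ?addn0.
    by apply: eq_card => m; rewrite !inE.
  by move=> m; rewrite !inE; case: eqP => // ->; rewrite (negbTE nij) andbF.
have h1 : (rowlen u (u i) <= colpos i + #|P1|)%N.
  rewrite colposE -cardUI; apply: leq_trans (leq_addr _ _).
  apply: subset_leq_card; apply/fintype.subsetP => m; rewrite !inE /before => -> /=.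
  by case: ltnP => //=; rewrite orbT.
have h2 : (colpos j < #|P2|)%N.
  rewrite colposE; apply: proper_card; apply/properP; split.
    apply/fintype.subsetP => m; rewrite !inE => b; rewrite (before_rk b).
    by case/andP: b => ->.
  by exists j; rewrite !inE ?before_irr // eqxx leqnn.
by rewrite wij in h1; apply: leq_ltn_trans h1 _; rewrite addnC ltn_add2l.
Qed.

End OneAlphabet.
End StandardWords.

Section Spanning.
Variables (k : idomainType) (d n : nat) (I : finType).
Hypothesis k_char0 : [pchar k] =i pred0.
Hypothesis dn : (d <= n)%N.
Notation R := (I * 'I_n)%type.
Notation word L := {ffun 'I_d -> L}.

Lemma straighten_violation (X Y : alphabet I) (p : word X) (u : word R) (q : word Y) i j
    (S : set {ffun word X * word Y -> k^o}) :
    submodule S -> rowword p u -> rowword q u -> partw u -> violation p u i j ->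
    (forall (p' : word X) (u' : word R) (q' : word Y), (shapewt u < shapewt u')%N -> rowword p' u' -> rowword q' u' ->
      S (tabker k p' u' q')) ->
    (forall p', rowword p' u -> (wt p' u < wt p u)%N -> S (tabker k p' u q)) ->
  S (tabker k p u q).
Proof.
move=> sS rpu rqu pu vij IHu IHp; have [r3 [co13 fresh]] := violation_fresh dn vij.
have long := violation_long vij; have [cij lij wij rij ev] := vij.
have len12 : (rowlen u (u j) <= rowlen u (u i))%N.
  by rewrite [u j]surjective_pairing [u i]surjective_pairing -cij; apply: pu.
apply: (straighten k_char0 rpu cij co13 lij rij ev fresh long len12 sS).
- by apply: orb_eqv; case: rqu.
- move=> q' v /orb_neq0/samew_zipP[s -> ->]; split; last exact: samew_perm.
  by move=> m; rewrite !ffunE; case: rqu.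
- move=> q' rq'; apply: IHu => //; first exact: shapewt_gather.
  exact: rowword_gather.
- exact: IHp.
Qed.

Lemma ker_swap (X Y : alphabet I) (p : word X) (u : word R) (q : word Y) :
  tabker k q u p = [ffun qp => tabker k p u q (qp.2, qp.1)].
Proof. by apply/ffunP => qp; rewrite !ffunE; apply: eq_bigr => v _; rewrite mulrC. Qed.

(** Renaming the rows is a bijection of the words that the kernel sums over. *)
Lemma ker_rows (X Y : alphabet I) (p : word X) (u : word R) (q : word Y) (f : R -> R) :
    injective f -> (forall r, (f r).1 = r.1) -> rowword p u -> rowword q u ->
    let fu := [ffun i => f (u i)] in
  [/\ rowword p fu, rowword q fu & exists c, tabker k p u q = c *: tabker k p fu q].
Proof.
move=> finj fco rpu rqu fu.
have fuE (v : word R) s : wperm [ffun i => f (v i)] s = [ffun i => f (wperm v s i)].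
  by apply/ffunP => i; rewrite !ffunE.
have ffinj (v w : word R) : [ffun i => f (v i)] = [ffun i => f (w i)] :> word R -> v = w.
  by move=> /ffunP e; apply/ffunP => i; apply: finj; have := e i; rewrite !ffunE.
have rr (Z : alphabet I) (z : word Z) : rowword z u -> rowword z fu.
  move=> [cz gz]; split=> [i|i j]; first by rewrite ffunE fco.
  rewrite /rpar !ffunE => -[zij /finj uij] /= odd_i.
  by apply: gz; rewrite /rpar !ffunE ?zij ?uij // -zij.
have rp := rr _ _ rpu; have rq := rr _ _ rqu; split=> //.
have oE (Z : alphabet I) (z : word Z) : rowword z u -> exists c : k, forall z' v,
    orb k (@rpar n I Z) (wzip z u) (wzip z' v)
    = c * orb k (@rpar n I Z) (wzip z fu) (wzip z' [ffun i => f (v i)]).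
  move=> rz; have [cz gz] := rz; have [_ gfz] := rr _ _ rz.
  pose F (g : word (Z * R)) := orb k (@rpar n I Z) (wzip z fu) (wzip (wfst g) [ffun i => f (wsnd g i)]).
  have eF : eqv (@rpar n I Z) F.
    move=> g s; have [z' [v ->]] := wunzip g.
    rewrite /F wzip_perm !wfst_zip !wsnd_zip -fuE -wzip_perm orb_eqv //.
    congr (_ ^+ nat_of_bool _ * _); apply: eq_sperm => i.
    by rewrite /rpar /= !ffunE.
  have F1 : F (wzip z u) = 1 by rewrite /F wfst_zip wsnd_zip orb_id.
  exists 1 => z' v; have := @eqv_orb k d _ (@rpar n I Z) F (wzip z u) eF gz _ (wzip z' v).
  rewrite F1 !mul1r /F wfst_zip wsnd_zip => -> // g; have [z1 [v1 ->]] := wunzip g.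
  rewrite wfst_zip wsnd_zip => /orb_neq0/samew_zipP[s -> e].
  by apply/samew_zipP; exists s => //; apply: ffinj; rewrite e fuE.
have [c1 E1] := oE X p rpu; have [c2 E2] := oE Y q rqu.
exists (c1 * c2); apply/ffunP => pq; rewrite !ffunE scaler_sumr.
have fb : bijective (fun v : word R => [ffun i => f (v i)] : word R).
  by apply: injF_bij => v w /ffinj.
rewrite [RHS](reindex _ (onW_bij _ fb)) /=; apply: eq_bigr => v _.
by rewrite E1 E2 mulrACA.
Qed.

(** Straightening a violation replaces a product by products of larger shape or smaller
    weight; two rows whose lengths increase can be exchanged. So the induction is on the
    shape, then on the position of the rows, then on the weights of the two factors. *)
Theorem standard_span (X Y : alphabet I) (S : set {ffun word X * word Y -> k^o}) :
    submodule S ->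
    (forall (p : word X) (u : word R) (q : word Y) w z, stdw p u w -> stdw q u z -> S (tabker k p u q)) ->
  forall (p : word X) (u : word R) (q : word Y), rowword p u -> rowword q u -> S (tabker k p u q).
Proof.
move=> sS Sstd.
have shapeB (u : word R) : (shapewt u <= \sum_(r : R) 2 ^ d)%N.
  apply: leq_sum => r _; rewrite leq_exp2l //.
  by rewrite -[X in (_ <= X)%N]card_ord max_card.
set B := (\sum_(r : R) 2 ^ d)%N in shapeB.
suff main m1 m2 m3 (p : word X) (u : word R) (q : word Y) : (B - shapewt u < m1)%N -> (\sum_i (u i).2 < m2)%N ->
    (wt p u + wt q u < m3)%N -> rowword p u -> rowword q u -> S (tabker k p u q).
  move=> p u q; exact: (main (B - shapewt u).+1 (\sum_i (u i).2)%N.+1 (wt p u + wt q u)%N.+1).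
elim: m1 m2 m3 p u q => [//|m1 IH1]; elim=> [//|m2 IH2]; elim=> [//|m3 IH3] p u q.
move=> hs hr hw rpu rqu.
have IHshape (p' : word X) (u' : word R) (q' : word Y) : (shapewt u < shapewt u')%N -> rowword p' u' -> rowword q' u' ->
    S (tabker k p' u' q').
  move=> lt rp rq.
  apply: (IH1 (\sum_i (u' i).2)%N.+1 (wt p' u' + wt q' u')%N.+1) => //.
  by have := shapeB u'; lia.
have [pu|/existsNP[c /existsNP[r /existsNP[r' /not_implyP[rr' /negP]]]]] := pselect (partw u).
  have [std_p|[i [j vij]]] := std_or_violation rpu pu; last first.
    apply: (straighten_violation sS rpu rqu pu vij IHshape) => p' rp' lt.
    by apply: IH3 => //; lia.
  have [std_q|[i [j vij]]] := std_or_violation rqu pu; first exact: Sstd std_p std_q.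
  pose S' := [set f : {ffun word Y * word X -> k^o} | S [ffun pq => f (pq.2, pq.1)]]%classic.
  have sw (q' : word Y) (u' : word R) (p' : word X) : S' (tabker k q' u' p') = S (tabker k p' u' q').
    by rewrite (ker_swap q' u' p').
  rewrite -sw; apply: (straighten_violation _ rqu rpu pu vij).
  - split=> [|a f g Sf Sg].
      have e : [ffun pq => (0 : {ffun word Y * word X -> k^o}) (pq.2, pq.1)] = 0
          :> {ffun word X * word Y -> k^o} by apply/ffunP => x; rewrite !ffunE.
      by rewrite /S' /mkset e; apply: sS.1.
    have e : [ffun pq => (a *: f + g) (pq.2, pq.1)] = a *: [ffun pq => f (pq.2, pq.1)] +
        [ffun pq => g (pq.2, pq.1)] :> {ffun word X * word Y -> k^o}.
      by apply/ffunP => x; rewrite !ffunE.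
    by rewrite /S' /mkset e; apply: sS.2.
  - by move=> q' u' p' lt rq rp; rewrite sw; apply: IHshape.
  - move=> q' rq' lt; rewrite sw; apply: IH3 => //.
    by move: hw lt; lia.
rewrite -ltnNge => len.
have tco x : (tperm (c, r) (c, r') x).1 = x.1 by case: tpermP => [->|->|].
have [rp rq [cc ->]] := ker_rows perm_inj tco rpu rqu.
apply: submoduleZ => //; set u' := [ffun i => _] in rp rq *.
have lenu' x : rowlen u' x = rowlen u (tperm (c, r) (c, r') x).
  apply: eq_card => i; rewrite !inE ffunE.
  by rewrite (canF_eq (tpermK _ _)).
have shu' : shapewt u' = shapewt u.
  rewrite /shapewt [RHS](reindex_inj (@perm_inj _ (tperm (c, r) (c, r')))).
  by apply: eq_bigr => x _; rewrite lenu'.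
apply: (IH2 (wt p u' + wt q u')%N.+1) => //; first by rewrite shu'.
suff lt : (\sum_i (u' i).2 < \sum_i (u i).2)%N by apply: leq_trans lt _.
have rowsE (v : word R) : (\sum_i (v i).2 = \sum_(x : R) x.2 * rowlen v x)%N.
  rewrite (partition_big v predT) //=; apply: eq_bigr => x _.
  rewrite (eq_bigr (fun=> x.2 : nat)) => [|i /eqP -> //].
  by rewrite sum_nat_const mulnC.
rewrite !rowsE.
have nrr : (c, r) != (c, r') by apply: contraTneq rr' => -[->]; rewrite ltnn.
have nrr' : (c, r') != (c, r) by rewrite eq_sym.
rewrite (bigD1 (c, r)) // (bigD1 (c, r')) //= [X in (_ < X)%N](bigD1 (c, r)) //.
rewrite [X in (_ < _ + X)%N](bigD1 (c, r')) //= !lenu' tpermL tpermR !addnA.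
rewrite (eq_bigr (fun x : R => x.2 * rowlen u x)%N) => [|x /andP[x1 x2]]; last first.
  by rewrite lenu' tpermD // eq_sym.
by rewrite ltn_add2r; move: len rr'; nia.
Qed.

End Spanning.

(** * Products of standard tableaux are independent *)

Section Counting.
Variable d : nat.

Lemma samew_card (L : finType) (g h : {ffun 'I_d -> L}) (P : pred L) : samew g h ->
  #|[pred i | P (g i)]| = #|[pred i | P (h i)]|.
Proof.
move=> /samewP[s ->]; rewrite -(card_imset (mem [pred i | P (wperm g s i)]) (@perm_inj _ s)).
apply: eq_card => i; rewrite !inE; apply/idP/imsetP => [Pi|[j]]; last by rewrite inE ffunE => Pj ->.
by exists (s^-1%g i); rewrite ?permKV // inE ffunE permKV.
Qed.

(** The number of points at [(R, A)] is an alternating sum of the numbers of points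
    strictly below the four thresholds at [(R, A)], [(R + 1, A)], [(R, A + 1)] and
    [(R + 1, A + 1)]. *)
Lemma thresholds (P P' : pred 'I_d) (r r' a a' : 'I_d -> nat) :
  (forall R A, #|[pred i | P i && (r i < R) && (a i < A)]|%N
             = #|[pred i | P' i && (r' i < R) && (a' i < A)]|%N) ->
  forall R A, #|[pred i | P i && (r i == R) && (a i == A)]|
             = #|[pred i | P' i && (r' i == R) && (a' i == A)]|.
Proof.
have split (Q : pred 'I_d) (f : 'I_d -> nat) F :
    #|[pred i | Q i && (f i < F.+1)%N]|
    = (#|[pred i | Q i && (f i == F)]| + #|[pred i | Q i && (f i < F)]|)%N.
  rewrite -cardUI [X in (_ = _ + X)%N](eq_card (B := pred0)) ?card0 ?addn0.
    by apply: eq_card => i; rewrite !inE -andb_orr -leq_eqVlt ltnS.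
  by move=> i; rewrite !inE; case: (Q i) => //=; case: ltngtP.
move=> e R A.
have step F : #|[pred i | P i && (r i == R) && (a i < F)]|%N
            = #|[pred i | P' i && (r' i == R) && (a' i < F)]|%N.
  have := e R.+1 F; pose Q i := P i && (a i < F)%N; pose Q' i := P' i && (a' i < F)%N.
  rewrite (eq_card (B := [pred i | Q i && (r i < R.+1)%N])); last by move=> i; rewrite !inE /Q andbAC.
  rewrite [RHS](eq_card (B := [pred i | Q' i && (r' i < R.+1)%N])); last by move=> i; rewrite !inE /Q' andbAC.
  rewrite !split => e1; have := e R F.
  rewrite (eq_card (B := [pred i | Q i && (r i < R)%N])); last by move=> i; rewrite !inE /Q andbAC.
  rewrite [RHS](eq_card (B := [pred i | Q' i && (r' i < R)%N])); last by move=> i; rewrite !inE /Q' andbAC.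
  move=> e2; move: e1; rewrite e2 => /addIn e3.
  rewrite (eq_card (B := [pred i | Q i && (r i == R)])); last by move=> i; rewrite !inE /Q andbAC.
  by rewrite e3; apply: eq_card => i; rewrite !inE /Q' andbAC.
have := step A.+1.
rewrite (split (fun i => P i && (r i == R))) (split (fun i => P' i && (r' i == R))) step.
by move/addIn.
Qed.

End Counting.

Section GaleRyser.
Variables (d n : nat) (I : finType) (X : alphabet I).
Notation R := (I * 'I_n)%type.
Notation C := (I * 'I_d)%type.
Notation word L := {ffun 'I_d -> L}.
Implicit Types (p : word X) (u : word R) (c : word C) (w : word 'I_d).

(** The number of entries smaller than [a] in the first [r] rows; for a standard
    tableau these numbers record the chain of shapes of its initial parts. *)
Definition domc p u (i : I) (r a : nat) : nat :=
  #|[pred m | ((u m).1 == i) && ((u m).2 < r) && (rk (p m) < a)]|%N.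

Definition colw u w : word C := [ffun m => ((u m).1, w m)].

Definition incol c u p (ij : C) (r a : nat) : nat :=
  #|[pred m | (c m == ij) && ((u m).2 < r) && (rk (p m) < a)]|%N.

Definition height c p (ij : C) (a : nat) : nat :=
  #|[pred m | (c m == ij) && (rk (p m) < a)]|%N.

Lemma domc_same p u p' u' i r a : samew (wzip p u) (wzip p' u') -> domc p u i r a = domc p' u' i r a.
Proof.
move=> s; have := samew_card
  (fun x : X * R => (x.2.1 == i) && (x.2.2 < r)%N && (rk x.1 < a)%N) s.
rewrite (eq_card (B := [pred m | ((u m).1 == i) && ((u m).2 < r) && (rk (p m) < a)]%N)).
  by rewrite /domc => ->; apply: eq_card => m; rewrite !inE ffunE.
by move=> m; rewrite !inE ffunE.
Qed.

Lemma domc_incol c u p i r a : (forall m, (c m).1 = (u m).1) ->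
  domc p u i r a = (\sum_(j < d) incol c u p (i, j) r a)%N.
Proof.
move=> cu; rewrite /domc -sum1_card (partition_big (fun m => (c m).2) predT) //=.
apply: eq_bigr => j _; rewrite /incol -sum1_card; apply: eq_bigl => m.
rewrite !inE -cu [c m]surjective_pairing xpair_eqE /=.
by case: ((c m).1 == i); case: ((c m).2 == j); rewrite ?andbT ?andbF.
Qed.

Lemma incol_le c u p ij r a : (forall m, (c m).1 = (u m).1) ->
    (forall m m', c m = c m' -> u m = u m' -> m = m') ->
  (incol c u p ij r a <= minn r (height c p ij a))%N.
Proof.
move=> cu inj; rewrite leq_min; apply/andP; split; last first.
  apply: subset_leq_card; apply/fintype.subsetP => m; rewrite !inE.
  by move=> /andP[/andP[-> _] ->].
apply: leq_trans (card_ord_lt n r); rewrite /incol -(card_in_imset (f := fun m => (u m).2)).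
  apply: subset_leq_card; apply/fintype.subsetP => _ /imsetP[m + ->].
  by rewrite !inE => /andP[/andP[_ ->]].
move=> m m'; rewrite !inE => /andP[/andP[/eqP cm _] _] /andP[/andP[/eqP cm' _] _] um.
apply: inj; first by rewrite cm cm'.
by rewrite [u m]surjective_pairing [u m']surjective_pairing um -!cu cm cm'.
Qed.

(** A column of a standard tableau is filled from the top by its smallest entries, so
    that the bound of [incol_le] is attained. *)
Lemma incol_std p u w ij r a : stdw p u w ->
  (minn r (height (colw u w) p ij a) <= incol (colw u w) u p ij r a)%N.
Proof.
move=> S; pose P m := (colw u w m == ij) && (rk (p m) < a)%N.
have [/existsP[m /andP[/andP[/eqP cm am] rm]]|/existsPn nex] :=
  boolP [exists m, P m && (r <= (u m).2)%N].
  rewrite geq_min; apply/orP; left.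
  have rn : (r <= n)%N by apply: leq_trans rm _; apply: ltnW.
  have ex (x : 'I_r) : exists m', u m' = ((u m).1, widen_ord rn x) /\ w m' = w m.
    have [|m' um' wm'] := std_up S (i := m) (r := widen_ord rn x).
      exact: leq_trans (ltn_ord x) rm.
    by exists m'.
  have {ex} [f fP] := choice ex.
  rewrite -[X in (X <= _)%N]card_ord -(card_codom (f := f)); last first.
    move=> x y e; apply: val_inj; have := (fP x).1; rewrite e (fP y).1.
    by move/(congr1 (fun v : R => val v.2)).
  apply: subset_leq_card; apply/fintype.subsetP => _ /codomP[x ->].
  have [ux wx] := fP x; rewrite !inE ux /= ltn_ord andbT.
  have -> : colw u w (f x) = ij by rewrite -cm !ffunE ux wx.
  rewrite eqxx /=; have [|||le _] := std_col S (i := f x) (j := m) => //.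
  - by rewrite ux.
  - by rewrite ux; apply: leq_trans (ltn_ord x) rm.
  - exact: leq_ltn_trans le am.
rewrite geq_min; apply/orP; right; apply: subset_leq_card; apply/fintype.subsetP => m.
rewrite !inE => /andP[cm am]; rewrite cm am andbT /=.
by have := nex m; rewrite /P cm am /= -ltnNge.
Qed.

Section Comparison.
Variables (p p1 : word X) (u u1 : word R) (w : word 'I_d) (c1 : word C).
Hypotheses (S : stdw p u w) (cp : samew (wzip (colw u w) p) (wzip c1 p1)).
Hypothesis cu1 : forall m, (c1 m).1 = (u1 m).1.
Hypothesis inj1 : forall m m', c1 m = c1 m' -> u1 m = u1 m' -> m = m'.

Lemma incol_compare ij r a : (incol c1 u1 p1 ij r a <= incol (colw u w) u p ij r a)%N.
Proof.
apply: leq_trans (incol_le _ _ _ _ cu1 inj1) _; apply: leq_trans (incol_std _ _ _ S).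
rewrite (_ : height c1 p1 ij a = height (colw u w) p ij a) //.
have := samew_card (fun x : C * X => (x.1 == ij) && (rk x.2 < a)%N) cp.
rewrite (eq_card (B := [pred m | (colw u w m == ij) && (rk (p m) < a)]%N)); last first.
  by move=> m; rewrite !inE [wzip _ _ m]ffunE.
by rewrite /height => ->; apply: eq_card => m; rewrite !inE ffunE.
Qed.

(** The easy half of the Gale-Ryser theorem, column by column: among the fillings
    without repeated nodes whose columns have given contents, a standard one has the most
    small entries in its upper rows. *)
Lemma domc_compare i r a : (domc p1 u1 i r a <= domc p u i r a)%N.
Proof.
rewrite (domc_incol _ _ _ _ cu1) (@domc_incol (colw u w)); last by move=> m; rewrite ffunE.
by apply: leq_sum => j _; apply: incol_compare.
Qed.

(** Equality of the sums in [domc_compare] is equality in every column. *)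
Lemma domc_rigid : (forall i r a, domc p1 u1 i r a = domc p u i r a) ->
  samew (wzip (colw u w) (wzip p u)) (wzip c1 (wzip p1 u1)).
Proof.
move=> e; have ec ij r a : incol c1 u1 p1 ij r a = incol (colw u w) u p ij r a.
  have := e ij.1 r a; rewrite (domc_incol _ _ _ _ cu1).
  rewrite (@domc_incol (colw u w)); last by move=> m; rewrite ffunE.
  move=> /eqP; rewrite (leqif_sum (fun j _ => leqif_eq (incol_compare (ij.1, j) r a))).
  by move=> /forallP/(_ ij.2)/eqP; rewrite -surjective_pairing.
apply/samew_count => -[ij [x v]].
have cuw m : (colw u w m).1 = (u m).1 by rewrite ffunE.
have lab (c : word C) (p' : word X) (u' : word R) : (forall m, (c m).1 = (u' m).1) ->
    #|[pred m | wzip c (wzip p' u') m == (ij, (x, v))]|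
    = if ij.1 == v.1 then #|[pred m | (c m == ij) && ((u' m).2 == v.2 :> nat) && (rk (p' m) == rk x)]|
      else 0%N.
  move=> cu'; case: eqP => [ev|nev].
    apply: eq_card => m; rewrite !inE [wzip _ _ m]ffunE [wzip _ _ m]ffunE !xpair_eqE.
    rewrite (inj_eq (@rk_inj _ X)) [u' m]surjective_pairing [v]surjective_pairing xpair_eqE /=.
    rewrite val_eqE -cu' -ev; case: eqP => [->|//]; rewrite eqxx /=.
    by rewrite andbC.
  apply: eq_card0 => m; rewrite !inE [wzip _ _ m]ffunE [wzip _ _ m]ffunE !xpair_eqE.
  apply/negbTE/negP => /and3P[/eqP cm _ /eqP um]; apply: nev.
  by rewrite -cm cu' um.
apply: etrans (lab _ _ _ cuw) _; apply: etrans (esym (lab _ _ _ cu1)).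
case: ifP => // _.
apply: thresholds => r a; exact/esym/ec.
Qed.

End Comparison.

Lemma domc_inj p u p' u' : (forall i r a, domc p u i r a = domc p' u' i r a) ->
  samew (wzip p u) (wzip p' u').
Proof.
move=> e; apply/samew_count => -[x v].
have lab (p1 : word X) (u1 : word R) : #|[pred m | wzip p1 u1 m == (x, v)]|
    = #|[pred m | ((u1 m).1 == v.1) && ((u1 m).2 == v.2 :> nat) && (rk (p1 m) == rk x)]|.
  apply: eq_card => m; rewrite !inE ffunE xpair_eqE (inj_eq (@rk_inj _ X)).
  by rewrite [u1 m]surjective_pairing [v]surjective_pairing xpair_eqE andbC.
by rewrite !lab; apply: thresholds => r a; apply: e.
Qed.

End GaleRyser.

Section Independence.
Variables (k : idomainType) (d n : nat) (I : finType) (X Y : alphabet I).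
Hypothesis k_char0 : [pchar k] =i pred0.
Notation R := (I * 'I_n)%type.
Notation C := (I * 'I_d)%type.
Notation word L := {ffun 'I_d -> L}.
Implicit Types (p : word X) (q : word Y) (u : word R) (w : word 'I_d) (c : word C).

(** In the functional below, columns have odd names; so a letter of a column counts with
    the opposite parity. *)
Definition cpar (Z : alphabet I) (cx : C * Z) : bool := ~~ par cx.2.

(** The sign of the product of the word [p] with reversed parities and the word [p]. *)
Definition csign p : k := (-1) ^+ theta (fun m => ~~ par (p m)) (fun m => par (p m)).

Lemma csign_perm p s : csign (wperm p s) = csign p * ((-1) ^+ sperm s (fun m => ~~ par (p m))
  * (-1) ^+ sperm s (fun m => par (p m)) * (-1) ^+ sperm s (fun=> true)).
Proof.
rewrite /csign -!signr_addb; congr (_ ^+ nat_of_bool _).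
rewrite (@eq_theta _ _ ((fun m => ~~ par (p m)) \o s) _ ((fun m => par (p m)) \o s));
  try by move=> m; rewrite /= ffunE.
rewrite theta_perm; congr (_ (+) (_ (+) _)); apply: eq_sperm => m.
by case: (par _).
Qed.

Lemma sgn_rpar (Z : alphabet I) (z : word Z) u s :
  sgn k (@rpar n I Z) (wzip z u) s = (-1) ^+ sperm s (fun m => par (z m)).
Proof. by congr (_ ^+ nat_of_bool _); apply: eq_sperm => m; rewrite /rpar /= ffunE. Qed.

Lemma sgn_cpar (Z : alphabet I) c (z : word Z) s :
  sgn k (@cpar Z) (wzip c z) s = (-1) ^+ sperm s (fun m => ~~ par (z m)).
Proof. by congr (_ ^+ nat_of_bool _); apply: eq_sperm => m; rewrite /cpar /= ffunE. Qed.

(** Columns repeat odd letters only. *)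
Lemma stdw_cgood (Z : alphabet I) (z : word Z) u w : stdw z u w ->
  goodw (@cpar Z) (wzip (colw u w) z).
Proof.
move=> S i j; rewrite !ffunE => -[uij wij zij]; rewrite /cpar /= => ev.
have [rij|rij|rij] := ltngtP (u i).2 (u j).2.
- by have [_ /(_ zij)] := std_col S uij rij wij; rewrite (negbTE ev).
- by have [_ /(_ (esym zij))] := std_col S (esym uij) rij (esym wij); rewrite -zij (negbTE ev).
- apply: std_inj S _ _ _ wij.
  by rewrite [u i]surjective_pairing [u j]surjective_pairing uij (val_inj rij).
Qed.

(** A Capelli-type functional: the coefficients at the word [q] and at the words with the
    same letters in each column as [p] are summed, with the signs of a tensor in odd
    columns. *)
Definition capelli p u w q (H : {ffun word X * word Y -> k^o}) : k :=
  \sum_p1 csign p1 * orb k (@cpar X) (wzip (colw u w) p) (wzip (colw u w) p1) * H (p1, q).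

Definition cterm p u w q p' u' q' p1 u1 : k :=
  csign p1 * orb k (@cpar X) (wzip (colw u' w) p') (wzip (colw u' w) p1)
  * (orb k (@rpar n I X) (wzip p u) (wzip p1 u1) * orb k (@rpar n I Y) (wzip q u) (wzip q' u1)).

Definition nodeinj u w u1 : bool :=
  [forall i, forall j, (colw u w i == colw u w j) && (u1 i == u1 j) ==> (i == j)].

Lemma nodeinjP u w u1 :
  reflect (forall i j, colw u w i = colw u w j -> u1 i = u1 j -> i = j) (nodeinj u w u1).
Proof.
apply: (iffP forallP) => [e i j cij uij|e i].
  by apply/eqP; have /forallP/(_ j) := e i; rewrite cij uij !eqxx.
by apply/forallP => j; apply/implyP => /andP[/eqP ? /eqP ?]; apply/eqP/e.
Qed.

(** Summing over [p1] leaves an equivariant function of the word of nodes, all of which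
    are odd, so it vanishes if a node is repeated. *)
Lemma capelli_cancel p u w q p' u' q' u1 : rowword p u -> stdw p' u' w ->
  ~~ nodeinj u' w u1 -> \sum_p1 cterm p u w q p' u' q' p1 u1 = 0.
Proof.
move=> [_ gpu] S' /nodeinjP ninj; have gc := stdw_cgood S'.
under eq_bigr => p1 _ do rewrite /cterm mulrA.
rewrite -mulr_suml.
pose G (g : word (C * R)) := \sum_p1 csign p1 *
   orb k (@cpar X) (wzip (colw u' w) p') (wzip (wfst g) p1) *
   orb k (@rpar n I X) (wzip p u) (wzip p1 (wsnd g)).
have eG : eqv (fun=> true) G.
  move=> g s; have [c [v ->]] := wunzip g.
  rewrite wzip_perm /G !wfst_zip !wsnd_zip mulr_sumr.
  rewrite (reindex (@wperm d X ^~ s)) /=; last exact/onW_bij/wperm_bij.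
  apply: eq_bigr => p1 _; rewrite -!wzip_perm !orb_eqv // csign_perm sgn_rpar sgn_cpar.
  set a := (-1) ^+ _; set b := (-1) ^+ _; set b' := (-1) ^+ sperm s (fun=> true).
  have -> : sgn k (fun=> true) (wzip c v) s = b' by congr (_ ^+ nat_of_bool _); apply: eq_sperm.
  have aa : a * a = 1 by rewrite -expr2 sqrr_sign.
  have bb : b * b = 1 by rewrite -expr2 sqrr_sign.
  set z := orb _ _ _ _; set o := orb _ _ _ _.
  have -> : csign p1 * (a * b * b') * (a * z) * (b * o) = a * a * (b * b) * (b' * (csign p1 * z * o)) by ring.
  by rewrite aa bb !mul1r.
have : G (wzip (colw u' w) u1) = 0.
  apply: (eqv_bad k_char0 eG) => gw; apply: ninj => i j cij uij.
  by apply: gw; rewrite // [wzip _ _ i]ffunE [wzip _ _ j]ffunE cij uij.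
rewrite /G wfst_zip wsnd_zip => ->; by rewrite mul0r.
Qed.

Lemma capelli_tabker p u w q p' u' q' :
  capelli p' u' w q' (tabker k p u q) = \sum_u1 \sum_p1 cterm p u w q p' u' q' p1 u1.
Proof.
rewrite exchange_big /=; apply: eq_bigr => p1 _; rewrite ffunE mulr_sumr.
by [].
Qed.

(** By [capelli_cancel] a nonzero value comes from a filling without repeated nodes, which
    has the rows of the first pair of tableaux and the columns of the second one. *)
Lemma capelli_support p u w q p' u' w' q' :
    stdw p u w -> stdw q u w -> stdw p' u' w' -> stdw q' u' w' ->
    capelli p' u' w' q' (tabker k p u q) != 0 ->
  forall i r a, (domc p u i r a <= domc p' u' i r a)%N /\ (domc q u i r a <= domc q' u' i r a)%N.
Proof.
move=> S T S' T'; rewrite capelli_tabker => /sum_neq0[u1 nz] i r a.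
have /nodeinjP inj : nodeinj u' w' u1.
  by apply: contraNT nz => ni; rewrite capelli_cancel //; apply: stdw_rowword S.
move: nz => /sum_neq0[p1].
rewrite /cterm !mulf_eq0 !negb_or -!andbA => /and4P[_ /orb_neq0 cp /orb_neq0 pp /orb_neq0 qq].
have cu m : (colw u' w' m).1 = (u1 m).1.
  rewrite ffunE -(std_co T'); have /samew_zipP[s -> ->] := qq.
  by rewrite !ffunE (std_co T).
split.
  by rewrite (domc_same _ _ _ pp); apply: domc_compare S' cp cu inj _ _ _.
rewrite (domc_same _ _ _ qq); apply: domc_compare T' _ cu inj _ _ _.
exact: samew_refl.
Qed.

(** By [domc_rigid] the terms that survive are permutations of [(p, u)] and contribute the
    same sign, so the value is a positive integer up to sign. *)
Lemma capelli_diag p u w q : stdw p u w -> stdw q u w ->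
  capelli p u w q (tabker k p u q) != 0.
Proof.
move=> S T; have gS := stdw_rowword S; have gT := stdw_rowword T.
have cS := stdw_cgood S; have cT := stdw_cgood T.
pose Q (x : word R * word X) := cterm p u w q p u q x.2 x.1.
have val u1 p1 : nodeinj u w u1 -> cterm p u w q p u q p1 u1 != 0 ->
    cterm p u w q p u q p1 u1 = csign p.
  move=> /nodeinjP inj; rewrite /cterm !mulf_eq0 !negb_or -!andbA.
  case/and4P=> _ /orb_neq0 cp /orb_neq0 pp /orb_neq0 qq.
  have cu m : (colw u w m).1 = (u1 m).1.
    rewrite ffunE -(std_co T); have /samew_zipP[s qE ->] := qq.
    by rewrite {1}qE !ffunE (std_co T).
  have domp i r a : domc p1 u1 i r a = domc p u i r a by apply/esym/domc_same.
  have domq i r a : domc q u1 i r a = domc q u i r a by apply/esym/domc_same.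
  have := domc_rigid S cp cu inj domp.
  have := domc_rigid T (samew_refl _) cu inj domq.
  move=> /samew_zipP[s' cE' /esym/eqP]; rewrite wzip_perm => /eqP/wzip_inj[qE' uE'].
  move=> /samew_zipP[s cE /esym/eqP]; rewrite wzip_perm => /eqP/wzip_inj[pE uE].
  have ss : s = s'.
    apply/permP => m; apply: (std_inj S).
      by have := congr1 (fun v : word R => v m) uE; rewrite -uE' !ffunE.
    have := congr1 (fun v : word C => (v m).2) cE.
    have := congr1 (fun v : word C => (v m).2) cE'.
    by rewrite !ffunE /= => <- <-.
  subst s'.
  have h1 : orb k (@cpar X) (wzip (colw u w) p) (wzip (colw u w) p1)
      = (-1) ^+ sperm s (fun m => ~~ par (p m)).
    by rewrite -(sgn_cpar (colw u w)) -(orb_perm k s cS) wzip_perm pE -cE.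
  have h2 : orb k (@rpar n I X) (wzip p u) (wzip p1 u1) = (-1) ^+ sperm s (fun m => par (p m)).
    by rewrite -(sgn_rpar _ u) -(orb_perm k s gS.2) wzip_perm pE -uE.
  have h3 : orb k (@rpar n I Y) (wzip q u) (wzip q u1) = (-1) ^+ sperm s (fun m => par (q m)).
    by rewrite -(sgn_rpar _ u) -(orb_perm k s gT.2) wzip_perm qE' -uE.
  (* s only exchanges equal letters of q in one column, and these are odd. *)
  have h4 : sperm s (fun=> true) = sperm s (fun m => par (q m)).
    have qs m : par (q (s m)) = par (q m).
      by have := congr1 (fun v : word Y => v m) qE'; rewrite ffunE => ->.
    have h5 : sperm s (fun m => ~~ par (q m)) = false.
      have := sgn_stab k cT (s := s); rewrite wzip_perm qE' -cE => /(_ erefl).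
      rewrite sgn_cpar; case: sperm => // /esym/eqP; rewrite -subr_eq0 opprK.
      by rewrite -[1 + 1]/(2%:R) (negbTE (natr_neq0 k_char0 _)).
    have := theta_perm s (fun=> true) (fun m => par (q m)).
    rewrite (@eq_theta _ _ (fun=> true) _ (fun m => par (q m))) //.
    rewrite (@eq_sperm _ _ (fun i => true (+) par (q i)) (fun m => ~~ par (q m))) // h5.
    by case: theta; case: sperm; case: sperm.
  rewrite h1 h2 h3 -pE csign_perm -h4.
  set a := (-1) ^+ _; set b := (-1) ^+ _; set b' := (-1) ^+ _.
  have aa : a * a = 1 by rewrite -expr2 sqrr_sign.
  have bb : b * b = 1 by rewrite -expr2 sqrr_sign.
  have bb' : b' * b' = 1 by rewrite -expr2 sqrr_sign.
  have -> : csign p * (a * b * b') * a * (b * b') = csign p * (a * a) * (b * b) * (b' * b') by ring.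
  by rewrite aa bb bb' !mulr1.
rewrite capelli_tabker (bigID (nodeinj u w)) /= [X in _ + X]big1 ?addr0; last first.
  by move=> u1 ni; apply: capelli_cancel.
rewrite pair_big_dep /=.
rewrite (bigID (fun x => Q x != 0)) /= [X in _ + X]big1 ?addr0; last first.
  by move=> x /andP[_ /negPn/eqP].
rewrite (eq_bigr (fun=> csign p)); last by move=> [u1 p1] /= /andP[/andP[inj _]]; apply: val.
rewrite sumr_const -mulr_natr mulf_neq0 ?signr_eq0 //.
apply: (natr_neq0 k_char0); apply/card_gt0P; exists (u, p); rewrite unfold_in /=.
apply/andP; split.
  rewrite andbT; apply/nodeinjP => i j cij uij; apply: (std_inj S) => //.
  by have := congr1 snd cij; rewrite !ffunE.
have [_ gp] := gS; have [_ gq] := gT.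
by rewrite /Q /cterm /= !orb_id // !mulr1 signr_eq0.
Qed.

Let bound : nat := (\max_(x : X) rk x + \max_(y : Y) rk y).+1%N.

(** A strictly monotone function of the families of numbers [domc] for the pointwise
    order; the finitely many thresholds suffice by [domc_min]. *)
Definition total_dom p u q : nat :=
  (\sum_(i : I) \sum_(r < n.+1) \sum_(a < bound.+1) (domc p u i r a + domc q u i r a))%N.

Lemma domc_min (Z : alphabet I) (z : word Z) u i r a m : (forall x : Z, rk x < m)%N ->
  domc z u i r a = domc z u i (minn r n) (minn a m).
Proof.
move=> zm; apply: eq_card => j; rewrite !inE !leq_min ltn_ord zm.
by rewrite !andbT.
Qed.

Lemma sum_eq_le (J : finType) (f g : J -> nat) : (forall j, f j <= g j)%N ->
  (\sum_j f j = \sum_j g j)%N -> forall j, f j = g j.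
Proof.
move=> le /eqP; rewrite (leqif_sum (fun j _ => leqif_eq (le j))) => /forallP e j.
exact/eqP/e.
Qed.

Lemma leq_sum_ord (f g : nat -> nat) m : (forall j, f j <= g j)%N ->
  (\sum_(j < m) f j <= \sum_(j < m) g j)%N.
Proof. by move=> le; apply: leq_sum => j _; apply: le. Qed.

Lemma total_dom_eq p u q p' u' q' :
    (forall i r a, (domc p u i r a <= domc p' u' i r a)%N /\ (domc q u i r a <= domc q' u' i r a)%N) ->
    (total_dom p' u' q' <= total_dom p u q)%N ->
  samew (wzip p u) (wzip p' u') /\ samew (wzip q u) (wzip q' u').
Proof.
move=> le ge.
have rX (x : X) : (rk x < bound)%N.
  by rewrite ltnS (leq_trans _ (leq_addr _ _)) // (leq_bigmax x).
have rY (y : Y) : (rk y < bound)%N.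
  by rewrite ltnS (leq_trans _ (leq_addl _ _)) // (leq_bigmax y).
have lesum i r a := leq_add (le i r a).1 (le i r a).2.
have tot : total_dom p u q = total_dom p' u' q'.
  apply/eqP; rewrite eqn_leq ge andbT; apply: leq_sum => i _; apply: leq_sum => r _.
  by apply: leq_sum => a _; apply: lesum.
have e i r a : (r < n.+1)%N -> (a < bound.+1)%N ->
    domc p u i r a = domc p' u' i r a /\ domc q u i r a = domc q' u' i r a.
  move=> rn am; move/eqP: tot; rewrite /total_dom.
  have sle1 i' (r' : nat) := leq_sum_ord bound.+1 (lesum i' r').
  have sle2 i' := leq_sum_ord n.+1 (sle1 i').
  move=> /eqP/(sum_eq_le sle2)/(_ i)/(sum_eq_le (fun r' : 'I_n.+1 => sle1 i r')).
  move=> /(_ (Ordinal rn))/(sum_eq_le (fun a' : 'I_bound.+1 => lesum i r a')).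
  by move=> /(_ (Ordinal am)) /=; have [l1 l2] := le i r a; split; lia.
have e' i r a : domc p u i r a = domc p' u' i r a /\ domc q u i r a = domc q' u' i r a.
  rewrite !(domc_min _ _ _ r a rX) !(domc_min _ _ _ r a rY); apply: e.
    by rewrite ltnS geq_minr.
  by rewrite ltnS geq_minr.
by split; apply: domc_inj => i r a; case: (e' i r a).
Qed.

(** Among the products that occur, take one with the smallest [total_dom]: its Capelli
    functional kills all the others. *)
Theorem standard_indep (J : finType) (p : J -> word X) (u : J -> word R) (w : J -> word 'I_d)
    (q : J -> word Y) :
    (forall j, stdw (p j) (u j) (w j)) -> (forall j, stdw (q j) (u j) (w j)) ->
    (forall i j, samew (wzip (p i) (u i)) (wzip (p j) (u j)) ->
      samew (wzip (q i) (u i)) (wzip (q j) (u j)) -> i = j) ->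
  forall c : J -> k, \sum_j c j *: tabker k (p j) (u j) (q j) = 0 -> forall j, c j = 0.
Proof.
move=> S T inj c c0 j0; apply: contrapT => /eqP nz0.
pose dl j := total_dom (p j) (u j) (q j).
case: (@arg_minnP _ j0 (fun j => c j != 0) dl nz0) => j nzj minj.
have lin (f : J -> {ffun word X * word Y -> k^o}) :
    capelli (p j) (u j) (w j) (q j) (\sum_i c i *: f i)
    = \sum_i c i * capelli (p j) (u j) (w j) (q j) (f i).
  rewrite /capelli; under [RHS]eq_bigr => i _ do rewrite mulr_sumr.
  rewrite exchange_big /=; apply: eq_bigr => p1 _; rewrite sum_ffunE mulr_sumr.
  by apply: eq_bigr => i _; rewrite ffunE mulrCA.
have := lin (fun i => tabker k (p i) (u i) (q i)); rewrite c0.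
rewrite (bigD1 j) //= [X in _ + X]big1 ?addr0 => [|i ij].
  rewrite /capelli big1 => [/esym/eqP|p1 _]; last by rewrite ffunE mulr0.
  by rewrite mulf_eq0 (negbTE nzj) (negbTE (capelli_diag (S j) (T j))).
have [->|nzi] := eqVneq (c i) 0; first by rewrite mul0r.
have [->|nzc] := eqVneq (capelli (p j) (u j) (w j) (q j) (tabker k (p i) (u i) (q i))) 0.
  by rewrite mulr0.
have [sp sq] := total_dom_eq (capelli_support (S i) (T i) (S j) (T j) nzc) (minj i nzi).
by rewrite (inj _ _ sp sq) eqxx in ij.
Qed.

End Independence.

(** * Tensors indexed by words *)

Definition pdeg (g : deg) : bool := g.2 != 0.

Lemma pdegE (g : deg) : (g.2 : nat) = pdeg g.
Proof. by rewrite /pdeg; case: g => m [[|[|]]]. Qed.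

Lemma pdegD (g h : deg) : pdeg (g + h) = pdeg g (+) pdeg h.
Proof. by rewrite /pdeg; case: g h => m [[|[|]] //= i] [m' [[|[|]] //= i']]. Qed.

Section Superalg.
Variables (k : comNzRingType) (V : superalg k).
Implicit Types (u v : V) (c : k).

Lemma smulZl c u v : smul (c *: u) v = c *: smul u v :> V.
Proof. by have := smul_linl c u 0 v; rewrite smul0l !addr0. Qed.

Lemma smulZr c u v : smul v (c *: u) = c *: smul v u :> V.
Proof. by have := smul_linr c v u 0; rewrite smul0r !addr0. Qed.

Lemma gr_scale g c u : gr g u -> gr g (c *: u).
Proof. exact: (submoduleZ (@gr_submodule k V g)). Qed.

Lemma gr0 g : gr g (0 : V).
Proof. by case: (@gr_submodule k V g). Qed.

End Superalg.

Section Multilinear.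
Variables (k : comNzRingType) (M : superalg k) (d : nat) (U : lmodType k).
Variable f : {ffun 'I_d -> M} -> U.
Hypothesis fM : multilinear f.

Implicit Types (v y : {ffun 'I_d -> M}).

Definition set_slot (v : {ffun 'I_d -> M}) i (x : M) : {ffun 'I_d -> M} :=
  finfun [eta v with i |-> x].

Lemma set_slotE v i x j : set_slot v i x j = if j == i then x else v j.
Proof. by rewrite ffunE. Qed.

Lemma multilinear0 v i : v i = 0 -> f v = 0.
Proof.
move=> vi; have e : set_slot v i (v i) = v.
  by apply/ffunP => j; rewrite set_slotE; case: eqP => // ->.
have := @fM v i (-1) 0 0; rewrite scaleN1r oppr0 addr0 scaleN1r addNr.
by rewrite -[finfun _]/(set_slot v i 0) -vi e.
Qed.

Lemma multilinear_slot (B : finType) v i (c : B -> k) (x : B -> M) :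
  f (set_slot v i (\sum_b c b *: x b)) = \sum_b c b *: f (set_slot v i (x b)).
Proof.
elim: (index_enum B) => [|b s IH]; last by rewrite !big_cons -IH; apply: fM.
by rewrite !big_nil (@multilinear0 _ i) // set_slotE eqxx.
Qed.

Lemma multilinear_expand (B : finType) (b0 : B) (c : 'I_d -> B -> k) (x : B -> M) :
  f [ffun i => \sum_b c i b *: x b]
  = \sum_(h : {ffun 'I_d -> B}) (\prod_i c i (h i)) *: f [ffun i => x (h i)].
Proof.
pose wgt (D : seq 'I_d) i b : k := if i \in D then c i b else (b == b0)%:R.
suff main (D : seq 'I_d) y : f [ffun i => if i \in D then \sum_b c i b *: x b else y i]
    = \sum_(h : {ffun 'I_d -> B}) (\prod_i wgt D i (h i)) *:
        f [ffun i => if i \in D then x (h i) else y i].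
  pose y0 : {ffun 'I_d -> M} := [ffun=> 0].
  transitivity (f [ffun i => if i \in enum 'I_d then \sum_b c i b *: x b else y0 i]).
    by congr f; apply/ffunP => i; rewrite !ffunE mem_enum.
  rewrite main; apply: eq_bigr => h _; congr (_ *: f _).
    by apply: eq_bigr => i _; rewrite /wgt mem_enum.
  by apply/ffunP => i; rewrite !ffunE mem_enum.
elim: D y => [|j D IH] y.
  rewrite (bigD1 [ffun=> b0]) //= [X in _ + X]big1 ?addr0 => [|h hb].
    by rewrite big1 ?scale1r // => i _; rewrite /wgt ffunE eqxx.
  have [i hi] : exists i, h i != b0.
    apply: contrapT => /forallNP e; move/eqP: hb; apply; apply/ffunP => i.
    by rewrite ffunE; apply/eqP/negPn/negP/e.
  by rewrite (bigD1 i) //= /wgt in_nil (negbTE hi) mul0r scale0r.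
have [jD|jD] := boolP (j \in D).
  have e i : (i \in j :: D) = (i \in D) by rewrite inE; case: eqP => // ->.
  transitivity (f [ffun i => if i \in D then \sum_b c i b *: x b else y i]).
    by congr f; apply/ffunP => i; rewrite !ffunE e.
  rewrite IH; apply: eq_bigr => h _; congr (_ *: f _).
    by apply: eq_bigr => i _; rewrite /wgt e.
  by apply/ffunP => i; rewrite !ffunE e.
pose upd (h : {ffun 'I_d -> B}) b : {ffun 'I_d -> B} := [ffun i => if i == j then b else h i].
transitivity (\sum_b \sum_(h : {ffun 'I_d -> B} | h j == b0)
    (\prod_i wgt (j :: D) i (upd h b i)) *:
      f [ffun i => if i \in j :: D then x (upd h b i) else y i]).
  pose z := [ffun i => if i \in D then \sum_b c i b *: x b else y i].
  transitivity (f (set_slot z j (\sum_b c j b *: x b))).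
    by congr f; apply/ffunP => i; rewrite set_slotE !ffunE inE; case: eqP => // ->.
  rewrite multilinear_slot; apply: eq_bigr => b _.
  transitivity (c j b *: f [ffun i => if i \in D then \sum_b c i b *: x b else set_slot y j (x b) i]).
    congr (_ *: f _); apply/ffunP => i; rewrite set_slotE !ffunE /=.
    by case: eqP => // ->; rewrite (negbTE jD).
  rewrite IH scaler_sumr (bigID (fun h : {ffun 'I_d -> B} => h j == b0)) /=.
  rewrite [X in _ + X]big1 ?addr0 => [|h hj]; last first.
    by rewrite (bigD1 j) //= /wgt (negbTE jD) (negbTE hj) mul0r scale0r scaler0.
  apply: eq_bigr => h hj; rewrite scalerA; congr (_ *: f _).
    rewrite (bigD1 j) //= [RHS](bigD1 j) //= {1}/wgt (negbTE jD) hj mul1r.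
    rewrite {2}/wgt inE eqxx ffunE eqxx; congr (_ * _); apply: eq_bigr => i ij.
    by rewrite /wgt inE ffunE (negbTE ij).
  apply/ffunP => i; rewrite !ffunE /= inE.
  by case: eqP => // ->; rewrite (negbTE jD).
rewrite pair_big_dep /=; symmetry.
rewrite (reindex_onto (fun bh : B * {ffun 'I_d -> B} => upd bh.2 bh.1)
    (fun h => (h j, upd h b0))) /= => [|h _]; last first.
  by apply/ffunP => i; rewrite !ffunE; case: eqP => // ->.
apply: eq_bigl => -[b h] /=; rewrite xpair_eqE ffunE eqxx eqxx /=; apply/eqP/eqP => [<-|hj].
  by rewrite !ffunE eqxx.
by apply/ffunP => i; rewrite !ffunE; case: eqP => // ->.
Qed.

End Multilinear.

Section SignExponent.
Variables (k : idomainType) (d : nat).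

Lemma theta_exponent (a b : 'I_d -> deg) :
  (-1) ^+ (\sum_(i < d) \sum_(j < d | (j < i)%N) (a i).2 * (b j).2)%N
  = (-1) ^+ theta (fun i => pdeg (a i)) (fun i => pdeg (b i)) :> k.
Proof.
rewrite -signr_odd; congr (_ ^+ nat_of_bool _).
rewrite (big_morph odd oddD (erefl _)).
under eq_bigr => i _ do rewrite (big_morph odd oddD (erefl _)).
rewrite /theta /pair_parity pair_big_dep /=.
rewrite (reindex (fun p : 'I_d * 'I_d => (p.2, p.1))) /=; last first.
  by exists (fun p => (p.2, p.1)) => -[].
by apply: eq_bigr => -[i j] _ /=; rewrite oddM !pdegE; do 2!case: pdeg.
Qed.

End SignExponent.

Section Tensors.
Variables (k : idomainType) (M W : superalg k) (d : nat) (t : {ffun 'I_d -> M} -> W).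
Hypothesis hW : tensor_power t.
Notation word L := {ffun 'I_d -> L}.

(** Tensors are handled through their coefficients on words of names, where a name [l]
    stands for the element [U l]. *)
Definition ev (L : finType) (U : L -> M) (F : word L -> k) : W :=
  \sum_g F g *: t [ffun i => U (g i)].

Lemma eq_ev (L : finType) (U : L -> M) F F' : F =1 F' -> ev U F = ev U F'.
Proof. by move=> e; apply: eq_bigr => g _; rewrite e. Qed.

Lemma ev_lin (L : finType) (U : L -> M) (J : Type) (s : seq J) (P : pred J) (c : J -> k)
    (F : J -> word L -> k) F0 :
  (forall g, F0 g = \sum_(j <- s | P j) c j * F j g) ->
  ev U F0 = \sum_(j <- s | P j) c j *: ev U (F j).
Proof.
move=> FE; under [RHS]eq_bigr => j _ do rewrite scaler_sumr.
rewrite exchange_big; apply: eq_bigr => g _; rewrite FE scaler_suml.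
by apply: eq_bigr => j _; rewrite scalerA.
Qed.

Lemma ev_scale (L : finType) (U : L -> M) c F F0 :
  (forall g, F0 g = c * F g) -> ev U F0 = c *: ev U F.
Proof.
by move=> FE; rewrite /ev scaler_sumr; apply: eq_bigr => g _; rewrite FE scalerA.
Qed.

Lemma ev_decomp (L : finType) (par : L -> bool) (U : L -> M) F : [pchar k] =i pred0 ->
  eqv par F -> ev U F = \sum_(h | (wrep h == h) && (F h != 0)) F h *: ev U (orb k par h).
Proof. by move=> k0 eF; apply: ev_lin => g; rewrite (eqv_decomp k0 g eF). Qed.

(** The factors of the product are named by pairs of names. *)
Lemma ev_mul (L L' : finType) (U : L -> M) (V : L' -> M) (a : L -> deg) (b : L' -> deg) F G :
    (forall x, gr (a x) (U x)) -> (forall y, gr (b y) (V y)) ->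
  smul (ev U F) (ev V G)
  = ev (fun x => smul (U x.1) (V x.2))
       (fun w : word (L * L') => F (wfst w) * G (wsnd w) *
          (-1) ^+ theta (fun i => pdeg (a (w i).1)) (fun i => pdeg (b (w i).2))).
Proof.
move=> aU bV; rewrite /ev smul_suml big_wzip; apply: eq_bigr => g _.
rewrite smulZl smul_sumr scaler_sumr; apply: eq_bigr => h _.
rewrite smulZr scalerA wfst_zip wsnd_zip.
rewrite (tp_mul hW (g := fun i => a (g i)) (h := fun i => b (h i))); last 2 first.
- by move=> i; rewrite ffunE.
- by move=> i; rewrite ffunE.
rewrite theta_exponent scalerA; congr (_ * _ *: t _).
  congr (_ ^+ nat_of_bool _); apply: eq_theta => i; by rewrite ffunE.
by apply/ffunP => i; rewrite !ffunE.
Qed.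

Lemma ev_change (L B : finType) (b0 : B) (U : L -> M) (x : B -> M) (c : L -> B -> k) F :
  (forall l, U l = \sum_b c l b *: x b) ->
  ev U F = ev x (fun h => \sum_g F g * \prod_i c (g i) (h i)).
Proof.
move=> UE; rewrite /ev; under [RHS]eq_bigr => h _ do rewrite scaler_suml.
rewrite exchange_big /=; apply: eq_bigr => g _.
have -> : [ffun i => U (g i)] = [ffun i => \sum_b c (g i) b *: x b].
  by apply/ffunP => i; rewrite !ffunE UE.
rewrite (multilinear_expand (tp_multilinear hW) b0) scaler_sumr.
by apply: eq_bigr => h _; rewrite scalerA.
Qed.

(** Products of the coordinate forms [kap] are multilinear, so they factor through the
    tensor power and separate the words. *)
Lemma ev_inj (L : finType) (U : L -> M) (P : pred L) (kap : L -> M -> k) F :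
    (forall l, P l -> forall (c : k) x y, kap l (c *: x + y) = c * kap l x + kap l y) ->
    (forall l l', P l -> kap l (U l') = (l == l')%:R) ->
  ev U F = 0 -> forall h : word L, (forall i, P (h i)) -> F h = 0.
Proof.
move=> klin kU F0 h Ph.
pose f (v : {ffun 'I_d -> M}) : k^o := \prod_i kap (h i) (v i).
have fM : multilinear f.
  move=> v i c x y; rewrite /f (bigD1 i) // [in X in _ = X + _](bigD1 i) // [in X in _ = _ + X](bigD1 i) //=.
  rewrite !ffunE /= !eqxx klin //.
  have e z : \prod_(j < d | j != i) kap (h j) (finfun [eta v with i |-> z] j)
           = \prod_(j < d | j != i) kap (h j) (v j).
    by apply: eq_bigr => j /negbTE ji; rewrite ffunE /= ji.
  by rewrite !e mulrDl -mulrA.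
have [g [gE _]] := tp_universal hW fM.
have := congr1 g F0; rewrite linear0 linear_sum (bigD1 h) //= big1 => [|h' hh'].
  rewrite addr0 linearZ /= gE /f big1 => [|i _]; last by rewrite ffunE kU // eqxx.
  by rewrite -[_ *: _]/(F h * 1) mulr1.
rewrite linearZ /= gE; have [i hi] : exists i, h i != h' i.
  apply: contrapT => /forallNP e; move/eqP: hh'; apply; apply/ffunP => i.
  by apply/eqP; rewrite eq_sym; apply/negPn/negP/e.
by rewrite /f (bigD1 i) //= ffunE kU // (negbTE hi) mul0r scaler0.
Qed.

Lemma ev_orb_gr (L : finType) (par : L -> bool) (U : L -> M) (a : L -> deg) (g0 : word L) :
  (forall x, gr (a x) (U x)) -> gr (\sum_i a (g0 i)) (ev U (orb k par g0)).
Proof.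
move=> aU; apply: (submodule_sum (@gr_submodule k W _)) => g _.
have [->|/orb_neq0/samewP[s ->]] := eqVneq (orb k par g0 g) 0.
  by rewrite scale0r; apply: gr0.
apply: gr_scale; rewrite (tp_gr hW); exists [:: (1, t [ffun i => U (wperm g0 s i)])]; split.
  move=> p; rewrite inE => /eqP -> /=; exists [ffun i => U (wperm g0 s i)] => //.
  exists (fun i => a (wperm g0 s i)); split; first by move=> i; rewrite [X in gr _ X]ffunE.
  by rewrite [RHS](reindex_inj (@perm_inj _ s)); apply: eq_bigr => i _; rewrite ffunE.
by rewrite big_seq1 scale1r.
Qed.

End Tensors.

(** * The span of the divided products is a subalgebra *)

Section YoungSubgroup.
Variables (d : nat) (B : finType) (cty : pred B).
Notation word L := {ffun 'I_d -> L}.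
Implicit Types (g : word B).

Definition mkperm (f : 'I_d -> 'I_d) : 'S_d :=
  odflt 1%g [pick s : 'S_d | [forall i, s i == f i]].

Lemma mkpermE f i : injective f -> mkperm f i = f i.
Proof.
move=> fi; rewrite /mkperm; case: pickP => [s /forallP/(_ i)/eqP //|/(_ (perm fi))].
by move/negbT/forallPn => [j]; rewrite permE eqxx.
Qed.

Definition mult g : nat := (\prod_(b | cty b) (#|[pred i | g i == b]|)`!)%N.

Definition cgroup g : {pred 'S_d} :=
  [pred s : 'S_d | [forall i, (g (s i) == g i) && (cty (g i) || (s i == i))]].

Lemma cgroupP g (s : 'S_d) : reflect (forall i, g (s i) = g i /\ (~~ cty (g i) -> s i = i)) (s \in cgroup g).
Proof.
apply: (iffP forallP) => e i; have := e i.
  by case/andP=> /eqP -> /orP[->//|/eqP ->].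
by case=> -> si; rewrite eqxx /=; case: (boolP (cty (g i))) => //= /si ->.
Qed.

(** [cgroup g] is the product of the symmetric groups of the sets of places that carry
    one letter of class [cty]. *)
Lemma card_cgroup g : #|cgroup g| = mult g.
Proof.
pose blk b := [set i | g i == b]%SET.
pose F b : {pred 'S_d} := if cty b then [pred s : 'S_d | perm_on (blk b) s] else pred1 1%g.
have FP b (s : 'S_d) : s \in F b -> (forall i, g i != b -> s i = i) /\ (forall i, g i = b -> g (s i) = b).
  rewrite /F; case: ifP => _; rewrite inE; last first.
    by move=> /eqP ->; split=> i; rewrite perm1.
  move=> so; split=> [i gi|i gi].
    by apply: (out_perm so); rewrite inE.
  by have := perm_closed i so; rewrite !inE gi eqxx => /eqP.
have glue_inj (f : {ffun B -> 'S_d}) : f \in family F -> injective (fun i => f (g i) i).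
  move=> /familyP fF i j e; have gij : g i = g j.
    have [_ h] := FP _ _ (fF (g i)); have [_ h'] := FP _ _ (fF (g j)).
    by rewrite -(h i erefl) e (h' j).
  by move: e; rewrite gij => /perm_inj.
pose phi (f : {ffun B -> 'S_d}) := mkperm (fun i => f (g i) i).
have phiE f i : f \in family F -> phi f i = f (g i) i.
  by move=> /glue_inj fi; rewrite /phi mkpermE.
have phi_inj : {in family F &, injective phi}.
  move=> f f' fF f'F e; apply/ffunP => b; apply/permP => i.
  have [gi|gi] := eqVneq (g i) b.
    by have := congr1 (fun s : 'S_d => s i) e; rewrite /= !phiE // gi.
  move/familyP: fF => /(_ b)/FP[-> // _]; move/familyP: f'F => /(_ b)/FP[-> // _].
have -> : mult g = #|family F|.
  rewrite card_family foldrE big_map big_enum /= /mult [LHS]big_mkcond /=.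
  apply: eq_bigr => b _; rewrite /F; case: ifP => _; last by rewrite card1.
  have -> : #|[pred i | g i == b]| = #|blk b| by apply: eq_card => i; rewrite !inE.
  by rewrite -card_perm; apply: eq_card => s; rewrite inE.
rewrite -(card_in_imset phi_inj); apply: eq_card => s; apply/cgroupP/imsetP.
  move=> sP; pose h b i := if (g i == b) && cty b then s i else i.
  have h_inj b : injective (h b).
    move=> i j; rewrite /h; case: (g i =P b) => gi; case: (g j =P b) => gj //=; case: (cty b) => //.
    - exact: perm_inj.
    - by move=> e; case: gj; rewrite -e; case: (sP i) => ->.
    - by move=> e; case: gi; rewrite e; case: (sP j) => ->.
  have fF : [ffun b => mkperm (h b)] \in family F.
    apply/familyP => b; rewrite ffunE /F; case: ifP => cb; rewrite inE.
      apply/fintype.subsetP => i; rewrite !inE mkpermE // /h cb andbT.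
      by case: ifP => //; rewrite eqxx.
    by apply/eqP/permP => i; rewrite mkpermE // /h cb andbF perm1.
  exists [ffun b => mkperm (h b)] => //; apply/permP => i.
  rewrite phiE // ffunE mkpermE // /h eqxx /=; case: ifP => // /negbT nc.
  by have [_ ->] := sP i.
case=> f fF -> i; rewrite phiE //; have [h1 h2] := FP _ _ (elimT familyP fF (g i)).
split; first exact: h2.
move=> nc; move/familyP: fF => /(_ (g i)); rewrite /F (negbTE nc) inE => /eqP ->.
by rewrite perm1.
Qed.

(** When [u] separates the equal letters of class [cty] and no other equal letters, the
    group [cgroup g] acts simply transitively on this fibre. *)
Lemma card_refinement (L : finType) g (u : word L) :
    (forall i j, g i = g j -> if cty (g i) then u i = u j -> i = j else u i = u j) ->
  #|[pred v | samew (wzip g u) (wzip g v)]| = mult g.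
Proof.
move=> sep; rewrite -card_cgroup -(card_in_imset (f := wperm u) (D := mem (cgroup g))).
  apply: eq_card => v; rewrite inE; apply/samew_zipP/imsetP => [[s gs ->]|[s /cgroupP sP ->]].
    have gsi i : g (s i) = g i by rewrite [in RHS]gs ffunE.
    pose h i := if cty (g i) then s i else i.
    have h_inj : injective h.
      move=> i j; rewrite /h; case: ifP => ci; case: ifP => cj //.
      - exact: perm_inj.
      - by move=> e; move: cj; rewrite -e gsi ci.
      - by move=> e; move: ci; rewrite e gsi cj.
    exists (mkperm h).
      apply/cgroupP => i; rewrite mkpermE // /h; case: ifP => ci; last by split.
      by split.
    apply/ffunP => i; rewrite !ffunE mkpermE // /h; case: ifP => // ci.
    by have := sep _ _ (gsi i); rewrite gsi ci.
  exists s => //; apply/ffunP => i; rewrite ffunE; exact/esym/(sP i).1.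
move=> s s' /cgroupP sP /cgroupP sP' e; apply/permP => i.
have [gs nc] := sP i; have [gs' nc'] := sP' i.
have [ci|ci] := boolP (cty (g i)); last by rewrite nc ?nc'.
have := sep (s i) (s' i); rewrite gs gs' ci; apply => //.
by have /ffunP/(_ i) := e; rewrite !ffunE.
Qed.

End YoungSubgroup.

Section LinearSpan.
Variables (k : comNzRingType) (V : lmodType k).

Lemma lspan_in (S : set V) v : S v -> lspan S v.
Proof.
move=> Sv; exists [:: (1, v)]; split; first by move=> p; rewrite inE => /eqP ->.
by rewrite big_seq1 scale1r.
Qed.

Lemma lspan_min (S P : set V) : submodule P -> (forall v, S v -> P v) -> forall v, lspan S v -> P v.
Proof.
move=> sP SP _ [s [sS ->]]; apply: submodule_sum_seq => // p /sS ?.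
by apply: submoduleZ => //; apply: SP.
Qed.

End LinearSpan.

Section Closure.
Variables (k : idomainType) (M W : superalg k) (d : nat) (t : {ffun 'I_d -> M} -> W).
Hypothesis k_char0 : [pchar k] =i pred0.
Hypothesis hW : tensor_power t.
Notation word L := {ffun 'I_d -> L}.
Variables (B : finType) (b0 : B) (vB : B -> M) (dB : B -> deg) (cty : pred B).
Variable str : B -> B -> B -> k.
Notation pB := (fun b => pdeg (dB b)).
(** For the basis of the matrix superalgebra these are the products of two even halves,
    which span a subalgebra. *)
Definition aty b := ~~ pdeg (dB b) && ~~ cty b.
Hypothesis vB_gr : forall b, gr (dB b) (vB b).
Hypothesis cty_even : forall b, cty b -> ~~ pdeg (dB b).
Hypothesis strE : forall b c, smul (vB b) (vB c) = \sum_e str b c e *: vB e.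
Hypothesis str_deg : forall b c e, str b c e != 0 -> dB e = dB b + dB c.
Hypothesis str_aty : forall b c e, aty b -> aty c -> str b c e != 0 -> aty e.

(** The algebra [TA] in abstract form: [vB] will list the basis of the matrix
    superalgebra, and [cty] will be the set of the products of two odd halves. *)
Definition divspan : set W :=
  lspan [set w | exists g : word B, goodw pB g /\ w = (mult cty g)%:R *: ev t vB (orb k pB g)]%classic.

(** Symmetrised words in arbitrary homogeneous elements of which only those
    supported on the letters of class [aty] are repeated: this description of
    [divspan] is visibly closed under products. *)
Definition symm (w : W) : Prop :=
  exists (L : finType) (dL : L -> deg) (c : L -> B -> k) (g : word L),
  [/\ goodw (fun l => pdeg (dL l)) g,
      (forall l b, c l b != 0 -> dB b = dL l),
      (forall i j b, g i = g j -> i != j -> c (g i) b != 0 -> aty b)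
    & w = ev t (fun l => \sum_b c l b *: vB b) (orb k (fun l => pdeg (dL l)) g)].

Definition symmspan : set W := lspan (symm : set W).

(** Let equal letters of class [cty] carry different markers. Forgetting the markers maps
    the orbit of the marked word to a multiple of the orbit of the word, the factor
    being the product of the factorials by [card_refinement]. *)
Lemma divspan_symm w : divspan w -> symmspan w.
Proof.
apply: lspan_min; first exact: lspan_submodule.
move=> {}w [g [gg ->]]; apply: lspan_in.
pose L : finType := (B * option 'I_d)%type.
pose u : word (option 'I_d) := [ffun i => if cty (g i) then Some i else None].
pose pL (l : L) := pdeg (dB l.1).
have gL : goodw pL (wzip g u).
  move=> i j; rewrite !ffunE => -[gij _] pi; apply: gg => //.
exists L, (fun l => dB l.1), (fun l b => (l.1 == b)%:R), (wzip g u); split=> //.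
- by move=> l b; case: (l.1 =P b) => [<- //|_]; rewrite eqxx.
- move=> i j b; rewrite [wzip g u i]ffunE [wzip g u j]ffunE /= => -[gij uij] nij.
  case: (g i =P b) => [<- _|_]; last by rewrite eqxx.
  rewrite /aty; apply/andP; split.
    by apply/negP => pi; move/eqP: nij; apply; apply: gg.
  apply/negP => ci; move: uij; rewrite /u !ffunE -gij ci => -[ij].
  by rewrite ij eqxx in nij.
have -> : ev t (fun l : L => \sum_b (l.1 == b)%:R *: vB b) (orb k pL (wzip g u))
    = ev t vB (fun h => \sum_v orb k pL (wzip g u) (wzip h v)).
  rewrite /ev big_wzip; apply: eq_bigr => h _; rewrite scaler_suml.
  apply: eq_bigr => v _; congr (_ *: t _); apply/ffunP => i; rewrite !ffunE.
  rewrite (bigD1 (h i)) //= eqxx scale1r big1 ?addr0 // => b bh.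
  by rewrite eq_sym (negbTE bh) scale0r.
symmetry; apply: ev_scale => h.
pose F h' := \sum_v orb k pL (wzip g u) (wzip h' v).
have eF : eqv pB F.
  move=> h' s; rewrite /F mulr_sumr (reindex (@wperm d _ ^~ s)) /=; last exact/onW_bij/wperm_bij.
  apply: eq_bigr => v _; rewrite -wzip_perm orb_eqv //; congr (_ ^+ nat_of_bool _ * _).
  by apply: eq_sperm => i; rewrite /pL /= ffunE.
have F1 : F g = (mult cty g)%:R.
  rewrite -(@card_refinement d B cty _ g u) => [|i j gij].
    rewrite -sum1_card natr_sum [RHS]big_mkcond /=; apply: eq_bigr => v _; rewrite inE.
    case: ifP => [|/negbT/orb_out //] /samew_zipP[s gs ->].
    have -> : wzip g (wperm u s) = wperm (wzip g u) s by rewrite wzip_perm -gs.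
    rewrite orb_perm //.
    transitivity (sgn k pB g s); last by rewrite sgn_stab.
    by congr (_ ^+ nat_of_bool _); apply: eq_sperm => i; rewrite /pL /= ffunE.
  by rewrite /u !ffunE -gij; case: (cty (g i)) => // -[].
rewrite -F1; apply: (eqv_orb eF gg) => h' /sum_neq0[v /orb_neq0/samew_zipP[s -> _]].
exact: samew_perm.
Qed.

(** In terms of the basis, the coefficient of a word [h] is a sum of functions on which
    [cgroup cty h] acts freely and without signs, so it is divisible by the order of this
    group. *)
Lemma symm_div w : symm w -> divspan w.
Proof.
case=> L [dL [c [g [gg cdeg catt ->]]]]; set pL := fun l : L => _ in gg *.
rewrite (ev_change hW b0 (c := c) (x := vB)) //.
pose f (h : word B) g1 := orb k pL g g1 * \prod_i c (g1 i) (h i).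
pose F (h : word B) := \sum_g1 f h g1.
have fnz h g1 : f h g1 != 0 -> samew g g1 /\ forall i, c (g1 i) (h i) != 0.
  rewrite /f mulf_eq0 negb_or => /andP[/orb_neq0 -> /prodf_neq0 cc]; split=> // i.
  exact: cc.
have fpar (h : word B) g1 i : f h g1 != 0 -> pL (g1 i) = pB (h i).
  by move=> /fnz[_ /(_ i)/cdeg]; rewrite /pL => ->.
have fperm h g1 s : f (wperm h s) (wperm g1 s) = sgn k pB h s * f h g1.
  have prodE : \prod_i c (wperm g1 s i) (wperm h s i) = \prod_i c (g1 i) (h i).
    rewrite [RHS](reindex_inj (@perm_inj _ s)); apply: eq_bigr => i _.
    by rewrite !ffunE.
  have [f0|nz] := eqVneq (f h g1) 0; last first.
    rewrite /f orb_eqv // prodE mulrA; congr (_ * _ * _).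
    by congr (_ ^+ nat_of_bool _); apply: eq_sperm => i; apply: fpar nz.
  by rewrite f0 mulr0 /f orb_eqv // prodE -mulrA -/(f h g1) f0 mulr0.
have eF : eqv pB F.
  move=> h s; rewrite /F mulr_sumr (reindex (@wperm d _ ^~ s)) /=; last exact/onW_bij/wperm_bij.
  by apply: eq_bigr => g1 _; apply: fperm.
(* The letters of class cty of h are separated by g1, so that the permutations
   of their places act freely on the terms of F h. *)
have Fdiv h : exists e, F h = (mult cty h)%:R * e.
  have stab s g1 : s \in cgroup cty h -> f h (wperm g1 s) = f h g1.
    move=> /cgroupP sP; have hs : wperm h s = h.
      by apply/ffunP => i; rewrite ffunE; case: (sP i).
    rewrite -[in LHS]hs fperm /sgn sperm_fix ?mul1r // => i /= pi.
    by apply: (sP i).2; apply: contraL pi; apply: cty_even.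
  have free s s' g1 : s \in cgroup cty h -> s' \in cgroup cty h -> f h g1 != 0 ->
      wperm g1 s = wperm g1 s' -> s = s'.
    move=> /cgroupP sP /cgroupP sP' nz e; apply/permP => i.
    have [ci|ci] := boolP (cty (h i)); last by rewrite (sP i).2 ?(sP' i).2.
    have gi : g1 (s i) = g1 (s' i) by have /ffunP/(_ i) := e; rewrite !ffunE.
    have [/samewP[r g1E] cc] := fnz _ _ nz.
    have [//|ns] := eqVneq (s i) (s' i).
    have : aty (h (s i)).
      apply: (catt (r (s i)) (r (s' i))); rewrite ?(inj_eq perm_inj) //.
        by move: gi; rewrite g1E !ffunE.
      by have := cc (s i); rewrite g1E ffunE.
    by rewrite (sP i).1 /aty ci andbF.
  have mulg s s' : s \in cgroup cty h -> s' \in cgroup cty h -> (s' * s)%g \in cgroup cty h.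
    move=> /cgroupP sP /cgroupP sP'; apply/cgroupP => i; rewrite permM (sP _).1 (sP' _).1.
    by split=> // ci; rewrite (sP' _).2 // (sP _).2.
  have invg s : s \in cgroup cty h -> s^-1%g \in cgroup cty h.
    move=> /cgroupP sP; apply/cgroupP => i; have := sP (s^-1%g i); rewrite permKV => -[-> si].
    by split=> // /si.
  have id1 : 1%g \in cgroup cty h by apply/cgroupP => i; rewrite perm1.
  pose orbit g1 : {set word L} := [set wperm g1 s | s in cgroup cty h]%SET.
  have orbitP g1 g2 : g2 \in orbit g1 -> orbit g2 = orbit g1.
    case/imsetP => s sG ->; apply/setP => v; apply/imsetP/imsetP => -[s' s'G ->].
      by exists (s' * s)%g; rewrite ?mulg // wpermM.
    by exists (s' * s^-1)%g; rewrite ?mulg ?invg // wpermM mulgKV.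
  have orbit_id g1 : g1 \in orbit g1 by apply/imsetP; exists 1%g; rewrite ?wperm1.
  have Fsum : F h = \sum_(o : {set word L}) \sum_(g1 | orbit g1 == o) f h g1.
    by rewrite /F (partition_big orbit predT).
  have ex o : exists e, \sum_(g1 | orbit g1 == o) f h g1 = (mult cty h)%:R * e.
    have [[g1 /andP[/eqP og1 nz]]|/forallNP nex] := pselect (exists g1, (orbit g1 == o) && (f h g1 != 0)).
      exists (f h g1).
      rewrite (eq_bigl (fun g2 => g2 \in orbit g1)) => [|g2]; last first.
        apply/eqP/idP => [o2|/orbitP -> //]; by rewrite og1 -o2.
      rewrite (eq_bigr (fun=> f h g1)) => [|g2 /imsetP[s sG ->]]; last exact: stab.
      rewrite sumr_const card_in_imset ?card_cgroup ?mulr_natl // => s s' sG s'G.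
      exact: free.
    exists 0; rewrite mulr0 big1 // => g1 og1; apply/eqP/negPn/negP => nz.
    by apply: (nex g1); rewrite og1.
  have [e eE] := choice ex; exists (\sum_o e o); rewrite Fsum mulr_sumr.
  by apply: eq_bigr.
rewrite (eq_ev t vB (F' := F)) // (ev_decomp _ _ k_char0 eF).
apply: submodule_sum; first exact: lspan_submodule.
move=> h /andP[_ nz]; have [e eE] := Fdiv h; rewrite eE mulrC -scalerA.
apply: submoduleZ; first exact: lspan_submodule.
by apply: lspan_in; exists h; split => //; apply: eqv_good eF nz.
Qed.

(** A pair of names is repeated only if both names are, and then the product of the two
    elements is again supported on the class [aty]. *)
Lemma symm_mul w w' : symm w -> symm w' -> symmspan (smul w w').
Proof.
case=> L [dL [c [g [gg cdeg catt ->]]]] [L' [dL' [c' [g' [gg' cdeg' catt' ->]]]]].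
have homL (N : finType) (dN : N -> deg) (e : N -> B -> k) :
    (forall l b, e l b != 0 -> dB b = dN l) -> forall l, gr (dN l) (\sum_b e l b *: vB b).
  move=> edeg l; apply: (submodule_sum (@gr_submodule k M _)) => b _.
  have [->|/edeg <-] := eqVneq (e l b) 0; last exact: gr_scale.
  by rewrite scale0r; apply: gr0.
rewrite (ev_mul hW _ _ (homL _ _ _ cdeg) (homL _ _ _ cdeg')).
pose N : finType := (L * L')%type; pose dN (x : N) := dL x.1 + dL' x.2.
pose e (x : N) b := \sum_b1 \sum_b2 c x.1 b1 * c' x.2 b2 * str b1 b2 b.
set F := fun w : word N => _.
have -> : ev t (fun x : N => smul (\sum_b c x.1 b *: vB b) (\sum_b c' x.2 b *: vB b)) F
    = ev t (fun x : N => \sum_b e x b *: vB b) F.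
  apply: eq_bigr => w1 _; congr (_ *: t _); apply/ffunP => i; rewrite !ffunE.
  rewrite smul_suml; under [RHS]eq_bigr => b _ do rewrite /e scaler_suml.
  rewrite [RHS]exchange_big /=; apply: eq_bigr => b1 _.
  rewrite smulZl smul_sumr scaler_sumr.
  under [RHS]eq_bigr => b _ do rewrite scaler_suml.
  rewrite [RHS]exchange_big /=; apply: eq_bigr => b2 _.
  rewrite smulZr strE !scaler_sumr; apply: eq_bigr => b _.
  by rewrite !scalerA.
have eF : eqv (fun x => pdeg (dN x)) F.
  move=> w1 s; have [h [h' ->]] := wunzip w1.
  rewrite wzip_perm /F !wfst_zip !wsnd_zip !orb_eqv //.
  have -> : (-1) ^+ theta (fun i => pdeg (dL (wzip (wperm h s) (wperm h' s) i).1))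
                    (fun i => pdeg (dL' (wzip (wperm h s) (wperm h' s) i).2)) =
     (-1) ^+ theta (fun i => pdeg (dL (wzip h h' i).1)) (fun i => pdeg (dL' (wzip h h' i).2)) *
     (sgn k (fun l => pdeg (dL l)) h s * sgn k (fun l => pdeg (dL' l)) h' s *
      sgn k (fun x => pdeg (dN x)) (wzip h h') s).
    rewrite -!signr_addb; congr (_ ^+ nat_of_bool _).
    rewrite (@eq_theta _ _ ((fun i => pdeg (dL (wzip h h' i).1)) \o s) _
       ((fun i => pdeg (dL' (wzip h h' i).2)) \o s)); try by move=> i; rewrite /= !ffunE.
    rewrite theta_perm; congr (_ (+) (_ (+) _ (+) _)); apply: eq_sperm => i /=.
    - by rewrite ffunE.
    - by rewrite ffunE.
    - by rewrite /dN pdegD.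
  set a := sgn k _ h s; set b := sgn k _ h' s; set ab := sgn _ _ (wzip _ _) s.
  have aa : a * a = 1 by apply: sgnK.
  have bb : b * b = 1 by apply: sgnK.
  set th := (-1) ^+ _; set o := orb _ _ _ _; set o' := orb _ _ _ _.
  have -> : a * o * (b * o') * (th * (a * b * ab)) = a * a * (b * b) * (ab * (o * o' * th)) by ring.
  by rewrite aa bb !mul1r.
rewrite (ev_decomp _ _ k_char0 eF); apply: submodule_sum; first exact: lspan_submodule.
move=> w1 /andP[_ nz]; apply: submoduleZ; first exact: lspan_submodule.
apply: lspan_in; exists N, dN, e, w1.
have gw := eqv_good k_char0 eF nz.
have e_nz x b : e x b != 0 -> exists b1 b2, [/\ c x.1 b1 != 0, c' x.2 b2 != 0 & str b1 b2 b != 0].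
  move=> /sum_neq0[b1 /sum_neq0[b2]]; rewrite !mulf_eq0 !negb_or => /andP[/andP[]].
  by exists b1, b2.
split=> //.
  by move=> x b /e_nz[b1 [b2 [/cdeg e1 /cdeg' e2 /str_deg ->]]]; rewrite /dN e1 e2.
have [h [h' w1E]] := wunzip w1; rewrite w1E in nz *.
move: nz; rewrite /F wfst_zip wsnd_zip !mulf_eq0 !negb_or -andbA.
case/and3P=> /orb_neq0/samewP[s hE] /orb_neq0/samewP[s' hE'] _.
move=> i j b; rewrite [wzip h h' i]ffunE [wzip h h' j]ffunE => -[hij hij'] nij.
case/e_nz => b1 [b2 [/= c1 c2]]; apply: str_aty.
  apply: (catt (s i) (s j)); rewrite ?(inj_eq perm_inj) //.
    by move: hij; rewrite hE !ffunE.
  by move: c1; rewrite hE ffunE.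
apply: (catt' (s' i) (s' j)); rewrite ?(inj_eq perm_inj) //.
  by move: hij'; rewrite hE' !ffunE.
by move: c2; rewrite hE' ffunE.
Qed.

Theorem divspan_mul w w' : divspan w -> divspan w' -> divspan (smul w w').
Proof.
have sub v : symmspan v -> divspan v.
  by apply: lspan_min; [apply: lspan_submodule|apply: symm_div].
move=> /divspan_symm sw /divspan_symm sw'; apply: sub; move: w sw.
apply: (lspan_min (P := [set w | symmspan (smul w w')]%classic)).
  split=> [|c u v Su Sv]; rewrite /mkset.
    by rewrite smul0l; case: (lspan_submodule (symm : set W)).
  by rewrite smul_linl; apply: (lspan_submodule _).2.
move=> w sw; move: w' sw'; apply: (lspan_min (P := [set w' | symmspan (smul w w')]%classic)).
  split=> [|c u v Su Sv]; rewrite /mkset.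
    by rewrite smul0r; case: (lspan_submodule (symm : set W)).
  by rewrite smul_linr; apply: (lspan_submodule _).2.
by move=> w'; apply: symm_mul.
Qed.

End Closure.

(** * Coordinates in a based quasi-hereditary superalgebra *)

Section Components.
Variables (k : comNzRingType) (V : superalg k).

Lemma gr_component (J : eqType) (s : seq J) (a : J -> V) (dg : J -> deg) (x : V) (g : deg) :
    (forall j, j \in s -> gr (dg j) (a j)) -> gr g x -> \sum_(j <- s) a j = x ->
  forall h, \sum_(j <- s | dg j == h) a j = if h == g then x else 0.
Proof.
move=> ga gx sx h.
pose v h' := \sum_(j <- s | dg j == h') a j - (if h' == g then x else 0).
pose S := undup (g :: map dg s).
have gv h' : gr h' (v h').
  apply: submoduleB; first exact: gr_submodule.
    rewrite big_seq_cond; apply: submodule_sum; first exact: gr_submodule.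
    by move=> j /andP[/ga + /eqP <-].
  by case: eqP => [->//|_]; apply: gr0.
have v0 : \sum_(h' <- S) v h' = 0.
  rewrite sumrB; apply/eqP; rewrite subr_eq0; apply/eqP.
  rewrite (exchange_big_dep predT) //= [RHS](bigD1_seq g) ?undup_uniq //=; last first.
    by rewrite mem_undup inE eqxx.
  rewrite eqxx [X in _ = _ + X]big1 ?addr0 => [|h' /negbTE -> //].
  rewrite -[RHS]sx [LHS]big_seq [RHS]big_seq; apply: eq_bigr => j js.
  rewrite -big_filter (_ : [seq _ <- S | _] = [:: dg j]) ?big_seq1 //.
  have -> : [seq i <- S | dg j == i] = [seq i <- S | pred1 (dg j) i].
    by apply: eq_filter => i; rewrite eq_sym.
  apply: filter_pred1_uniq; rewrite ?undup_uniq // mem_undup inE.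
  by apply/orP; right; apply/mapP; exists j.
have [hS|hS] := boolP (h \in S).
  by have /eqP := @gr_indep k V S v (undup_uniq _) gv v0 h hS; rewrite subr_eq0 => /eqP.
move: hS; rewrite mem_undup inE negb_or => /andP[/negbTE -> hs].
rewrite big_seq_cond big1 // => j /andP[js /eqP dj]; case/negP: hs.
by rewrite -dj; apply/mapP; exists j.
Qed.

Lemma gr_unique (x : V) g h : x != 0 -> gr g x -> gr h x -> g = h.
Proof.
move=> x0 gx hx; apply/eqP; apply: contraNT x0 => /negbTE gh.
have := @gr_component _ [:: x] id (fun=> g) x h _ hx _ h.
rewrite big_seq1 eqxx big_cons big_nil gh => <- // j.
by rewrite inE => /eqP ->.
Qed.

Lemma parity_gr (g : deg) (x : V) (eps : 'Z_2) : gr g x -> x != 0 ->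
  parity_part eps x <-> g.2 = eps.
Proof.
move=> gx x0; split=> [[s [sP xE]]|<-]; last first.
  by apply: lspan_in; exists g.1 => //; rewrite /= -surjective_pairing.
have ex (p : k * V) : exists m : int, p \in s -> gr (m, eps) p.2.
  have [/sP[m _ gm]|_] := boolP (p \in s); first by exists m.
  by exists 0.
have [m mP] := choice ex.
apply/eqP; apply: contraNT x0 => ge.
have ga p : p \in s -> gr (m p, eps) (p.1 *: p.2) by move=> /mP; apply: gr_scale.
have := gr_component ga gx (esym xE) g; rewrite eqxx => <-.
by rewrite big1 // => p /eqP gE; rewrite -gE eqxx in ge.
Qed.

Lemma even_pdeg (g : deg) (x : V) : gr g x -> x != 0 -> (evenE x <-> ~~ pdeg g).
Proof.
move=> gx x0; apply: (iff_trans (parity_gr 0 gx x0)).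
by rewrite /pdeg; split=> [->|/negPn/eqP]; rewrite ?eqxx.
Qed.

Lemma odd_pdeg (g : deg) (x : V) : gr g x -> x != 0 -> (oddE x <-> pdeg g).
Proof.
move=> gx x0; apply: (iff_trans (parity_gr 1 gx x0)); rewrite /pdeg.
case: g {gx} => a b /=; split=> [->//|].
by case: b => [[|[|b]] //] ib _; apply: val_inj.
Qed.

End Components.

Section Enumeration.
Variables (T : choiceType) (I : finType) (X : I -> set T).

Lemma enum_family : (forall i, finite_set (X i)) ->
    (forall i j x, X i x -> X j x -> i = j) ->
  exists (P : finType) (c : P -> I) (v : P -> T),
    injective v /\ forall i x, X i x <-> exists2 xi, c xi = i & v xi = x.
Proof.
move=> fX dX.
have ex i : exists s : seq T, X i = [set` s]%classic.
  by have /finite_seqP := fX i.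
have [s sE] := choice ex.
pose P : finType := {i : I & seq_sub (s i)}.
exists P, (fun z : P => tag z), (fun z : P => ssval (tagged z)); split.
  move=> [i [x xi]] [j [y yj]] /= xy; rewrite -xy in yj *.
  have ij : i = j by apply: (dX i j x); rewrite sE /=.
  by rewrite -ij in yj *; congr existT; apply: val_inj.
move=> i x; rewrite sE /=; split=> [xi|[[j [y yj]] /= <- <-] //].
by exists (existT _ i (SeqSub xi)).
Qed.

End Enumeration.

(** Heredity data whose sets of generators are enumerated by finite types. *)
Record presentation (k : idomainType) (A : superalg k) (I : finType) (leI : rel I)
    (X Y : I -> set A) (e : I -> A) := Presentation {
  based_hd : heredity_data leI X Y e [set: A]%classic;
  PX : finType;
  PY : finType;
  cX : PX -> I;
  cY : PY -> I;
  vX : PX -> A;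
  vY : PY -> A;
  vX_inj : injective vX;
  vY_inj : injective vY;
  XP : forall i x, X i x <-> exists2 xi, cX xi = i & vX xi = x;
  YP : forall i y, Y i y <-> exists2 eta, cY eta = i & vY eta = y;
  dX : PX -> deg;
  dY : PY -> deg;
  grX : forall xi, gr (dX xi) (vX xi);
  grY : forall eta, gr (dY eta) (vY eta);
  eX : I -> PX;
  eY : I -> PY;
  ceX : forall i, cX (eX i) = i;
  ceY : forall i, cY (eY i) = i;
  veX : forall i, vX (eX i) = e i;
  veY : forall i, vY (eY i) = e i
}.

Lemma presentation_exists (k : idomainType) (A : superalg k) (I : finType) (leI : rel I)
    (X Y : I -> set A) (e : I -> A) :
  heredity_data leI X Y e [set: A]%classic -> inhabited (presentation leI X Y e).
Proof.
move=> hA.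
have [PX0 [cX0 [vX0 [vXi XP0]]]] := enum_family (hd_finX hA) (hd_disjX hA).
have [PY0 [cY0 [vY0 [vYi YP0]]]] := enum_family (hd_finY hA) (hd_disjY hA).
have exX xi : exists g, gr g (vX0 xi).
  have [_ [g _ gx]] := hd_homX hA ((XP0 _ _).2 (ex_intro2 _ _ xi erefl erefl)).
  by exists g.
have exY eta : exists g, gr g (vY0 eta).
  have [_ [g _ gx]] := hd_homY hA ((YP0 _ _).2 (ex_intro2 _ _ eta erefl erefl)).
  by exists g.
have [dX0 grX0] := choice exX; have [dY0 grY0] := choice exY.
have iX i : exists xi, cX0 xi = i /\ vX0 xi = e i.
  by have [/XP0[xi ? ?] _] := hd_init hA i; exists xi.
have iY i : exists eta, cY0 eta = i /\ vY0 eta = e i.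
  by have [_ /YP0[eta ? ?]] := hd_init hA i; exists eta.
have [eX0 eXP] := choice iX; have [eY0 eYP] := choice iY.
exists; exact: (Presentation hA vXi vYi XP0 YP0 grX0 grY0 (fun i => (eXP i).1) (fun i => (eYP i).1)
  (fun i => (eXP i).2) (fun i => (eYP i).2)).
Qed.

Section Coordinates.
Variables (k : idomainType) (A : superalg k) (I : finType) (leI : rel I).
Variables (X Y : I -> set A) (e : I -> A) (D : presentation leI X Y e).
Local Notation hA := (based_hd D).
Local Notation PX := (PX D).
Local Notation PY := (PY D).
Local Notation cX := (@cX _ _ _ _ _ _ _ D).
Local Notation cY := (@cY _ _ _ _ _ _ _ D).
Local Notation vX := (@vX _ _ _ _ _ _ _ D).
Local Notation vY := (@vY _ _ _ _ _ _ _ D).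
Local Notation vX_inj := (@vX_inj _ _ _ _ _ _ _ D).
Local Notation vY_inj := (@vY_inj _ _ _ _ _ _ _ D).
Local Notation XP := (@XP _ _ _ _ _ _ _ D).
Local Notation YP := (@YP _ _ _ _ _ _ _ D).
Local Notation dX := (@dX _ _ _ _ _ _ _ D).
Local Notation dY := (@dY _ _ _ _ _ _ _ D).
Local Notation eX := (eX D).
Local Notation eY := (eY D).
Local Notation ceX := (@ceX _ _ _ _ _ _ _ D).
Local Notation ceY := (@ceY _ _ _ _ _ _ _ D).
Local Notation veX := (@veX _ _ _ _ _ _ _ D).
Local Notation veY := (@veY _ _ _ _ _ _ _ D).

Definition vXY (b : PX * PY) : A := smul (vX b.1) (vY b.2).
Definition matched (b : PX * PY) : bool := cX b.1 == cY b.2.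

Lemma vXX xi : X (cX xi) (vX xi). Proof. by apply/XP; exists xi. Qed.
Lemma vYY eta : Y (cY eta) (vY eta). Proof. by apply/YP; exists eta. Qed.

Lemma vX_e xi : smul (vX xi) (e (cX xi)) = vX xi.
Proof. exact: (hd_xe hA (vXX xi)). Qed.

Lemma e_vY eta : smul (e (cY eta)) (vY eta) = vY eta.
Proof. exact: (hd_ey hA (vYY eta)). Qed.

Lemma e_orth i j : i != j -> smul (e i) (e j) = 0.
Proof.
move=> ij; have [Xj _] := hd_init hA j; have [Xi Yi] := hd_init hA i.
have [e1|//] := hd_ejx hA i Xj; have [e2|//] := hd_yej hA j Yi.
rewrite e1 in e2; rewrite -e2 in Xi.
by move: ij; rewrite (hd_disjX hA Xi Xj) eqxx.
Qed.

Lemma unmatched0 b : ~~ matched b -> vXY b = 0.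
Proof.
move=> nb; rewrite /vXY -vX_e -e_vY smulA -[smul (smul (vX _) _) _]smulA e_orth //.
by rewrite smul0r smul0l.
Qed.

Lemma vXY_inj b b' : matched b -> matched b' -> vXY b = vXY b' -> b = b'.
Proof.
move=> /eqP mb /eqP mb' e'; have Yb := vYY b.2; have Yb' := vYY b'.2.
rewrite -mb in Yb; rewrite -mb' in Yb'.
have [_ /vX_inj e1 /vY_inj e2] := hd_distinct hA (vXX b.1) Yb (vXX b'.1) Yb' e'.
by rewrite [b]surjective_pairing e1 e2 -surjective_pairing.
Qed.

Lemma vXY_basis b : matched b -> hered_basis X Y (vXY b).
Proof.
move=> /eqP mb; exists (cX b.1) => //; exists (vX b.1); first exact: vXX.
by exists (vY b.2) => //; rewrite mb; apply: vYY.
Qed.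

Lemma hered_basisP u : hered_basis X Y u -> exists2 b, matched b & u = vXY b.
Proof.
case=> i _ [x /XP[xi ci <-] [y /YP[eta ceta <-] <-]].
by exists (xi, eta) => //; rewrite /matched /= ci ceta.
Qed.

Lemma coord_exists a : exists c : PX * PY -> k, a = \sum_(b | matched b) c b *: vXY b.
Proof.
have : lspan (hered_basis X Y) a by rewrite (hd_span hA).
apply: (lspan_min (P := [set a | exists c : PX * PY -> k,
  a = \sum_(b | matched b) c b *: vXY b]%classic)).
  split; first by exists (fun=> 0); rewrite big1 // => b _; rewrite scale0r.
  move=> c u v [c1 ->] [c2 ->]; exists (fun b => c * c1 b + c2 b).
  rewrite scaler_sumr -big_split /=; apply: eq_bigr => b _.
  by rewrite scalerDl scalerA.
move=> _ /hered_basisP[b mb ->]; exists (fun b' => (b' == b)%:R).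
rewrite (bigD1 b) //= eqxx scale1r big1 ?addr0 // => b' /andP[_ /negbTE ->].
by rewrite scale0r.
Qed.

(** These coordinates vanish at the unmatched pairs, whose product is 0 ([unmatched0]). *)
Definition acoord a : PX * PY -> k :=
  fun b => if matched b then sval (cid (coord_exists a)) b else 0.

Lemma coordE a : a = \sum_b acoord a b *: vXY b.
Proof.
rewrite [LHS](svalP (cid (coord_exists a))) [LHS]big_mkcond /=; apply: eq_bigr => b _.
by rewrite /acoord; case: ifP => //; rewrite scale0r.
Qed.

Lemma coord_indep (c : PX * PY -> k) : \sum_(b | matched b) c b *: vXY b = 0 ->
  forall b, matched b -> c b = 0.
Proof.
move=> c0 b mb.
pose s := [seq vXY b | b <- enum matched].
pose c' u := \sum_(b | matched b && (vXY b == u)) c b.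
have c'E b' : matched b' -> c' (vXY b') = c b'.
  move=> mb'; rewrite /c' (bigD1 b') /= ?mb' ?eqxx // big1 ?addr0 // => b2.
  by case/andP=> /andP[mb2 /eqP /(vXY_inj mb2 mb') ->]; rewrite eqxx.
rewrite -(c'E b mb); apply: (hd_indep hA (s := s) (c := c')).
- rewrite map_inj_in_uniq ?enum_uniq // => b1 b2; rewrite !mem_enum => m1 m2.
  exact: vXY_inj.
- by move=> u /mapP[b']; rewrite mem_enum => mb' ->; apply: vXY_basis.
- rewrite big_map big_enum /= -[RHS]c0; apply: eq_bigr => b' mb'.
  by rewrite c'E.
- by apply/mapP; exists b; rewrite ?mem_enum.
Qed.

Lemma coord_unique a (c : PX * PY -> k) : a = \sum_b c b *: vXY b ->
  forall b, acoord a b = if matched b then c b else 0.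
Proof.
move=> aE b; case: ifP => [mb|nb]; last by rewrite /acoord nb.
apply/eqP; rewrite -subr_eq0; apply/eqP.
apply: (coord_indep (c := fun b => acoord a b - c b)) mb.
rewrite (eq_bigr (fun b => acoord a b *: vXY b - c b *: vXY b)); last by move=> b' _; rewrite scalerBl.
rewrite sumrB; apply/eqP; rewrite subr_eq0; apply/eqP.
have full (f : PX * PY -> k) : \sum_(b | matched b) f b *: vXY b = \sum_b f b *: vXY b.
  rewrite [RHS](bigID matched) /= [X in _ = _ + X]big1 ?addr0 // => b' nb.
  by rewrite unmatched0 // scaler0.
by rewrite !full -coordE -aE.
Qed.

Lemma coord_lin c a a' b : acoord (c *: a + a') b = c * acoord a b + acoord a' b.
Proof.
rewrite (@coord_unique _ (fun b => c * acoord a b + acoord a' b)).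
  by case: ifP => // nb; rewrite /acoord nb mulr0 addr0.
under eq_bigr => b' _ do rewrite scalerDl -scalerA.
by rewrite big_split /= -scaler_sumr -!coordE.
Qed.

Lemma acoord0 b : acoord 0 b = 0.
Proof.
rewrite (@coord_unique _ (fun=> 0)) ?if_same // big1 // => b' _.
by rewrite scale0r.
Qed.

Lemma coord_sub_submodule (P : pred (PX * PY)) :
  submodule [set a : A | forall b, acoord a b != 0 -> P b]%classic.
Proof.
split=> [b|c u v Su Sv b]; first by rewrite acoord0 eqxx.
rewrite coord_lin; have [->|/Su //] := eqVneq (acoord u b) 0.
by rewrite mulr0 add0r; apply: Sv.
Qed.

Lemma coord_vXY b b' : matched b -> acoord (vXY b) b' = (b' == b)%:R.
Proof.
move=> mb; rewrite (@coord_unique _ (fun b' => (b' == b)%:R)).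
  by case: ifP => // nb; case: eqP => // eb; rewrite eb mb in nb.
rewrite (bigD1 b) //= eqxx scale1r big1 ?addr0 // => b2 /negbTE ->.
by rewrite scale0r.
Qed.

Lemma vXY_neq0 b : matched b -> vXY b != 0.
Proof.
move=> mb; apply/eqP => b0; have := coord_vXY b mb.
by rewrite b0 acoord0 eqxx => /eqP; rewrite eq_sym oner_eq0.
Qed.

Lemma matched_eY xi : matched (xi, eY (cX xi)).
Proof. by rewrite /matched /= ceY. Qed.

Lemma matched_eX eta : matched (eX (cY eta), eta).
Proof. by rewrite /matched /= ceX. Qed.

Lemma vXY_eY xi : vXY (xi, eY (cX xi)) = vX xi.
Proof. by rewrite /vXY /= veY vX_e. Qed.

Lemma vXY_eX eta : vXY (eX (cY eta), eta) = vY eta.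
Proof. by rewrite /vXY /= veX e_vY. Qed.

Lemma vX_neq0 xi : vX xi != 0.
Proof. by rewrite -vXY_eY vXY_neq0 // matched_eY. Qed.

Lemma vY_neq0 eta : vY eta != 0.
Proof. by rewrite -vXY_eX vXY_neq0 // matched_eX. Qed.

Definition dXY (b : PX * PY) : deg := dX b.1 + dY b.2.

Lemma gr_vXY b : gr (dXY b) (vXY b).
Proof. exact: gr_smul (grX _) (grY _). Qed.

Lemma coord_deg a g b : gr g a -> acoord a b != 0 -> dXY b = g.
Proof.
move=> ga nz; have [//|gb] := eqVneq (dXY b) g.
have mb : matched b by move: nz; rewrite /acoord; case: ifP => //; rewrite eqxx.
have := gr_component (s := index_enum _) (a := fun b => acoord a b *: vXY b) (dg := dXY) _ ga (esym (coordE a)) (dXY b).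
rewrite (negbTE gb) => h; have {}h := h (fun b' _ => gr_scale _ (gr_vXY b')).
suff : (if dXY b == dXY b then acoord a b else 0) = 0 by rewrite eqxx => e0; rewrite e0 eqxx in nz.
apply: (coord_indep (c := fun b' => if dXY b' == dXY b then acoord a b' else 0)) mb.
rewrite -[RHS]h [RHS]big_mkcond [RHS](bigID matched) /= [X in _ = _ + X]big1 ?addr0; last first.
  by move=> b' nb; rewrite unmatched0 // scaler0 if_same.
by apply: eq_bigr => b' _; case: ifP => //; rewrite scale0r.
Qed.

(** As [e j] is one of the elements of [Y j], its product with [vX xi] is a combination of
    elements of [Y j] modulo larger components, and it is also a basis element. *)
Lemma weightX xi j : smul (e j) (vX xi) = vX xi -> leI j (cX xi) /\ (j = cX xi -> xi = eX j).
Proof.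
move=> ex; have [_ Yj] := hd_init hA j; have [rf _ _] := hd_poset hA.
have [u Yu] := hd_right hA (a := vX xi) Yj Logic.I.
rewrite ex => above.
pose P (b : PX * PY) := (b.1 == eX j) || (leI j (cX b.1) && (j != cX b.1)).
have sP := coord_sub_submodule P; set S := mkset _ in sP.
have Su : S u.
  apply: (lspan_min sP _ Yu) => y /YP[eta ceta <-] b; rewrite -vXY_eX coord_vXY ?matched_eX //.
  by case: (b =P _) => [->|_]; rewrite ?eqxx // /P /= ceta eqxx.
have Sd : S (vX xi - u).
  apply: (lspan_min sP _ above) => _ [m /andP[jm njm] [x /XP[x1 cx1 <-] [y /YP[y1 cy1 <-] <-]]] b.
  rewrite -[smul _ _]/(vXY (x1, y1)) coord_vXY; last by rewrite /matched /= cx1 cy1.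
  by case: (b =P _) => [->|_]; rewrite ?eqxx // /P /= cx1 jm njm orbT.
have Sx : S (vX xi) by rewrite -(subrK u (vX xi)); exact: (submoduleD sP Sd Su).
have /Sx : acoord (vX xi) (xi, eY (cX xi)) != 0.
  by rewrite -vXY_eY coord_vXY ?matched_eY // eqxx oner_eq0.
rewrite /P /= => /orP[/eqP xiE|/andP[jc njc]].
  by rewrite {1}xiE ceX.
by split=> // jE; rewrite -jE eqxx in njc.
Qed.

Lemma weightY eta j : smul (vY eta) (e j) = vY eta -> leI j (cY eta) /\ (j = cY eta -> eta = eY j).
Proof.
move=> ey; have [Xj _] := hd_init hA j; have [rf _ _] := hd_poset hA.
have [u Xu] := hd_left hA (a := vY eta) Xj Logic.I.
rewrite ey => above.
pose P (b : PX * PY) := (b.2 == eY j) || (leI j (cY b.2) && (j != cY b.2)).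
have sP := coord_sub_submodule P; set S := mkset _ in sP.
have Su : S u.
  apply: (lspan_min sP _ Xu) => x /XP[xi cxi <-] b; rewrite -vXY_eY coord_vXY ?matched_eY //.
  by case: (b =P _) => [->|_]; rewrite ?eqxx // /P /= cxi eqxx.
have Sd : S (vY eta - u).
  apply: (lspan_min sP _ above) => _ [m /andP[jm njm] [x /XP[x1 cx1 <-] [y /YP[y1 cy1 <-] <-]]] b.
  rewrite -[smul _ _]/(vXY (x1, y1)) coord_vXY; last by rewrite /matched /= cx1 cy1.
  by case: (b =P _) => [->|_]; rewrite ?eqxx // /P /= cy1 jm njm orbT.
have Sx : S (vY eta) by rewrite -(subrK u (vY eta)); exact: (submoduleD sP Sd Su).
have /Sx : acoord (vY eta) (eX (cY eta), eta) != 0.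
  by rewrite -vXY_eX coord_vXY ?matched_eX // eqxx oner_eq0.
rewrite /P /= => /orP[/eqP xiE|/andP[jc njc]].
  by rewrite {1}xiE ceY.
by split=> // jE; rewrite -jE eqxx in njc.
Qed.

End Coordinates.

(** * Shortest coset representatives *)

Section Shortest.
Variable d : nat.
Implicit Types s : 'S_d.

Definition inversions s : {pred 'I_d * 'I_d} :=
  [pred p : 'I_d * 'I_d | (p.1 < p.2)%N && (s p.2 < s p.1)%N].

(** Exchanging the values maps the inversions that remain injectively to old inversions
    other than the pair itself. *)
Lemma perm_length_swap s (i j : 'I_d) : (i < j)%N -> (s j < s i)%N ->
  (perm_length (tperm i j * s)%g < perm_length s)%N.
Proof.
move=> ij sji; set ta := tperm i j.
pose f (p : 'I_d * 'I_d) := if (ta p.1 < ta p.2)%N then (ta p.1, ta p.2) else p.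
have fK : {in [pred p : 'I_d * 'I_d | (p.1 < p.2)%N], cancel f f}.
  move=> [p q]; rewrite inE /f /= => pq; case h: (ta p < ta q)%N => /=; last by rewrite h.
  by rewrite !tpermK pq.
have f_inj : {in inversions (ta * s)%g &, injective f}.
  move=> p q /andP[p12 _] /andP[q12 _] e.
  by rewrite -(fK p) ?inE // e fK ?inE.
rewrite -[perm_length (ta * s)%g](card_in_imset f_inj); apply: proper_card; apply/properP; split.
  apply/fintype.subsetP => _ /imsetP[[p q] + ->]; rewrite !inE /= !permM => /andP[pq].
  rewrite /f /=; case: ifP => [h //= ->|/negbT]; first by rewrite h.
  move: pq; rewrite -leqNgt /ta; case: (tpermP i j p) => [->|->|pi pj];
    case: (tpermP i j q) => [->|->|qi qj] pq h; rewrite ?pq //=.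
  - by rewrite !ltnn.
  - by move=> sq; apply: ltn_trans sq sji.
  - by move: pq; rewrite ltnNge ltnW.
  - by rewrite !ltnn.
  - by move: h; rewrite leqNgt (ltn_trans ij pq).
  - by move: h; rewrite leqNgt (ltn_trans pq ij).
  - by move=> sp; apply: ltn_trans sji sp.
exists (i, j); first by rewrite !inE /= ij.
apply/imsetP => -[[p q]]; rewrite !inE /= !permM => /andP[pq spq] e.
have := congr1 f e; rewrite fK ?inE // /f /= /ta tpermL tpermR ltnNge ltnW //= => -[ei ej].
by move: spq; rewrite -ei -ej tpermL tpermR ltnNge ltnW.
Qed.

End Shortest.

Section XiOrbit.
Variables (k : idomainType) (A : superalg k) (n d : nat).
Variables (W : superalg k) (t : {ffun 'I_d -> matA A n} -> W).
Variables (a : d.-tuple A) (r s : d.-tuple 'I_n).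
Variables (L : finType) (par : L -> bool) (U : L -> matA A n) (g0 : {ffun 'I_d -> L}).
Hypothesis labels : forall i j, (g0 i == g0 j)
  = ((tnth a i, tnth r i, tnth s i) == (tnth a j, tnth r j, tnth s j)).
Hypothesis UE : forall i, U (g0 i) = xi1 (tnth a i) (tnth r i) (tnth s i).
Hypothesis parE : forall i, par (g0 i) = `[< oddE (tnth a i) >].
Hypothesis good0 : goodw par g0.

Lemma stabE u : (u \in stab a r s) = (wperm g0 u == g0).
Proof.
rewrite inE; apply/forallP/eqP => [h|e i].
  by apply/ffunP => i; rewrite ffunE; apply/eqP; rewrite labels.
by rewrite -labels; have /ffunP/(_ i) := e; rewrite ffunE => ->.
Qed.

(** Otherwise exchanging two equal letters would shorten [u]. *)
Lemma shortest_incr u : u \in shortest_reps a r s ->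
  forall i j : 'I_d, (i < j)%N -> g0 (u i) = g0 (u j) -> (u i < u j)%N.
Proof.
move=> /forallP sh i j ij gij; rewrite ltnNge leq_eqVlt; apply/negP => /orP[/eqP/val_inj/perm_inj e|uji].
  by rewrite e ltnn in ij.
have tE : (tperm i j * u)%g = (u * tperm (u i) (u j))%g.
  by apply/permP => m; rewrite !permM; case: (tpermP i j m) => [->|->|mi mj];
     rewrite ?tpermL ?tpermR // tpermD //; apply/eqP => /perm_inj; [move/esym/mi|move/esym/mj].
have := sh (tperm (u i) (u j)); rewrite stabE.
have -> : wperm g0 (tperm (u i) (u j)) == g0.
  by apply/eqP/ffunP => m; rewrite ffunE; case: tpermP => [->|->|].
by move=> /=; rewrite -tE leqNgt perm_length_swap.
Qed.

Lemma shortest_inj : {in shortest_reps a r s &, injective (wperm g0)}.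
Proof.
suff wlg u v : u \in shortest_reps a r s -> v \in shortest_reps a r s ->
    wperm g0 u = wperm g0 v -> forall i : 'I_d, (forall j : 'I_d, (j < i)%N -> u j = v j) -> ~~ (u i < v i)%N.
  move=> u v us vs e; apply/permP => i.
  elim/ltn_ind: {i}(i : nat) {-2}i (leqnn i) => m IH i im.
  have before (j : 'I_d) : (j < i)%N -> u j = v j.
    by move=> ji; apply: (IH j) => //; apply: leq_trans ji im.
  apply: val_inj; apply/eqP; rewrite eqn_leq leqNgt (wlg v u) // => [|j /before //].
  by rewrite leqNgt (wlg u v).
move=> us vs e i before; apply/negP => uvi.
have gg m : g0 (u m) = g0 (v m) by have /ffunP/(_ m) := e; rewrite !ffunE.
pose j := (v^-1)%g (u i).
have vj : v j = u i by rewrite permKV.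
have [ji|ij|ij] := ltngtP j i.
- by move: vj; rewrite -before // => /perm_inj ji'; rewrite ji' ltnn in ji.
- have := shortest_incr vs ij; rewrite -gg vj => /(_ erefl).
  by rewrite ltnNge ltnW.
- by rewrite -vj (val_inj ij) ltnn in uvi.
Qed.

(** A coset has a single shortest representative, which keeps the order of equal letters,
    so the sum has one term for each word of the orbit. *)
Lemma xi_ev : xi t a r s = ev t U (orb k par g0).
Proof.
have sgnE u : (-1) ^+ sgn_count u a = sgn k par g0 u.
  rewrite -signr_odd; congr (_ ^+ nat_of_bool _).
  rewrite /sgn_count -sum1_card (big_morph odd oddD (erefl _)) /sperm /pair_parity.
  rewrite [RHS]big_mkcond [LHS]big_mkcond /=; apply: eq_bigr => -[i j] _.
  by rewrite inE /= !parE; case: (i < j)%N => //=; case: ifP.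
have termE u : tensor_act t a r s u = orb k par g0 (wperm g0 u) *: t [ffun i => U (wperm g0 u i)].
  rewrite /tensor_act sgnE orb_perm //; congr (_ *: t _).
  by apply/ffunP => i; rewrite !ffunE UE.
pose f g := orb k par g0 g *: t [ffun i => U (g i)].
rewrite /xi (eq_bigr (fun u => f (wperm g0 u))); last by move=> u _; apply: termE.
rewrite -(big_imset f shortest_inj) /= /ev [RHS](bigID (fun g => g \in [set wperm g0 u | u in shortest_reps a r s]%SET)) /=.
rewrite [X in _ = _ + X]big1 ?addr0 // => g.
move=> ng; have [->|/orb_neq0/samewP[u gE]] := eqVneq (orb k par g0 g) 0.
  by rewrite scale0r.
case/negP: ng.
case: (@arg_minnP _ u (fun v => wperm g0 v == g) (@perm_length d)) => [|v /eqP vg vmin].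
  by rewrite gE.
apply/imsetP; exists v => //; apply/forallP => w; apply/implyP; rewrite stabE => /eqP w0.
by apply: vmin; rewrite -wpermM w0 vg.
Qed.

End XiOrbit.

(** * Products of row tableaux in the tensor power *)

Section MatrixUnits.
Variables (k : comNzRingType) (A : superalg k) (n : nat).
Implicit Types (a b : A) (r s : 'I_n).

Lemma mul_xi1 a b r s r' s' :
  smul (xi1 a r s : matA A n) (xi1 b r' s')
  = if s == r' then xi1 (smul a b) r s' else 0.
Proof.
apply/ffunP => -[i j]; rewrite [LHS]ffunE /=.
rewrite (bigD1 s) //= big1 ?addr0 => [|q qs]; last first.
  by rewrite [xi1 a _ _ _]ffunE xpair_eqE (negbTE qs) andbF smul0l.
rewrite !ffunE !xpair_eqE eqxx andbT.
have [_|sr] := eqVneq s r'; last by rewrite !ffunE /= smul0r.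
rewrite !ffunE !xpair_eqE; case: (i == r) => /=; last by rewrite smul0l.
by case: (j == s') => //; rewrite smul0r.
Qed.

Lemma xi1_0 r s : xi1 (0 : A) r s = 0.
Proof. by apply/ffunP => p; rewrite !ffunE if_same. Qed.

Lemma xi1_inj r s : injective (fun a => xi1 a r s).
Proof. by move=> a b /ffunP/(_ (r, s)); rewrite !ffunE eqxx. Qed.

Lemma gr_xi1 g a r s : gr g a -> gr g (xi1 a r s : matA A n).
Proof. by move=> ga p; rewrite ffunE; case: ifP => // _; apply: gr0. Qed.

End MatrixUnits.

Section Relabel.
Variables (k : idomainType) (M W : superalg k) (d : nat) (t : {ffun 'I_d -> M} -> W).
Hypothesis hW : tensor_power t.
Notation word L := {ffun 'I_d -> L}.

Lemma ev_relabel (L L' : finType) (par : pred L) (par' : pred L') (f : L -> L')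
    (U : L -> M) (U' : L' -> M) (g0 : word L) :
    injective f -> (forall x, par' (f x) = par x) -> goodw par g0 ->
    (forall i, U (g0 i) = U' (f (g0 i))) ->
  ev t U (orb k par g0) = ev t U' (orb k par' [ffun i => f (g0 i)]).
Proof.
move=> fi pf gg UU; pose fw (g : word L) : word L' := [ffun i => f (g i)].
have fw_inj : injective fw.
  by move=> g h /ffunP e; apply/ffunP => i; apply: fi; have := e i; rewrite !ffunE.
have fwP g s : fw (wperm g s) = wperm (fw g) s by apply/ffunP => i; rewrite !ffunE.
have gf : goodw par' (fw g0).
  by move=> i j; rewrite !ffunE pf => /fi; apply: gg.
have oE g : orb k par g0 g = orb k par' (fw g0) (fw g).
  have [/samewP[s ->]|ng] := boolP (samew g0 g).
    rewrite fwP !orb_perm //; congr (_ ^+ nat_of_bool _).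
    by apply: eq_sperm => i; rewrite /= ffunE pf.
  rewrite !orb_out //; apply: contra ng => /samewP[s].
  by rewrite -fwP => /fw_inj ->; apply: samew_perm.
rewrite /ev -/(fw g0) [RHS](bigID (fun h => h \in [set fw g | g : word L]%SET)) /=.
rewrite [X in _ = _ + X]big1 ?addr0 => [|h nh]; last first.
  rewrite orb_out ?scale0r //; apply: contra nh => /samewP[s ->].
  by rewrite -fwP; apply/imsetP; exists (wperm g0 s).
rewrite big_imset /=; last by move=> g h _ _; apply: fw_inj.
apply: eq_bigr => g _; rewrite oE.
have [->|] := eqVneq (orb k par' (fw g0) (fw g)) 0; first by rewrite !scale0r.
rewrite -oE => /orb_neq0/samewP[s ->]; congr (_ *: t _).
by apply/ffunP => i; rewrite !ffunE UU.
Qed.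

Variables (R : finType) (E : R -> M).
Hypothesis E_gr : forall r, gr 0 (E r).
Hypothesis E_orth : forall r r', smul (E r) (E r') = if r == r' then E r else 0.

(** The idempotent of the Schur algebra attached to the content of [v]. *)
Definition idem (v : word R) : W := ev t E (orb k (fun=> false) v).

Lemma idem_orb (v w : word R) : orb k (fun=> false) v w = (samew v w)%:R.
Proof.
have [/samewP[s ->]|nw] := boolP (samew v w); last by rewrite orb_out.
by rewrite orb_perm // /sgn sperm_fix.
Qed.

Section Weights.
Variables (L : finType) (par : pred L) (U : L -> M) (dL : L -> deg) (g0 : word L).
Hypothesis U_gr : forall l, gr (dL l) (U l).

Definition rweight (v : word R) : Prop :=
  exists2 v' : word R, samew v v' & forall i, smul (U (g0 i)) (E (v' i)) = U (g0 i).

Definition lweight (v : word R) : Prop :=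
  exists2 v' : word R, samew v v' & forall i, smul (E (v' i)) (U (g0 i)) = U (g0 i).

(** At most one rearrangement of [v] acts on a given word as the identity, since the
    [E r] are orthogonal; all the others kill it. *)
Lemma mul_idem v : (forall i r, smul (U (g0 i)) (E r) = U (g0 i) \/ smul (U (g0 i)) (E r) = 0) ->
  smul (ev t U (orb k par g0)) (idem v)
  = if `[< rweight v >] then ev t U (orb k par g0) else 0.
Proof.
move=> h01; rewrite (ev_mul hW _ _ U_gr E_gr).
rewrite /ev big_wzip.
have -> : (if `[< rweight v >] then \sum_g orb k par g0 g *: t [ffun i => U (g i)] else 0)
   = \sum_g (`[< rweight v >])%:R *: (orb k par g0 g *: t [ffun i => U (g i)]).
  case: asboolP => _; first by apply: eq_bigr => g _; rewrite scale1r.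
  by rewrite big1 // => g _; rewrite scale0r.
apply: eq_bigr => g _.
have [o0|/orb_neq0/samewP[s gE]] := eqVneq (orb k par g0 g) 0.
  rewrite o0 scale0r scaler0 big1 // => w _.
  by rewrite wfst_zip o0 !mul0r scale0r.
have [[i Ui]|nz] := pselect (exists i, U (g0 i) = 0).
  have gz : exists j, U (g j) = 0 by exists (s^-1%g i); rewrite gE ffunE permKV.
  have [j Uj] := gz; rewrite (@multilinear0 _ _ _ _ _ (tp_multilinear hW) [ffun i => U (g i)] j) ?ffunE //.
  rewrite !scaler0 big1 // => w _.
  rewrite (@multilinear0 _ _ _ _ _ (tp_multilinear hW) _ j) ?scaler0 //.
  by rewrite !ffunE /= Uj smul0l.
have signE w : (-1) ^+ theta (fun i => pdeg (dL (wzip g w i).1)) (fun i => pdeg 0) = 1 :> k.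
  by rewrite (_ : theta _ _ = false) //; apply: pair_parity0 => i j _; rewrite andbF.
have gU i : U (g i) != 0.
  by apply/eqP => Ui; apply: nz; exists (s i); rewrite gE ffunE in Ui.
have g01 i r : smul (U (g i)) (E r) = U (g i) \/ smul (U (g i)) (E r) = 0.
  by rewrite gE ffunE.
have term w : (orb k par g0 (wfst (wzip g w)) * orb k (fun=> false) v (wsnd (wzip g w)) *
    (-1) ^+ theta (fun i => pdeg (dL (wzip g w i).1)) (fun i => pdeg 0)) *:
     t [ffun i => smul (U (wzip g w i).1) (E (wzip g w i).2)]
   = (samew v w && [forall i, smul (U (g i)) (E (w i)) == U (g i)])%:R *:
     (orb k par g0 g *: t [ffun i => U (g i)]).
  rewrite wfst_zip wsnd_zip signE mulr1 idem_orb scalerA mulrC.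
  case: samew => /=; last by rewrite !mul0r !scale0r.
  case: forallP => [all1|nall].
    by congr (_ *: t _); apply/ffunP => i; rewrite !ffunE /= (eqP (all1 i)).
  rewrite mul0r scale0r mul1r.
  have [i ni] : exists i, smul (U (g i)) (E (w i)) != U (g i).
    by apply: contrapT => /forallNP na; apply: nall => i; apply/negPn/negP/na.
  rewrite (@multilinear0 _ _ _ _ _ (tp_multilinear hW) _ i) ?scaler0 // !ffunE /=.
  by case: (g01 i (w i)) => // e; rewrite e eqxx in ni.
rewrite (eq_bigr _ (fun w _ => term w)).
case: asboolP => [[v' vv' v'P]|nw].
  rewrite (bigD1 (wperm v' s)) //= big1 ?addr0 => [|w nw].
    rewrite (samew_trans vv' (samew_perm v' s)) /=.
    have -> : [forall i, smul (U (g i)) (E (wperm v' s i)) == U (g i)] => //.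
    by apply/forallP => i; rewrite gE !ffunE v'P.
  case: andP; last by rewrite scale0r.
  case=> _ /forallP wP; case/eqP: nw; apply/ffunP => i.
  have /eqP e1 := wP i; have e2 := v'P (s i).
  have [//|nwv] := eqVneq (w i) (wperm v' s i).
  have : U (g i) = 0.
    have gi : g i = g0 (s i) by rewrite gE ffunE.
    rewrite -gi in e2.
    have : smul (smul (U (g i)) (E (w i))) (E (v' (s i))) = U (g i) by rewrite e1 e2.
    rewrite -smulA E_orth; have /negbTE -> : w i != v' (s i) by rewrite ffunE in nwv.
    by rewrite smul0r => <-.
  by move/eqP; rewrite (negbTE (gU i)).
rewrite scale0r big1 // => w _; case: andP; last by rewrite scale0r.
case=> vw /forallP wP; case: nw; exists (wperm w s^-1%g).
  exact: samew_trans vw (samew_perm _ _).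
move=> i; have /eqP := wP (s^-1%g i); by rewrite gE !ffunE permKV.
Qed.

Lemma idem_mul v : (forall i r, smul (E r) (U (g0 i)) = U (g0 i) \/ smul (E r) (U (g0 i)) = 0) ->
  smul (idem v) (ev t U (orb k par g0))
  = if `[< lweight v >] then ev t U (orb k par g0) else 0.
Proof.
move=> h01; rewrite (ev_mul hW _ _ E_gr U_gr).
rewrite /ev big_wzip exchange_big /=.
have -> : (if `[< lweight v >] then \sum_g orb k par g0 g *: t [ffun i => U (g i)] else 0)
   = \sum_g (`[< lweight v >])%:R *: (orb k par g0 g *: t [ffun i => U (g i)]).
  case: asboolP => _; first by apply: eq_bigr => g _; rewrite scale1r.
  by rewrite big1 // => g _; rewrite scale0r.
apply: eq_bigr => g _.
have [o0|/orb_neq0/samewP[s gE]] := eqVneq (orb k par g0 g) 0.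
  rewrite o0 scale0r scaler0 big1 // => w _.
  by rewrite wsnd_zip o0 mulr0 mul0r scale0r.
have [[i Ui]|nz] := pselect (exists i, U (g0 i) = 0).
  have gz : exists j, U (g j) = 0 by exists (s^-1%g i); rewrite gE ffunE permKV.
  have [j Uj] := gz; rewrite (@multilinear0 _ _ _ _ _ (tp_multilinear hW) [ffun i => U (g i)] j) ?ffunE //.
  rewrite !scaler0 big1 // => w _.
  rewrite (@multilinear0 _ _ _ _ _ (tp_multilinear hW) _ j) ?scaler0 //.
  by rewrite !ffunE /= Uj smul0r.
have signE w : (-1) ^+ theta (fun i => pdeg 0) (fun i => pdeg (dL (wzip w g i).2)) = 1 :> k.
  by rewrite (_ : theta _ _ = false) //; apply: pair_parity0 => i j _.
have gU i : U (g i) != 0.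
  by apply/eqP => Ui; apply: nz; exists (s i); rewrite gE ffunE in Ui.
have g01 i r : smul (E r) (U (g i)) = U (g i) \/ smul (E r) (U (g i)) = 0.
  by rewrite gE ffunE.
have term w : (orb k (fun=> false) v (wfst (wzip w g)) * orb k par g0 (wsnd (wzip w g)) *
    (-1) ^+ theta (fun i => pdeg 0) (fun i => pdeg (dL (wzip w g i).2))) *:
     t [ffun i => smul (E (wzip w g i).1) (U (wzip w g i).2)]
   = (samew v w && [forall i, smul (E (w i)) (U (g i)) == U (g i)])%:R *:
     (orb k par g0 g *: t [ffun i => U (g i)]).
  rewrite wfst_zip wsnd_zip signE mulr1 idem_orb scalerA.
  case: samew => /=; last by rewrite !mul0r !scale0r.
  case: forallP => [all1|nall].
    by congr (_ *: t _); apply/ffunP => i; rewrite !ffunE /= (eqP (all1 i)).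
  rewrite mul0r scale0r mul1r.
  have [i ni] : exists i, smul (E (w i)) (U (g i)) != U (g i).
    by apply: contrapT => /forallNP na; apply: nall => i; apply/negPn/negP/na.
  rewrite (@multilinear0 _ _ _ _ _ (tp_multilinear hW) _ i) ?scaler0 // !ffunE /=.
  by case: (g01 i (w i)) => // e; rewrite e eqxx in ni.
rewrite (eq_bigr _ (fun w _ => term w)).
case: asboolP => [[v' vv' v'P]|nw].
  rewrite (bigD1 (wperm v' s)) //= big1 ?addr0 => [|w nw].
    rewrite (samew_trans vv' (samew_perm v' s)) /=.
    have -> : [forall i, smul (E (wperm v' s i)) (U (g i)) == U (g i)] => //.
    by apply/forallP => i; rewrite gE !ffunE v'P.
  case: andP; last by rewrite scale0r.
  case=> _ /forallP wP; case/eqP: nw; apply/ffunP => i.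
  have /eqP e1 := wP i; have e2 := v'P (s i).
  have [//|nwv] := eqVneq (w i) (wperm v' s i).
  have : U (g i) = 0.
    have gi : g i = g0 (s i) by rewrite gE ffunE.
    rewrite -gi in e2.
    have : smul (E (v' (s i))) (smul (E (w i)) (U (g i))) = U (g i) by rewrite e1 e2.
    rewrite smulA E_orth eq_sym; have /negbTE -> : w i != v' (s i) by rewrite ffunE in nwv.
    by rewrite smul0l => <-.
  by move/eqP; rewrite (negbTE (gU i)).
rewrite scale0r big1 // => w _; case: andP; last by rewrite scale0r.
case=> vw /forallP wP; case: nw; exists (wperm w s^-1%g).
  exact: samew_trans vw (samew_perm _ _).
move=> i; have /eqP := wP (s^-1%g i); by rewrite gE !ffunE permKV.
Qed.

End Weights.
End Relabel.

Section TensorLevel.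
Variables (k : idomainType) (n d : nat).
Hypothesis k_char0 : [pchar k] =i pred0.
Hypotheses (n_gt0 : (0 < n)%N) (dn : (d <= n)%N).
Variables (A : superalg k) (a : set A) (I : finType) (leI : rel I).
Variables (X Y : I -> set A) (e : I -> A).
Hypothesis ha : conforming leI X Y e a.
Variables (i0 : I) (D : presentation leI X Y e).
Local Notation hA := (based_hd D).
Variables (rX : 'I_n * PX D -> nat) (rY : 'I_n * PY D -> nat).
Hypotheses (rX_inj : injective rX) (rY_inj : injective rY).
Variables (W : superalg k) (t : {ffun 'I_d -> matA A n} -> W).
Hypothesis hW : tensor_power t.
Notation R := (I * 'I_n)%type.
Notation word L := {ffun 'I_d -> L}.

Definition alphX : alphabet I :=
  @Alphabet I ('I_n * PX D)%type (fun p => pdeg (dX p.2)) (fun p => cX p.2) rX rX_inj.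
Definition alphY : alphabet I :=
  @Alphabet I ('I_n * PY D)%type (fun q => pdeg (dY q.2)) (fun q => cY q.2) rY rY_inj.

(** The factors of a row tableau: a letter [r^x] in the row [t] of its component is
    [xE_(r,t)], and symmetrically for [Y]. *)
Definition UX (x : alphX * R) : matA A n := xi1 (vX x.1.2) x.1.1 x.2.2.
Definition UY (y : alphY * R) : matA A n := xi1 (vY y.1.2) y.2.2 y.1.1.

(** The basis [xyE_(r,s)] of the matrix superalgebra is named by its two halves, the
    letters [r^x] and [s^y]. Names with [x] and [y] in different components stand for 0. *)
Definition bas : finType := (alphX * alphY)%type.
Definition vB (b : bas) : matA A n := xi1 (vXY (b.1.2, b.2.2)) b.1.1 b.2.1.
Definition dB (b : bas) : deg := dXY (b.1.2, b.2.2).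
Definition cty (b : bas) : bool := pdeg (dX b.1.2) && pdeg (dY b.2.2).
Definition pB (b : bas) : bool := pdeg (dB b).

Lemma pBE b : pB b = pdeg (dX b.1.2) (+) pdeg (dY b.2.2).
Proof. exact: pdegD. Qed.

Lemma gr_vB b : gr (dB b) (vB b).
Proof. exact/gr_xi1/gr_vXY. Qed.

Lemma gr_UX x : gr (dX x.1.2) (UX x).
Proof. exact/gr_xi1/grX. Qed.

Lemma gr_UY y : gr (dY y.1.2) (UY y).
Proof. exact/gr_xi1/grY. Qed.

Lemma cty_even b : cty b -> ~~ pdeg (dB b).
Proof. by rewrite -/(pB b) pBE => /andP[-> ->]. Qed.

Definition evenpair (b : PX D * PY D) := ~~ pdeg (dX b.1) && ~~ pdeg (dY b.2).

Lemma atyE b : aty dB cty b = evenpair (b.1.2, b.2.2).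
Proof.
rewrite /aty -/(pB b) pBE /cty /evenpair /=.
by case: pdeg; case: pdeg.
Qed.

(** Products of even basis elements stay in the conforming subalgebra, whose
    elements have even coordinates only. *)
Lemma coord_evenpair b b' c : evenpair b -> evenpair b' ->
  acoord (smul (vXY b) (vXY b')) c != 0 -> evenpair c.
Proof.
have [_ hd] := ha; have [[asub amul _] aspan] := (hd_subalg hd, hd_span hd).
have inX (xi : PX D) : ~~ pdeg (dX xi) -> (X (cX xi) `&` evenE)%classic (vX xi).
  by move=> ev; split; [exact: (vXX xi)|exact: (even_pdeg (grX xi) (vX_neq0 xi)).2 ev].
have inY (eta : PY D) : ~~ pdeg (dY eta) -> (Y (cY eta) `&` evenE)%classic (vY eta).
  by move=> ev; split; [exact: (vYY eta)|exact: (even_pdeg (grY eta) (vY_neq0 eta)).2 ev].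
have va (z : PX D * PY D) : evenpair z -> a (vXY z).
  move=> /andP[e1 e2]; have [/eqP mz|nz] := boolP (matched z); last first.
    by rewrite unmatched0 //; apply: asub.1.
  rewrite -aspan; apply: lspan_in; exists (cX z.1) => //.
  by exists (vX z.1); [apply: inX|exists (vY z.2); [rewrite mz; apply: inY|]].
move=> eb eb'; have : a (smul (vXY b) (vXY b')) by apply: amul; apply: va.
rewrite -aspan => h; have sP := coord_sub_submodule (D := D) evenpair.
have := lspan_min sP _ h; apply=> {h}.
move=> _ [i _ [x [/(XP D)[xi cxi <-] ex] [y [/(YP D)[eta ceta <-] ey] <-]]] c'.
rewrite -[smul _ _]/(vXY (xi, eta)) coord_vXY; last by rewrite /matched /= cxi ceta.
case: (c' =P _) => [->|_]; last by rewrite eqxx.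
move=> _; apply/andP; split.
  exact: (even_pdeg (grX xi) (vX_neq0 xi)).1 ex.
exact: (even_pdeg (grY eta) (vY_neq0 eta)).1 ey.
Qed.

(** Structure constants of the matrix superalgebra. *)
Definition str (b c z : bas) : k :=
  if [&& b.2.1 == c.1.1, z.1.1 == b.1.1 & z.2.1 == c.2.1]
  then acoord (smul (vXY (b.1.2, b.2.2)) (vXY (c.1.2, c.2.2))) (z.1.2, z.2.2) else 0.

Lemma strE b c : smul (vB b) (vB c) = \sum_z str b c z *: vB z.
Proof.
rewrite /vB mul_xi1; case: eqP => [bc|nbc]; last first.
  by rewrite big1 // => z _; rewrite /str; case: eqP => //= _; rewrite scale0r.
set x := smul _ _; apply/ffunP => p; rewrite sum_ffunE ffunE.
under eq_bigr => z _ do rewrite !ffunE.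
transitivity (\sum_(bb : PX D * PY D) acoord x bb *: (if p == (b.1.1, c.2.1) then vXY bb else 0)).
  case: eqP => _; first exact: coordE.
  by rewrite big1 // => bb _; rewrite scaler0.
pose f (z : bas) : PX D * PY D := (z.1.2, z.2.2).
rewrite [RHS](bigID (fun z : bas => (z.1.1 == b.1.1) && (z.2.1 == c.2.1))) /=.
rewrite [X in _ = _ + X]big1 ?addr0 => [|z /negbTE nz]; last by rewrite /str bc eqxx /= nz scale0r.
rewrite (reindex_onto f (fun bb => ((b.1.1, bb.1), (c.2.1, bb.2)))) /=; last by case.
apply: eq_big => [[[r xi] [s eta]]|[[r xi] [s eta]]] /=.
  by rewrite /f /= !xpair_eqE !eqxx !andbT [b.1.1 == r]eq_sym [c.2.1 == s]eq_sym.
rewrite /f /= !xpair_eqE !eqxx !andbT => /andP[/eqP er /eqP es].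
by rewrite /str /= bc er es !eqxx.
Qed.

Lemma str_deg b c z : str b c z != 0 -> dB z = dB b + dB c.
Proof.
rewrite /str; case: ifP => _; last by rewrite eqxx.
apply: coord_deg; apply: gr_smul; exact: gr_vXY.
Qed.

Lemma str_aty b c z : aty dB cty b -> aty dB cty c -> str b c z != 0 -> aty dB cty z.
Proof.
rewrite !atyE /str => eb ec; case: ifP => _; last by rewrite eqxx.
exact: coord_evenpair.
Qed.

(** The algebra [TA], see [TA_TT]. *)
Definition TT : set W := divspan t vB dB cty.

Lemma TT_mul w w' : TT w -> TT w' -> TT (smul w w').
Proof.
have r0 : 'I_n by exists 0%N.
apply: (divspan_mul k_char0 hW ((r0, eX D i0), (r0, eY D i0)) gr_vB cty_even strE str_deg str_aty).
Qed.

Definition cmatched (b : bas) : bool := matched (b.1.2, b.2.2).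

Lemma vB_unmatched b : ~~ cmatched b -> vB b = 0.
Proof. by move=> nb; rewrite /vB unmatched0 // xi1_0. Qed.

Lemma ev_vB_inj F : ev t vB F = 0 -> forall h : word bas, (forall i, cmatched (h i)) -> F h = 0.
Proof.
apply: (ev_inj hW (kap := fun l (M : matA A n) => acoord (M (l.1.1, l.2.1)) (l.1.2, l.2.2))).
  by move=> l _ c x y; rewrite !ffunE coord_lin.
move=> l l' ml; rewrite /vB ffunE.
have [ml'|nl'] := boolP (cmatched l'); last first.
  rewrite unmatched0 // if_same acoord0.
  by case: (l =P l') => // ll; rewrite -ll ml in nl'.
case: l l' ml ml' => [[r xi] [s eta]] [[r' xi'] [s' eta']] ml ml' /=.
case: ifP => [/eqP[-> ->]|nrs].
  rewrite coord_vXY // ; congr (_%:R); congr (nat_of_bool _).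
  by rewrite !xpair_eqE /= !eqxx.
rewrite acoord0 /= !xpair_eqE /=; case: eqP => [rr|] //=; case: eqP => //= xx; case: eqP => //= ss.
by rewrite rr ss xpair_eqE !eqxx in nrs.
Qed.

(** The sign of multiplying the tensor of the left halves by that of the right halves. *)
Definition thB (g : word bas) : k :=
  (-1) ^+ theta (fun i => pdeg (dX (g i).1.2)) (fun i => pdeg (dY (g i).2.2)).

Lemma mul_UXY x y : smul (UX x) (UY y)
  = if x.2.2 == y.2.2 then xi1 (vXY (x.1.2, y.1.2)) x.1.1 y.1.1 else 0 :> matA A n.
Proof. exact: mul_xi1. Qed.

(** In the middle, rows have to agree, since the product of [xE_(r,t)] and [yE_(t',s)]
    is 0 unless [t = t'] and [x], [y] belong to the same component. *)
Lemma mul_XY F G :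
    (forall p u, F (wzip p u) != 0 -> forall i, @co I alphX (p i) = (u i).1) ->
    (forall q u, G (wzip q u) != 0 -> forall i, @co I alphY (q i) = (u i).1) ->
  smul (ev t UX F) (ev t UY G)
  = ev t vB (fun g => thB g * @kerG k d n I alphX alphY F G (wfst g, wsnd g)).
Proof.
move=> sF sG; rewrite (ev_mul hW _ _ gr_UX gr_UY) /ev.
rewrite big_wzip [RHS]big_wzip big_wzip; apply: eq_bigr => p _.
transitivity (\sum_u \sum_q (thB (wzip p q) * (F (wzip p u) * G (wzip q u))) *:
    t [ffun i => vB (wzip p q i)]).
  apply: eq_bigr => u _; rewrite big_wzip; apply: eq_bigr => q _.
  have [F0|nF] := eqVneq (F (wzip p u)) 0.
    rewrite F0 mul0r mulr0 scale0r big1 // => u' _.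
    by rewrite wfst_zip F0 !mul0r scale0r.
  rewrite (bigD1 u) //= big1 ?addr0 => [|u' nu].
    rewrite wfst_zip wsnd_zip [thB _ * _]mulrC; congr (_ * _ *: t _).
      by congr (_ ^+ nat_of_bool _); apply: eq_theta => i; rewrite !ffunE.
    apply/ffunP => i; rewrite [RHS]ffunE wzipE.
    transitivity (smul (UX (p i, u i)) (UY (q i, u i))); first by rewrite ffunE !wzipE.
    by rewrite mul_UXY /= eqxx.
  rewrite wfst_zip wsnd_zip.
  have [G0|nG] := eqVneq (G (wzip q u')) 0; first by rewrite G0 mulr0 mul0r scale0r.
  have [i ni] : exists i, u i != u' i.
    apply: contrapT => /forallNP na; case/eqP: nu; apply/ffunP => i.
    by apply/eqP; rewrite eq_sym; apply/negPn/negP/na.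
  rewrite (@multilinear0 _ _ _ _ _ (tp_multilinear hW) _ i) ?scaler0 //.
  transitivity (smul (UX (p i, u i)) (UY (q i, u' i))); first by rewrite ffunE !wzipE.
  rewrite mul_UXY /=.
  case: eqP => // u2; rewrite unmatched0 ?xi1_0 //.
  rewrite /matched /=; have := sF _ _ nF i; have := sG _ _ nG i => /= -> ->.
  by apply: contra ni => /eqP u1; rewrite [u i]surjective_pairing [u' i]surjective_pairing u1 u2.
rewrite exchange_big /=; apply: eq_bigr => q _.
by rewrite -scaler_suml wfst_zip wsnd_zip ffunE mulr_sumr.
Qed.

Definition Erow (r : R) : matA A n := xi1 (e r.1) r.2 r.2.

Lemma e_neq0 i : e i != 0.
Proof. by rewrite -(veX D i) vX_neq0. Qed.

Lemma ee i : smul (e i) (e i) = e i.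
Proof. by have := vX_e (eX D i); rewrite ceX veX. Qed.

Lemma gr_e i : gr 0 (e i).
Proof.
have ge : gr (dX (eX D i)) (e i) by rewrite -(veX D i); apply: grX.
have : gr (dX (eX D i) + dX (eX D i)) (e i) by rewrite -[in gr _ _](ee i); apply: gr_smul.
move/(gr_unique (e_neq0 i) ge)/eqP; rewrite -{1}[dX _]addr0 => /eqP/addrI d0.
by rewrite d0.
Qed.

Lemma dX_e i : dX (eX D i) = 0.
Proof. by apply: (gr_unique (vX_neq0 (eX D i)) (grX _)); rewrite veX; apply: gr_e. Qed.

Lemma dY_e i : dY (eY D i) = 0.
Proof. by apply: (gr_unique (vY_neq0 (eY D i)) (grY _)); rewrite veY; apply: gr_e. Qed.

Lemma gr_Erow r : gr 0 (Erow r).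
Proof. exact/gr_xi1/gr_e. Qed.

Lemma Erow_orth r r' : smul (Erow r) (Erow r') = if r == r' then Erow r else 0 :> matA A n.
Proof.
rewrite /Erow mul_xi1; case: (r =P r') => [<-|nr]; first by rewrite eqxx ee.
case: eqP => // e2; rewrite (e_orth D) ?xi1_0 //; apply/eqP => e1; apply: nr.
by rewrite [r]surjective_pairing [r']surjective_pairing e1 e2.
Qed.

Definition Ew (v : word R) : W := idem t Erow v.
Definition Xw (p : word alphX) (u : word R) : W := ev t UX (orb k (@rpar n I alphX) (wzip p u)).
Definition Yw (q : word alphY) (u : word R) : W := ev t UY (orb k (@rpar n I alphY) (wzip q u)).

Lemma vX_ne (xi : PX D) i : i != cX xi -> smul (vX xi) (e i) = 0 :> A.
Proof.
by move=> ni; rewrite -(vX_e (D := D)) -smulA (e_orth D) ?smul0r // eq_sym.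
Qed.

Lemma ne_vY (eta : PY D) i : i != cY eta -> smul (e i) (vY eta) = 0 :> A.
Proof. by move=> ni; rewrite -(e_vY (D := D)) smulA (e_orth D) ?smul0l. Qed.

Lemma Xw_idem p u v : rowword p u -> smul (Xw p u) (Ew v)
  = if `[< rweight Erow UX (wzip p u) v >] then Xw p u else 0.
Proof.
move=> [cpu gpu]; rewrite /Xw /Ew; apply: (mul_idem hW gr_Erow Erow_orth _ gr_UX) => i r.
rewrite /UX /Erow mul_xi1; case: eqP => [<-|_]; last by right.
have [->|nr] := eqVneq r.1 (cX (wzip p u i).1.2); first by rewrite vX_e; left.
by rewrite vX_ne // xi1_0; right.
Qed.

Lemma Yw_idem q u v : rowword q u -> smul (Yw q u) (Ew v)
  = if `[< rweight Erow UY (wzip q u) v >] then Yw q u else 0.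
Proof.
move=> [cqu gqu]; rewrite /Yw /Ew; apply: (mul_idem hW gr_Erow Erow_orth _ gr_UY) => i r.
rewrite /UY /Erow mul_xi1; case: eqP => [<-|_]; last by right.
by case: (hd_yej hA r.1 (vYY (wzip q u i).1.2)) => ->; [left|right; rewrite xi1_0].
Qed.

Lemma idem_Xw p u v : rowword p u -> smul (Ew v) (Xw p u)
  = if `[< lweight Erow UX (wzip p u) v >] then Xw p u else 0.
Proof.
move=> [cpu gpu]; rewrite /Xw /Ew; apply: (idem_mul hW gr_Erow Erow_orth _ gr_UX) => i r.
rewrite /UX /Erow mul_xi1; case: eqP => [->|_]; last by right.
by case: (hd_ejx hA r.1 (vXX (wzip p u i).1.2)) => ->; [left|right; rewrite xi1_0].
Qed.

Lemma idem_Yw q u v : rowword q u -> smul (Ew v) (Yw q u)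
  = if `[< lweight Erow UY (wzip q u) v >] then Yw q u else 0.
Proof.
move=> [cqu gqu]; rewrite /Yw /Ew; apply: (idem_mul hW gr_Erow Erow_orth _ gr_UY) => i r.
rewrite /UY /Erow mul_xi1; case: eqP => [->|_]; last by right.
have [->|nr] := eqVneq r.1 (cY (wzip q u i).1.2); first by rewrite e_vY; left.
by rewrite ne_vY // xi1_0; right.
Qed.

Lemma Xw_E p u v : rowword p u -> samew u v -> smul (Xw p u) (Ew v) = Xw p u.
Proof.
move=> rp uv; rewrite Xw_idem //; case: asboolP => // nw; case: nw.
exists u => [|i]; first by rewrite samew_sym.
rewrite wzipE /UX /Erow mul_xi1 /= eqxx; have [/(_ i) /= <- _] := rp.
by rewrite vX_e.
Qed.

Lemma E_Yw q u v : rowword q u -> samew u v -> smul (Ew v) (Yw q u) = Yw q u.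
Proof.
move=> rq uv; rewrite idem_Yw //; case: asboolP => // nw; case: nw.
exists u => [|i]; first by rewrite samew_sym.
rewrite wzipE /UY /Erow mul_xi1 /= eqxx; have [/(_ i) /= <- _] := rq.
by rewrite e_vY.
Qed.

(** A word [v] of rows whose idempotents fix the factors of the row tableau from the
    left. *)
Definition wtX (p : word alphX) (v : word R) : Prop :=
  forall i, (v i).2 = (p i).1 /\ smul (e (v i).1) (vX (p i).2) = vX (p i).2.

Definition wtY (q : word alphY) (v : word R) : Prop :=
  forall i, (v i).2 = (q i).1 /\ smul (vY (q i).2) (e (v i).1) = vY (q i).2.

Lemma lweightX p u v : lweight Erow UX (wzip p u) v <-> exists2 v', samew v v' & wtX p v'.
Proof.
split=> -[v' vv' wv']; exists v' => // i; have := wv' i.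
  rewrite wzipE /UX /Erow mul_xi1 /=; case: eqP => [->|_ /eqP].
    by move/xi1_inj.
  rewrite eq_sym => /eqP; rewrite -(xi1_0 A (p i).1 (u i).2) => /xi1_inj/eqP.
  by rewrite (negbTE (vX_neq0 _)).
by move=> [v2 ev]; rewrite wzipE /UX /Erow mul_xi1 /= v2 eqxx ev.
Qed.

Lemma rweightY q u v : rweight Erow UY (wzip q u) v <-> exists2 v', samew v v' & wtY q v'.
Proof.
split=> -[v' vv' wv']; exists v' => // i; have := wv' i.
  rewrite wzipE /UY /Erow mul_xi1 /=; case: eqP => [e2|_ /eqP].
    by rewrite -e2 => /xi1_inj.
  rewrite eq_sym => /eqP; rewrite -(xi1_0 A (u i).2 (q i).1) => /xi1_inj/eqP.
  by rewrite (negbTE (vY_neq0 _)).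
by move=> [v2 ev]; rewrite wzipE /UY /Erow mul_xi1 /= v2 eqxx ev.
Qed.

Lemma gr_Xw p u : exists g, gr g (Xw p u).
Proof. by exists (\sum_i dX (wzip p u i).1.2); exact: (@ev_orb_gr _ _ _ _ _ hW _ _ _ (fun x : alphX * R => dX x.1.2) _ gr_UX). Qed.

Lemma gr_Yw q u : exists g, gr g (Yw q u).
Proof. by exists (\sum_i dY (wzip q u i).1.2); exact: (@ev_orb_gr _ _ _ _ _ hW _ _ _ (fun x : alphY * R => dY x.1.2) _ gr_UY). Qed.

Lemma TT_graded w : TT w -> lspan (TT `&` homogeneous)%classic w.
Proof.
apply: lspan_min; first exact: lspan_submodule.
move=> {}w [g [gg ->]]; apply: lspan_in; split; first by apply: lspan_in; exists g.
exists (\sum_i dB (g i)) => //; apply: gr_scale; exact: (@ev_orb_gr _ _ _ _ _ hW _ _ _ dB _ gr_vB).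
Qed.

Lemma mult_noncty (g : word bas) : (forall i, ~~ cty (g i)) -> mult cty g = 1%N.
Proof.
move=> nc; rewrite /mult big1 // => b cb.
rewrite (eq_card (B := pred0)) ?card0 // => i; rewrite !inE.
by apply/eqP => gi; rewrite -gi (negbTE (nc i)) in cb.
Qed.

(** The element [x] is itself a basis element, with right half [e_i]. *)
Lemma Xw_TT p u : rowword p u -> TT (Xw p u).
Proof.
move=> [cpu gpu]; pose f (x : alphX * R) : bas := (x.1, (x.2.2, eY D x.2.1)).
have fi : injective f.
  move=> [x1 [i1 r1]] [x2 [i2 r2]] [-> -> e1]; congr (_, (_, _)).
  by rewrite -(ceY D i1) e1 ceY.
have pf x : pB (f x) = rpar x by rewrite pBE /f /= dY_e addbF.
have UU i : UX (wzip p u i) = vB (f (wzip p u i)).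
  rewrite wzipE /UX /vB /f /=; have := cpu i => /= <-.
  by rewrite vXY_eY.
rewrite /Xw (ev_relabel t fi pf gpu UU); set g := [ffun i => _].
apply: lspan_in; exists g; split.
  by move=> i j; rewrite [g i]ffunE [g j]ffunE -/(pB _) pf => /fi; apply: gpu.
by rewrite mult_noncty ?scale1r // => i; rewrite [g i]ffunE /cty /f /= dY_e andbF.
Qed.

Lemma Yw_TT q u : rowword q u -> TT (Yw q u).
Proof.
move=> [cqu gqu]; pose f (x : alphY * R) : bas := ((x.2.2, eX D x.2.1), x.1).
have fi : injective f.
  move=> [x1 [i1 r1]] [x2 [i2 r2]] [-> e1 ->]; congr (_, (_, _)).
  by rewrite -(ceX D i1) e1 ceX.
have pf x : pB (f x) = rpar x by rewrite pBE /f /= dX_e.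
have UU i : UY (wzip q u i) = vB (f (wzip q u i)).
  rewrite wzipE /UY /vB /f /=; have := cqu i => /= <-.
  by rewrite vXY_eX.
rewrite /Yw (ev_relabel t fi pf gqu UU); set g := [ffun i => _].
apply: lspan_in; exists g; split.
  by move=> i j; rewrite [g i]ffunE [g j]ffunE -/(pB _) pf => /fi; apply: gqu.
by rewrite mult_noncty ?scale1r // => i; rewrite [g i]ffunE /cty /f /= dX_e.
Qed.

Lemma orb_co (Z : alphabet I) (z z' : word Z) (u u' : word R) : rowword z u ->
  orb k (@rpar n I Z) (wzip z u) (wzip z' u') != 0 -> forall i, co (z' i) = (u' i).1.
Proof. by move=> [cz _] /orb_neq0/samew_zipP[s -> ->] i; rewrite !ffunE. Qed.

Lemma mul_XYw p u q : rowword p u -> rowword q u -> smul (Xw p u) (Yw q u)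
  = ev t vB (fun g => thB g * @tabker k d n I alphX alphY p u q (wfst g, wsnd g)).
Proof.
by move=> rp rq; apply: mul_XY => z v; [apply: orb_co rp|apply: orb_co rq].
Qed.

Lemma thB_perm g s : thB (wperm g s) = thB g *
  ((-1) ^+ sperm s (fun i => pdeg (dX (g i).1.2)) * (-1) ^+ sperm s (fun i => pdeg (dY (g i).2.2))
   * sgn k pB g s).
Proof.
rewrite /thB /sgn -!signr_addb; congr (_ ^+ nat_of_bool _).
rewrite (@eq_theta _ _ ((fun i => pdeg (dX (g i).1.2)) \o s) _ ((fun i => pdeg (dY (g i).2.2)) \o s));
  try by move=> i; rewrite /= ffunE.
by rewrite theta_perm; congr (_ (+) (_ (+) _)); apply: eq_sperm => i; rewrite /= pBE.
Qed.

Lemma thB_sqr g : thB g * thB g = 1.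
Proof. by rewrite -expr2 sqrr_sign. Qed.

Lemma sgn_X (p : word alphX) (q : word alphY) (u : word R) s :
  sgn k (@rpar n I alphX) (wzip p u) s = (-1) ^+ sperm s (fun i => pdeg (dX (wzip p q i).1.2)).
Proof. by congr (_ ^+ nat_of_bool _); apply: eq_sperm => i; rewrite /= !wzipE. Qed.

Lemma sgn_Y (p : word alphX) (q : word alphY) (u : word R) s :
  sgn k (@rpar n I alphY) (wzip q u) s = (-1) ^+ sperm s (fun i => pdeg (dY (wzip p q i).2.2)).
Proof. by congr (_ ^+ nat_of_bool _); apply: eq_sperm => i; rewrite /= !wzipE. Qed.

Lemma tabker_supp (p p1 : word alphX) (u : word R) (q q1 : word alphY) :
    @tabker k d n I alphX alphY p u q (p1, q1) != 0 ->
  exists u1, samew (wzip p u) (wzip p1 u1) /\ samew (wzip q u) (wzip q1 u1).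
Proof.
rewrite ffunE => /sum_neq0[u1]; rewrite mulf_eq0 negb_or => /andP[/orb_neq0 ? /orb_neq0 ?].
by exists u1.
Qed.

(** Equal letters are put in the same row, unless one of their halves is odd, and all
    other letters in rows of their own; [d <= n] rows suffice. The terms of the product
    that coincide are counted by [card_refinement]. *)
Lemma factor_word (g : word bas) : goodw pB g -> (forall i, cmatched (g i)) ->
  exists p u q, [/\ @rowword d n I alphX p u, @rowword d n I alphY q u &
    exists c : k, (mult cty g)%:R *: ev t vB (orb k pB g) = c *: smul (Xw p u) (Yw q u)].
Proof.
move=> gg mg; have [p [q gE]] := wunzip g; rewrite gE in gg mg *.
have gi i : wzip p q i = (p i, q i) by rewrite wzipE.
pose odd_at i := pdeg (dX (p i).2) || pdeg (dY (q i).2).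
have odd_same i j : wzip p q i = wzip p q j -> odd_at j = odd_at i.
  by rewrite !wzipE /odd_at => -[-> ->].
(* [key i] is a place that names the row of place [i]. *)
pose key i := if odd_at i then i else odflt i [pick j | wzip p q j == wzip p q i].
have keyE i j : key i = key j -> wzip p q i = wzip p q j /\ (odd_at i -> i = j).
  have pickE m : wzip p q (odflt m [pick j | wzip p q j == wzip p q m]) = wzip p q m.
    by case: pickP => [j' /eqP|/(_ m)] //=; rewrite eqxx.
  have kE m : wzip p q (key m) = wzip p q m by rewrite /key; case: ifP.
  move=> kij; have gij : wzip p q i = wzip p q j by rewrite -kE kij kE.
  by split=> // oi; move: kij; rewrite /key (odd_same _ _ gij) oi.
have keyF i j : wzip p q i = wzip p q j -> ~~ odd_at i -> key i = key j.
  move=> gij ni; rewrite /key (negbTE ni).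
  rewrite (odd_same _ _ gij).
  rewrite (negbTE ni) (eq_pick (Q := fun m => wzip p q m == wzip p q j)); last by move=> m; rewrite gij.
  by case: pickP => [//|/(_ j)]; rewrite eqxx.
pose u : word R := [ffun i => (cX (p i).2, widen_ord dn (key i))].
have uE0 i : u i = (cX (p i).2, widen_ord dn (key i)) by rewrite ffunE.
have uE i j : u i = u j -> wzip p q i = wzip p q j /\ (odd_at i -> i = j).
  move=> uij; have kij : nat_of_ord (u i).2 = nat_of_ord (u j).2 by rewrite uij.
  by apply: keyE; apply: val_inj; move: kij; rewrite !uE0.
have rp : @rowword d n I alphX p u.
  split=> [i|i j]; first by rewrite ffunE.
  rewrite wzipE [wzip p u j]wzipE => -[_ /uE[_ h]]; rewrite /rpar /= => oi.
  by apply: h; rewrite /odd_at oi.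
have rq : @rowword d n I alphY q u.
  split=> [i|i j]; first by rewrite ffunE /=; have /eqP := mg i; rewrite wzipE.
  rewrite wzipE [wzip q u j]wzipE => -[_ /uE[_ h]]; rewrite /rpar /= => oi.
  by apply: h; rewrite /odd_at oi orbT.
exists p, u, q; split=> //; exists (thB (wzip p q)).
have [_ gp] := rp; have [_ gq] := rq.
pose H w := thB w * @tabker k d n I alphX alphY p u q (wfst w, wsnd w).
have signs (p1 : word alphX) (q1 : word alphY) s : wperm (wzip p q) s = wzip p q ->
    sgn k (@rpar n I alphX) (wzip p u) s * sgn k (@rpar n I alphY) (wzip q u) s = 1.
  move=> st; rewrite (sgn_X _ q) (sgn_Y p).
  have := thB_perm (wzip p q) s; rewrite st (sgn_stab k gg st) mulr1.
  move=> h; apply: (mulfI (x := thB (wzip p q))); first by rewrite signr_eq0.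
  by rewrite mulr1 -h.
have eH : eqv pB H.
  move=> w s; have [p1 [q1 ->]] := wunzip w.
  rewrite /H wzip_perm !wfst_zip !wsnd_zip -wzip_perm thB_perm.
  rewrite !ffunE /= (reindex (@wperm d R ^~ s)) /=; last exact/onW_bij/wperm_bij.
  under eq_bigr => v _ do rewrite -!wzip_perm !orb_eqv // (sgn_X _ q1) (sgn_Y p1) mulrACA.
  rewrite -mulr_sumr; set x := (-1) ^+ _; set y := (-1) ^+ _; set z := sgn _ _ _ _.
  have xx : x * x = 1 by rewrite -expr2 sqrr_sign.
  have yy : y * y = 1 by rewrite -expr2 sqrr_sign.
  set th := thB _; set S := \sum_v _.
  have -> : th * (x * y * z) * (x * y * S) = (x * x) * (y * y) * (z * (th * S)).
    by ring.
  by rewrite xx yy !mul1r.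
have supp w : H w != 0 -> samew (wzip p q) w.
  have [p1 [q1 ->]] := wunzip w; rewrite /H wfst_zip wsnd_zip mulf_eq0 negb_or.
  case/andP=> _ /tabker_supp[u1 [/samew_zipP[s p1E u1E] /samew_zipP[s' q1E u1E']]].
  apply/samewP; exists s; apply/ffunP => i; rewrite [RHS]ffunE !wzipE p1E q1E [wperm p s i]ffunE [wperm q s' i]ffunE.
  congr (_, _).
  have /uE[] : u (s' i) = u (s i).
    by have /ffunP/(_ i) := u1E'; rewrite u1E !wpermE.
  by rewrite !wzipE => -[_ ->].
have H1 : H (wzip p q) = thB (wzip p q) * (mult cty (wzip p q))%:R.
  rewrite /H wfst_zip wsnd_zip; congr (_ * _); rewrite ffunE /=.
  rewrite -(@card_refinement d bas cty _ (wzip p q) u) => [|i j gij].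
    rewrite -sum1_card natr_sum [RHS]big_mkcond /=; apply: eq_bigr => u1 _; rewrite inE.
    case: ifP => [/samew_zipP[s st ->]|/negbT ns].
      have [ps qs] : p = wperm p s /\ q = wperm q s.
        by move: (st); rewrite wzip_perm => /wzip_inj.
      rewrite {2}ps {2}qs -!wzip_perm !orb_perm //; exact: signs.
    apply/eqP; apply: contraNT ns; rewrite mulf_eq0 negb_or.
    case/andP=> /orb_neq0/samew_zipP[s ps us] /orb_neq0/samew_zipP[s' qs us'].
    apply/samew_zipP; exists s => //; apply/ffunP => i; rewrite [RHS]ffunE !wzipE.
    have /uE[gss _] : u (s i) = u (s' i).
      by have /ffunP/(_ i) := us'; rewrite us !wpermE.
    move: gss; rewrite !wzipE => -[_ qss]; congr (_, _).
      by rewrite [in LHS]ps ffunE.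
    by rewrite [in LHS]qs ffunE qss.
  case: ifP => [ci|/negbT nci].
    move=> /uE[_ h]; apply: h; move: ci; rewrite /cty wzipE /= => /andP[oi _].
    by rewrite /odd_at oi.
  have [oi|ni] := boolP (pB (wzip p q i)); first by rewrite (gg _ _ gij oi).
  have no : ~~ odd_at i.
    move: ni nci; rewrite pBE /cty wzipE /odd_at /=.
    by case: pdeg; case: pdeg.
  rewrite !ffunE (keyF i j) //; congr (_, _).
  by move: gij; rewrite !wzipE => -[->].
have evH : ev t vB H = H (wzip p q) *: ev t vB (orb k pB (wzip p q)).
  by apply: ev_scale => w; apply: eqv_orb eH gg supp w.
by rewrite mul_XYw // -/H evH H1 scalerA mulrA thB_sqr mul1r.
Qed.

Definition std_products : set W := [set v | exists (p : word alphX) (u : word R) (q : word alphY) w z,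
  [/\ stdw p u w, stdw q u z & v = smul (Xw p u) (Yw q u)]]%classic.

Lemma ev_zero0 F : (forall h, F h = 0) -> ev t vB F = 0.
Proof. by move=> F0; apply: big1 => h _; rewrite F0 scale0r. Qed.

(** A generator that is not 0 is, up to a scalar, a product of two row tableaux, to which
    straightening applies. *)
Lemma TT_span w : TT w -> lspan std_products w.
Proof.
apply: lspan_min; first exact: lspan_submodule.
move=> {}w [g [gg ->]].
have [mg|/existsNP[i /negP nm]] := pselect (forall i, cmatched (g i)); last first.
  have -> : ev t vB (orb k pB g) = 0.
    apply: big1 => h _.
    have [->|/orb_neq0/samewP[s ->]] := eqVneq (orb k pB g h) 0; first by rewrite scale0r.
    rewrite (@multilinear0 _ _ _ _ _ (tp_multilinear hW) _ (s^-1%g i)) ?scaler0 //.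
    by rewrite ffunE [wperm _ _ _]ffunE permKV vB_unmatched.
  by rewrite scaler0; case: (lspan_submodule std_products).
have [p [u [q [rp rq [c ->]]]]] := factor_word gg mg.
apply: submoduleZ; first exact: lspan_submodule.
pose S := [set f : {ffun word alphX * word alphY -> k^o} |
  lspan std_products (ev t vB (fun g => thB g * f (wfst g, wsnd g)))]%classic.
have sS : submodule S.
  split=> [|b f f' Sf Sf']; rewrite /S /mkset.
    rewrite (ev_zero0 (F := fun h => thB h * (0 : {ffun word alphX * word alphY -> k^o}) (wfst h, wsnd h))); last by move=> h; rewrite ffunE mulr0.
    by case: (lspan_submodule std_products).
  have -> : ev t vB (fun h => thB h * (b *: f + f') (wfst h, wsnd h))
     = b *: ev t vB (fun h => thB h * f (wfst h, wsnd h)) + ev t vB (fun h => thB h * f' (wfst h, wsnd h)).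
    rewrite /ev scaler_sumr -big_split /=; apply: eq_bigr => h _.
    by rewrite !ffunE scalerA -scalerDl mulrDr; congr ((_ + _) *: _); rewrite mulrCA.
  exact: (lspan_submodule std_products).2.
have : S (@tabker k d n I alphX alphY p u q).
  apply: (standard_span k_char0 dn sS) rp rq => p1 u1 q1 w1 z1 S1 S2.
  rewrite /S /mkset -mul_XYw; [|exact: stdw_rowword S1|exact: stdw_rowword S2].
  by apply: lspan_in; exists p1, u1, q1, w1, z1.
by rewrite /S /mkset -mul_XYw.
Qed.

Lemma products_indep (J : finType) (p : J -> word alphX) (u : J -> word R) (w : J -> word 'I_d)
    (q : J -> word alphY) :
    (forall j, stdw (p j) (u j) (w j)) -> (forall j, stdw (q j) (u j) (w j)) ->
    (forall i j, samew (wzip (p i) (u i)) (wzip (p j) (u j)) ->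
      samew (wzip (q i) (u i)) (wzip (q j) (u j)) -> i = j) ->
  forall c : J -> k, \sum_j c j *: smul (Xw (p j) (u j)) (Yw (q j) (u j)) = 0 -> forall j, c j = 0.
Proof.
move=> S T inj c c0; apply: (standard_indep k_char0 S T inj).
apply/ffunP => -[p1 q1]; rewrite sum_ffunE ffunE.
have [m1|/existsNP[i /negP nm]] := pselect (forall i, cmatched (wzip p1 q1 i)); last first.
  apply: big1 => j _; rewrite ffunE; apply/eqP; rewrite mulf_eq0; apply/orP; right.
  apply: contraNT nm => /tabker_supp[u1 [/samew_zipP[s -> u1E] /samew_zipP[s' -> u1E']]].
  rewrite /cmatched /matched wzipE /= !ffunE.
  have [/(_ (s i)) /= -> _] := stdw_rowword (S j); have [/(_ (s' i)) /= -> _] := stdw_rowword (T j).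
  by have /ffunP/(_ i) := u1E'; rewrite u1E !wpermE => ->.
pose H w := \sum_j c j * (thB w * @tabker k d n I alphX alphY (p j) (u j) (q j) (wfst w, wsnd w)).
have H0 : ev t vB H = 0.
  rewrite (ev_lin t vB (F := fun j w => thB w * @tabker k d n I alphX alphY (p j) (u j) (q j) (wfst w, wsnd w)) (c := c) (s := index_enum J) (P := predT)) // -[RHS]c0.
  by apply: eq_bigr => j _; rewrite mul_XYw //; [apply: stdw_rowword (S j)|apply: stdw_rowword (T j)].
have := ev_vB_inj H0 m1; rewrite /H wfst_zip wsnd_zip.
under eq_bigr => j _ do rewrite mulrCA.
rewrite -mulr_sumr => /eqP; rewrite mulf_eq0 signr_eq0 /= => /eqP h0.
by rewrite -[RHS]h0; apply: eq_bigr => j _; rewrite ffunE.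
Qed.

End TensorLevel.

(** * Dominance *)

Lemma rank_total (L : finType) (le : rel L) :
    reflexive le -> antisymmetric le -> transitive le -> total le ->
  exists rk : L -> nat, injective rk /\ forall x y, (rk x <= rk y)%N = le x y.
Proof.
move=> refl anti trans tot; pose rk x := #|[pred y | le y x]|.
have rkE x y : (rk x <= rk y)%N = le x y.
  apply/idP/idP => [|xy]; last first.
    by apply: subset_leq_card; apply/fintype.subsetP => z; rewrite !inE => /trans; apply.
  apply: contraTT => nxy; rewrite -ltnNge; apply: proper_card; apply/properP; split.
    apply/fintype.subsetP => z; rewrite !inE => /trans; apply.
    by have := tot x y; rewrite (negbTE nxy).
  by exists x; rewrite inE ?refl.
exists rk; split=> // x y e; apply: anti.
by rewrite -!rkE e leqnn.
Qed.

Section Dominance.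
Variables (d n l : nat) (leI : rel 'I_l.+1).
Hypothesis leI_trans : transitive leI.
Hypothesis leI_nat : forall i j, leI i j -> (i <= j)%N.
Notation I := 'I_l.+1.
Notation R := (I * 'I_n)%type.
Notation word L := {ffun 'I_d -> L}.
Variables (Z : alphabet I) (letr : I -> 'I_n -> Z).
Hypothesis letr_even : forall c r, ~~ par (letr c r).
Hypothesis letr_rk : forall c r r', (rk (letr c r) <= rk (letr c r'))%N -> (r <= r')%N.
Variables (p : word Z) (u : word R) (w : word 'I_d) (v : word R).
Hypothesis S : stdw p u w.
Hypothesis v_le : forall i, leI (v i).1 (u i).1.
Hypothesis v_eq : forall i, (v i).1 = (u i).1 -> p i = letr (u i).1 (v i).2.

Lemma weight_above j : (#|[pred i | leI j (v i).1]| <= #|[pred i | leI j (u i).1]|)%N.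
Proof.
by apply: subset_leq_card; apply/fintype.subsetP => i; rewrite !inE => /leI_trans; apply.
Qed.

Lemma sum_by_count (f : word I) : (\sum_i f i = \sum_(j : I) #|[pred i | f i == j]| * j)%N.
Proof.
rewrite (partition_big f predT) //=; apply: eq_bigr => j _.
rewrite (eq_bigr (fun=> j : nat)) => [|i /eqP -> //].
by rewrite sum_nat_const.
Qed.

(** Components can only grow from [v] to [u], so if their counts agree, comparing the sums
    of their indices shows that none does. *)
Lemma weight_component :
    (forall j, #|[pred i | (v i).1 == j]| = #|[pred i | (u i).1 == j]|) ->
  forall i, (v i).1 = (u i).1.
Proof.
move=> cnt i; have /leqif_sum h : forall m : 'I_d, true -> ((v m).1 <= (u m).1 ?= iff ((v m).1 == (u m).1))%N.
  by move=> m _; split; [exact: leI_nat|rewrite -val_eqE].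
have [_] := h; have sw (x : word R) : (\sum_i (x i).1 = \sum_(j : I) #|[pred i | (x i).1 == j]| * j)%N.
  have := sum_by_count [ffun i => (x i).1]; under eq_bigr => m _ do rewrite ffunE.
  move=> ->; apply: eq_bigr => j _; congr (_ * _)%N.
  by apply: eq_card => m; rewrite !inE ffunE.
rewrite !sw (eq_bigr (fun j : I => #|[pred i | (u i).1 == j]| * j)%N); last by move=> j _; rewrite cnt.
by rewrite eqxx => /esym/forall_inP/(_ i isT)/eqP.
Qed.

Hypothesis same : forall i, (v i).1 = (u i).1.

(** Columns increase strictly, because all letters are now even; so the entry in
    row [r] has index at least [r]. *)
Lemma weight_row i : ((u i).2 <= (v i).2)%N.
Proof.
have [m] := ubnP (nat_of_ord (u i).2); elim: m i => // m0 IH i; rewrite ltnS leq_eqVlt.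
case/orP=> [/eqP ui|]; last exact: IH.
case: m0 ui IH => [|m] ui IH; first by rewrite ui.
have mn : (m < n)%N by apply: ltn_trans (ltn_ord (u i).2); rewrite ui.
have [j uj wj] : exists2 j, u j = ((u i).1, Ordinal mn) & w j = w i.
  by apply: (std_up S); rewrite ui.
have [] := std_col S (i := j) (j := i); rewrite ?uj ?ui //= => le ne.
have pj := v_eq (same j); have pi := v_eq (same i); rewrite uj /= in pj.
have := IH j; rewrite uj /= => /(_ (ltnSn m)) => IHj; apply: leq_ltn_trans IHj _.
rewrite ltn_neqAle; move: le; rewrite pj pi => /letr_rk ->; rewrite andbT.
apply: contraTneq (letr_even (u i).1 (v j).2) => /ord_inj e.
by rewrite negbK -pj; apply: ne; rewrite pj pi e.
Qed.

Lemma weight_dominated c (r : 'I_n) :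
  (#|[pred i | ((v i).1 == c) && ((v i).2 <= r)%N]| <= #|[pred i | ((u i).1 == c) && ((u i).2 <= r)%N]|)%N.
Proof.
apply: subset_leq_card; apply/fintype.subsetP => i; rewrite !inE same => /andP[-> le] /=.
exact: leq_trans (weight_row i) le.
Qed.

(** The rows of [u] are at most those of [v], and their sums agree. *)
Lemma weight_equal : samew v u -> v = u.
Proof.
move=> vu; have /leqif_sum h : forall m : 'I_d, true -> ((u m).2 <= (v m).2 ?= iff ((u m).2 == (v m).2))%N.
  by move=> m _; split; [exact: weight_row|rewrite -val_eqE].
have [_] := h; have /samewP[s us] := vu.
have -> : (\sum_m (u m).2 = \sum_m (v m).2)%N.
  rewrite [RHS](reindex_inj (@perm_inj _ s)) /=.
  by apply: eq_bigr => m _; rewrite us ffunE.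
rewrite eqxx => /esym/forall_inP e2; apply/ffunP => i.
by rewrite [LHS]surjective_pairing [RHS]surjective_pairing same (eqP (e2 i isT)).
Qed.

End Dominance.

(** * Reading words of multipartitions *)

Section Reading.
Variables (l n d : nat).
Notation I := 'I_l.+1.
Notation R := (I * 'I_n)%type.
Notation word L := {ffun 'I_d -> L}.

Section OneShape.
Variable lam : multipart l n d.

Definition node : finType := {i : I & {r : 'I_n & 'I_(mpart lam i r)}}.
Definition mknode i r (c : 'I_(mpart lam i r)) : node :=
  existT (fun i : I => {r : 'I_n & 'I_(mpart lam i r)}) i
    (existT (fun r : 'I_n => 'I_(mpart lam i r)) r c).
Definition ncomp (x : node) : I := tag x.
Definition nrow (x : node) : 'I_n := tag (tagged x).
Definition ncol (x : node) : 'I_(mpart lam (ncomp x) (nrow x)) := tagged (tagged x).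

Lemma mknodeE x : mknode (ncol x) = x.
Proof. by case: x => i [r c]. Qed.

Lemma card_node : #|node| = d.
Proof.
have /andP[/eqP sz _] := valP lam; rewrite -[RHS]sz card_tagged sumnE big_map big_enum /=.
apply: eq_bigr => i _; rewrite card_tagged sumnE big_map big_enum /=.
by apply: eq_bigr => r _; rewrite card_ord.
Qed.

Lemma map_reading_seq (L L' : Type) (f : L -> L') (F : forall i r, 'I_(mpart lam i r) -> L) :
  reading_seq (fun i r c => f (F i r c)) = map f (reading_seq F).
Proof.
rewrite /reading_seq map_flatten -map_comp; congr flatten; apply: eq_map => i /=.
rewrite map_flatten -map_comp; congr flatten; apply: eq_map => r /=.
by rewrite -map_comp.
Qed.

Definition node_at : 'I_d -> node := locked (tnth (reading mknode)).

Lemma tnth_reading (L : Type) (F : forall i r, 'I_(mpart lam i r) -> L) k :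
  tnth (reading F) k = F _ _ (ncol (node_at k)).
Proof.
pose f (x : node) := F _ _ (ncol x).
have -> : reading F = map_tuple f (reading mknode).
  by apply: val_inj; rewrite /= -map_reading_seq.
by rewrite tnth_map /node_at -lock.
Qed.

Lemma node_at_onto x : exists k, node_at k = x.
Proof.
have /seq_tnthP : x \in (reading mknode : seq node).
  case: x => i [r c]; apply/flattenP; exists (flatten [seq [seq mknode c | c <- enum 'I_(mpart lam i r)] | r <- enum 'I_n]).
    by apply/mapP; exists i => //; rewrite mem_enum.
  apply/flattenP; exists [seq mknode c | c <- enum 'I_(mpart lam i r)].
    by apply/mapP; exists r => //; rewrite mem_enum.
  by apply/mapP; exists c => //; rewrite mem_enum.
by case=> k ->; exists (cast_ord (size_tuple _) k); rewrite /node_at -lock !(tnth_nth x).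
Qed.

Lemma node_at_inj : injective node_at.
Proof.
apply/injectiveP; rewrite /injectiveb /dinjectiveb; apply/card_uniqP.
rewrite size_map -cardE card_ord -[RHS]card_node; apply: eq_card => x.
by rewrite inE; apply/codomP; case: (node_at_onto x) => k <-; exists k.
Qed.

Fact place_subproof x : exists k, node_at k == x.
Proof. by have [k <-] := node_at_onto x; exists k. Qed.

Definition place : node -> 'I_d := locked (fun x => xchoose (place_subproof x)).

Lemma placeK : cancel place node_at.
Proof. by move=> x; rewrite /place -lock; apply/eqP/(xchooseP (place_subproof x)). Qed.

Lemma node_atK : cancel node_at place.
Proof. by move=> k; apply: node_at_inj; rewrite placeK. Qed.

Lemma mpart_le i r : (mpart lam i r <= d)%N.
Proof. by rewrite -ltnS; apply: ltn_ord. Qed.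

Lemma mpart_anti i (r s : 'I_n) : (r <= s)%N -> (mpart lam i s <= mpart lam i r)%N.
Proof. by have /andP[_ /forallP/(_ i)/forallP/(_ r)/forallP/(_ s)/implyP] := valP lam. Qed.

Definition rows_of : word R := [ffun k => (ncomp (node_at k), nrow (node_at k))].
Definition cols_of : word 'I_d :=
  [ffun k => widen_ord (mpart_le _ _) (ncol (node_at k))].

Lemma rows_ofE k : rows_of k = (ncomp (node_at k), nrow (node_at k)).
Proof. exact: ffunE. Qed.

Lemma cols_ofE k : cols_of k = ncol (node_at k) :> nat.
Proof. by rewrite ffunE. Qed.

Lemma node_eq (x y : node) : (ncomp x, nrow x) = (ncomp y, nrow y) ->
  ncol x = ncol y :> nat -> x = y.
Proof.
case: x y => i [r c] [i' [r' c']]; rewrite /ncomp /nrow /ncol /= => -[ei er].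
by subst i' r' => /ord_inj ->.
Qed.

Lemma place_rows i r (c : 'I_(mpart lam i r)) : rows_of (place (mknode c)) = (i, r).
Proof. by rewrite rows_ofE placeK. Qed.

Lemma place_cols i r (c : 'I_(mpart lam i r)) : cols_of (place (mknode c)) = c :> nat.
Proof. by rewrite cols_ofE placeK. Qed.

Lemma cols_lt k : (cols_of k < mpart lam (rows_of k).1 (rows_of k).2)%N.
Proof. by rewrite cols_ofE rows_ofE /=. Qed.

Lemma node_exists i r c : (c < mpart lam i r)%N ->
  exists2 k, rows_of k = (i, r) & cols_of k = c :> nat.
Proof.
by move=> lt; exists (place (mknode (Ordinal lt))); rewrite ?place_rows ?place_cols.
Qed.

Lemma node_inj k k' : rows_of k = rows_of k' -> cols_of k = cols_of k' -> k = k'.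
Proof.
rewrite !rows_ofE => er /(congr1 (@nat_of_ord _)); rewrite !cols_ofE => ec.
exact/node_at_inj/node_eq.
Qed.

Lemma rowlen_rows i r : rowlen rows_of (i, r) = mpart lam i r.
Proof.
rewrite -[RHS]card_ord /rowlen -(card_imset _ (f := fun c => place (@mknode i r c))).
  apply: eq_card => k; rewrite !inE; apply/eqP/imsetP => [e|[c _ ->]]; last exact: place_rows.
  have := cols_lt k; rewrite e /= => lt; exists (Ordinal lt) => //.
  by apply: node_inj; [rewrite place_rows|apply: val_inj; rewrite /= place_cols].
move=> c c' e; apply: val_inj.
by rewrite /= -(place_cols c) e place_cols.
Qed.

End OneShape.

Lemma stdw_perm (Z : alphabet I) (p : word Z) (u : word R) (w : word 'I_d) (s : 'S_d) :
  stdw p u w -> stdw (wperm p s) (wperm u s) (wperm w s).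
Proof.
move=> S; split=> [i|i j|i c|i r|i j|i j]; rewrite ?(wpermE p, wpermE u, wpermE w).
- exact: std_co S _.
- by move=> uij wij; apply: (@perm_inj _ s); apply: std_inj S _ _ uij wij.
- move=> /(std_left S)[j uj wj]; exists (s^-1%g j); by rewrite ?[wperm _ _ _]ffunE permKV.
- move=> /(std_up S)[j uj wj]; exists (s^-1%g j); by rewrite ?[wperm _ _ _]ffunE permKV.
- exact: (std_row S (i := s i) (j := s j)).
- exact: (std_col S (i := s i) (j := s j)).
Qed.

Section OfWord.
Variables (Z : alphabet I) (p : word Z) (u : word R) (w : word 'I_d).
Hypothesis S : stdw p u w.

Lemma stdw_col_lt k : (w k < rowlen u (u k))%N.
Proof.
have ex (c : 'I_(w k).+1) : exists j, u j = u k /\ w j = c :> nat.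
  have := ltn_ord c; rewrite ltnS leq_eqVlt => /orP[/eqP ck|/(std_left S)[j]]; first by exists k.
  by exists j.
have [f fE] := choice ex.
have fi : injective f.
  by move=> c c' e; apply: val_inj; rewrite /= -(fE c).2 -(fE c').2 e.
rewrite -[X in (X <= _)%N]card_ord -(card_imset _ fi); apply: subset_leq_card.
by apply/fintype.subsetP => _ /imsetP[c _ ->]; rewrite inE (fE c).1.
Qed.

Lemma card_fibres (T : finType) (f : 'I_d -> T) (P : pred T) :
  #|[pred k | P (f k)]| = (\sum_(x | P x) #|[pred k | f k == x]|)%N.
Proof.
rewrite -sum1_card (partition_big f P) //=; apply: eq_bigr => x Px.
rewrite -sum1_card; apply: eq_bigl => k; rewrite !inE.
by case: (f k =P x) => [->|]; rewrite ?andbF ?Px.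
Qed.

(** A column has no gaps, so each entry of the lower row has an entry of the upper row
    above it. *)
Lemma stdw_rowlen_anti i (r r' : 'I_n) : (r <= r')%N -> (rowlen u (i, r') <= rowlen u (i, r))%N.
Proof.
rewrite leq_eqVlt => /orP[/eqP/ord_inj -> //|rr].
have ex (j : 'I_d) : exists j', u j = (i, r') -> u j' = (i, r) /\ w j' = w j.
  have [uj|nu] := pselect (u j = (i, r')); last by exists j => /nu.
  have [|j' uj' wj'] := std_up S (i := j) (r := r); first by rewrite uj.
  by exists j' => _; rewrite uj' uj.
have [f fE] := choice ex.
rewrite [X in (X <= _)%N]/rowlen -(@card_in_imset _ _ f (mem [pred j | u j == (i, r')])).
  by apply: subset_leq_card; apply/fintype.subsetP => _ /imsetP[j jr ->]; move: jr; rewrite !inE => /eqP/fE[-> _].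
move=> j j'; rewrite !inE => /eqP uj /eqP uj' e; apply: (std_inj S); rewrite ?uj ?uj' //.
by have [_ <-] := fE _ uj; have [_ <-] := fE _ uj'; rewrite e.
Qed.

Lemma shape_exists : exists lam : multipart l n d, forall i r, rowlen u (i, r) = mpart lam i r.
Proof.
have le i r : (rowlen u (i, r) < d.+1)%N.
  by rewrite ltnS -[X in (_ <= X)%N]card_ord max_card.
pose lam : {ffun I -> {ffun 'I_n -> 'I_d.+1}} := [ffun i => [ffun r => Ordinal (le i r)]].
have lamE i r : lam i r = rowlen u (i, r) :> nat by rewrite !ffunE.
have isp : is_multipart lam.
  apply/andP; split.
    apply/eqP; rewrite -[RHS]card_ord; under eq_bigr => i _ do under eq_bigr => r _ do rewrite lamE.
    rewrite pair_bigA /=; have := card_fibres u xpredT.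
    rewrite (eq_card (B := 'I_d)) => [->|k]; last by rewrite !inE.
    by apply: eq_bigr => -[i r] _.
  apply/forallP => i; apply/forallP => r; apply/forallP => r'; apply/implyP => rr.
  by rewrite !lamE; apply: stdw_rowlen_anti.
by exists (exist _ lam isp) => i r; rewrite /mpart lamE.
Qed.

(** The nodes of a tableau are those of its shape, so the places can be renumbered by
    their positions in the reading word of the shape. *)
Lemma stdw_transport (lam : multipart l n d) : (forall i r, rowlen u (i, r) = mpart lam i r) ->
  exists s : 'S_d, rows_of lam = wperm u s /\ stdw (wperm p s) (rows_of lam) (cols_of lam).
Proof.
move=> lamE.
have ex k : exists j, rows_of lam j = u k /\ cols_of lam j = w k.
  have := stdw_col_lt k; rewrite [u k]surjective_pairing lamE => /node_exists[j uj wj].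
  by exists j; split=> //; apply: val_inj.
have [f fE] := choice ex.
have fi : injective f.
  move=> k k' e; apply: (std_inj S); first by rewrite -(fE k).1 -(fE k').1 e.
  by rewrite -(fE k).2 -(fE k').2 e.
pose s := ((perm fi)^-1)%g.
have fK j : f (s j) = j by rewrite -[f _](permE fi) permKV.
have uE : rows_of lam = wperm u s.
  by apply/ffunP => j; rewrite [RHS]ffunE -(fE _).1 fK.
have wE : cols_of lam = wperm w s.
  by apply/ffunP => j; rewrite [RHS]ffunE -(fE _).2 fK.
by exists s; split=> //; rewrite uE wE; apply: stdw_perm.
Qed.

End OfWord.

(** In a sorted row the entries of rank at most [m] come first. *)
Lemma stdw_rk_le (Z : alphabet I) (p : word Z) (u : word R) (w : word 'I_d) i m : stdw p u w ->
  (rk (p i) <= m)%N = (w i < #|[pred j | (u j == u i) && (rk (p j) <= m)%N]|)%N.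
Proof.
move=> S; apply/idP/idP => [le_m|]; last first.
  apply: contraTT; rewrite -ltnNge -leqNgt => lt_m.
  rewrite -(@card_in_imset _ _ w (mem [pred j | (u j == u i) && (rk (p j) <= m)%N])).
    apply: leq_trans (card_ord_lt d (w i)); apply: subset_leq_card.
    apply/fintype.subsetP => _ /imsetP[j jm ->]; move: jm; rewrite !inE => /andP[/eqP uj le_m].
    rewrite ltnNge leq_eqVlt; apply/negP => /orP[/eqP/ord_inj wij|/(std_row S (esym uj))[le_ij _]].
      by move: lt_m; rewrite (std_inj S (esym uj) wij) ltnNge le_m.
    by move: lt_m; rewrite ltnNge (leq_trans le_ij le_m).
  move=> j j'; rewrite !inE => /andP[/eqP uj _] /andP[/eqP uj' _].
  by apply: (std_inj S); rewrite uj.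
have ex (c : 'I_(w i).+1) : exists j, [/\ u j = u i, w j = c :> nat & (rk (p j) <= m)%N].
  have := ltn_ord c; rewrite ltnS leq_eqVlt => /orP[/eqP ci|ci]; first by exists i.
  have [j uj wj] := std_left S ci; exists j; split=> //; apply: leq_trans le_m.
  by apply: (std_row S uj _).1; rewrite wj.
have [f fE] := choice ex.
have fi : injective f.
  by move=> c c' e; apply: val_inj; have [_ /= <- _] := fE c; have [_ /= <- _] := fE c'; rewrite e.
rewrite -[X in (X <= _)%N]card_ord -(card_imset _ fi); apply: subset_leq_card.
by apply/fintype.subsetP => _ /imsetP[c _ ->]; rewrite inE; have [-> _ ->] := fE c; rewrite eqxx.
Qed.

(** The rows of a standard tableau are sorted, so it is determined by their contents. *)
Lemma stdw_unique (Z : alphabet I) (p p' : word Z) (u : word R) (w : word 'I_d) :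
  stdw p u w -> stdw p' u w -> samew (wzip p u) (wzip p' u) -> p = p'.
Proof.
move=> S S' pp; apply/ffunP => i; apply: rk_inj.
have same m : (rk (p i) <= m)%N = (rk (p' i) <= m)%N.
  rewrite (stdw_rk_le i m S) (stdw_rk_le i m S'); congr (_ < _)%N.
  have := samew_card (fun x => (x.2 == u i) && (rk x.1 <= m)%N) pp.
  rewrite (eq_card (B := [pred j | (u j == u i) && (rk (p j) <= m)%N])) => [->|j]; last by rewrite !inE wzipE.
  by apply: eq_card => j; rewrite !inE wzipE.
by apply/eqP; rewrite eqn_leq same leqnn -same leqnn.
Qed.

Lemma mnormE (lam : multipart l n d) i : mnorm lam i = #|[pred k | (rows_of lam k).1 == i]|.
Proof.
rewrite ffunE (card_fibres _ (fun x : R => x.1 == i)).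
rewrite (eq_bigl (fun x : R => (x.1 == i) && xpredT x.2)) => [|x]; last by rewrite andbT.
rewrite -(pair_big_dep (fun j => j == i) (fun _ => xpredT) (fun j r => #|[pred k | rows_of lam k == (j, r)]|)) /=.
by rewrite big_pred1_eq; apply: eq_bigr => r _; rewrite -rowlen_rows.
Qed.

Lemma upper_sum (leI : rel I) (lam : multipart l n d) i :
  (\sum_(j | leI i j) mnorm lam j = #|[pred k | leI i (rows_of lam k).1]|)%N.
Proof.
rewrite (card_fibres (fun k => (rows_of lam k).1) (leI i)).
by apply: eq_bigr => j _; rewrite mnormE.
Qed.

Lemma partial_sum (lam : multipart l n d) i (r : 'I_n) :
  (\sum_(q < n | (q <= r)%N) mpart lam i q
   = #|[pred k | ((rows_of lam k).1 == i) && ((rows_of lam k).2 <= r)%N]|)%N.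
Proof.
rewrite (card_fibres _ (fun x : R => (x.1 == i) && (x.2 <= r)%N)).
rewrite -(pair_big_dep (fun j => j == i) (fun _ (q : 'I_n) => (q <= r)%N) (fun j q => #|[pred k | rows_of lam k == (j, q)]|)) /=.
by rewrite big_pred1_eq; apply: eq_bigr => q _; rewrite -rowlen_rows.
Qed.

Lemma rows_of_inj lam mu : samew (rows_of lam) (rows_of mu) -> lam = mu.
Proof.
move=> /samew_count h; apply: val_inj; apply/ffunP => i; apply/ffunP => r.
by apply: val_inj; have := h (i, r); rewrite -!/(rowlen _ _) !rowlen_rows.
Qed.

Section Order.
Variable leI : rel I.
Hypothesis leI_po : partial_order_rel leI.
Hypothesis leI_nat : forall i j, leI i j -> (i <= j)%N.

(** Downward induction along the linear refinement of the order: the upper sum at [i] is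
    the value at [i] plus values at larger indices. *)
Lemma domI_anti (al be : {ffun I -> nat}) : domI leI al be -> domI leI be al -> al = be.
Proof.
have [refl anti _] := leI_po.
move=> /forallP ab /forallP ba; apply/ffunP => i.
have [m] := ubnP (l - i); elim: m i => // m IH i; rewrite ltnS => lim.
have /eqP : (\sum_(j | leI i j) al j == \sum_(j | leI i j) be j)%N by rewrite eqn_leq ab ba.
rewrite [X in X = _](bigD1 i) ?refl //= [X in _ = X](bigD1 i) ?refl //=.
rewrite (eq_bigr (fun j => be j)); first by move/addIn.
move=> j /andP[ij nij]; apply: IH; apply: leq_trans lim.
have lt : (i < j)%N.
  by rewrite ltn_neqAle leI_nat // andbT; apply: contraNneq nij => /ord_inj ->.
by apply: ltn_sub2l => //; apply: leq_trans lt _; rewrite -ltnS.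
Qed.

Lemma dominates_anti (la mu : 'I_n -> nat) : dominates mu la -> dominates la mu -> la =1 mu.
Proof.
move=> /forallP ab /forallP ba r.
have e (q : 'I_n) : (\sum_(q' < n | (q' <= q)%N) la q' = \sum_(q' < n | (q' <= q)%N) mu q')%N.
  by apply/eqP; rewrite eqn_leq ab ba.
have [m] := ubnP r; elim: m r => // m IH r; rewrite ltnS => rm.
have := e r; rewrite [X in X = _](bigD1 r) //= [X in _ = X](bigD1 r) //= (eq_bigr (fun q => mu q)); first by move/addIn.
move=> q /andP[qr nqr]; apply: IH; apply: leq_trans rm.
by rewrite ltn_neqAle qr andbT.
Qed.

Lemma domI_trans (al be ga : {ffun I -> nat}) : domI leI al be -> domI leI be ga -> domI leI al ga.
Proof.
by move=> /forallP ab /forallP bc; apply/forallP => i; apply: leq_trans (ab i) (bc i).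
Qed.

Lemma multipart_le_po : partial_order_rel (@multipart_le l n d leI).
Proof.
split=> [lam|lam mu|mu lam nu]; rewrite /multipart_le.
- by rewrite eqxx /=; apply/orP; right; apply/forallP => i; apply/forallP.
- have [nn|nn] := eqVneq (mnorm lam) (mnorm mu).
    rewrite andbF andbF /= => /andP[/forallP h1 /forallP h2].
    apply: val_inj; apply/ffunP => i; apply/ffunP => r; apply: val_inj.
    exact: (dominates_anti (h1 i) (h2 i)).
  rewrite andbT !orbF => /andP[h1 /andP[h2 _]].
  by rewrite (domI_anti h1 h2) eqxx in nn.
- case/orP=> [/andP[h1 n1]|/andP[/eqP e1 /forallP h1]] /orP[/andP[h2 n2]|/andP[/eqP e2 /forallP h2]].
  + apply/orP; left; rewrite (domI_trans h1 h2) /=.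
    by apply: contraNneq n2 => e; move: h1; rewrite e => h1; rewrite (domI_anti h1 h2).
  + by rewrite -e2 h1 n1.
  + by rewrite e1 h2 n2.
  + rewrite e1 e2 eqxx /=; apply/orP; right; apply/forallP => i; apply/forallP => r.
    exact: leq_trans (forallP (h1 i) r) (forallP (h2 i) r).
Qed.

Variables (Z : alphabet I) (letr : I -> 'I_n -> Z).
Hypothesis letr_even : forall c r, ~~ par (letr c r).
Hypothesis letr_rk : forall c r r', (rk (letr c r) <= rk (letr c r'))%N -> (r <= r')%N.

(** The component sizes of [nu] are bounded by [weight_above]; if they are those of [lam],
    then [v] has the components of [lam], all letters are [letr], and the rows are
    compared by [weight_dominated]. *)
Lemma weight_le (lam nu : multipart l n d) (p : word Z) (w : word 'I_d) (v : word R) :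
    stdw p (rows_of lam) w -> samew v (rows_of nu) ->
    (forall i, leI (v i).1 (rows_of lam i).1) ->
    (forall i, (v i).1 = (rows_of lam i).1 -> p i = letr (rows_of lam i).1 (v i).2) ->
  multipart_le leI nu lam /\
  (nu = lam -> p = [ffun i => letr (rows_of lam i).1 (rows_of lam i).2]).
Proof.
have [_ _ trans] := leI_po.
move=> S vn v_le v_eq; have cnt P := samew_card P vn.
have norm j : mnorm nu j = #|[pred k | (v k).1 == j]|.
  by rewrite mnormE (cnt (fun x : R => x.1 == j)).
have same : mnorm nu = mnorm lam -> forall i, (v i).1 = (rows_of lam i).1.
  move=> nn; apply: (weight_component leI_nat v_le) => j.
  by rewrite -norm nn mnormE.
split; last first.
  move=> nl; have sm : forall i, (v i).1 = (rows_of lam i).1 by apply: same; rewrite nl.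
  rewrite nl in vn; have ve := weight_equal letr_even letr_rk S v_eq sm vn.
  by apply/ffunP => i; rewrite [RHS]ffunE v_eq ?sm // ve.
rewrite /multipart_le; have [nn|nn] := eqVneq (mnorm nu) (mnorm lam); last first.
  rewrite andbT orbF; apply/forallP => j; rewrite !upper_sum -(cnt (fun x : R => leI j x.1)).
  exact: weight_above.
apply/orP; right; apply/forallP => c; apply/forallP => r; rewrite !partial_sum.
rewrite -(cnt (fun x : R => (x.1 == c) && (x.2 <= r)%N)).
have h := weight_dominated letr_even letr_rk S v_eq (same nn) c r.
exact: h.
Qed.

End Order.

End Reading.

(** * Coloured tableaux as words *)

Section ColouredTableaux.
Variables (k : idomainType) (A : superalg k) (l n d : nat).
Notation I := 'I_l.+1.
Notation R := (I * 'I_n)%type.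
Notation word L := {ffun 'I_d -> L}.
Variables (P : finType) (cP : P -> I) (vP : P -> A) (dP : P -> deg) (X : I -> set A).
Hypothesis vP_inj : injective vP.
Hypothesis XP : forall i x, X i x <-> exists2 xi, cP xi = i & vP xi = x.
Hypothesis grP : forall xi, gr (dP xi) (vP xi).
Hypothesis vP_neq0 : forall xi, vP xi != 0.
Variable le : I -> rel ('I_n * A).
Hypothesis hle : forall i, letter_order (X i) (le i).

Definition letter_rank (rk : 'I_n * P -> nat) : Prop :=
  forall p q, cP p.2 = cP q.2 -> (rk p <= rk q)%N = le (cP p.2) (p.1, vP p.2) (q.1, vP q.2).

(** Standardness compares letters of one component only, so the total orders of the
    components can be put one after the other. *)
Lemma letter_rank_exists : exists rk, injective rk /\ letter_rank rk.
Proof.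
pose gle (p q : 'I_n * P) := (cP p.2 < cP q.2)%N ||
  (cP p.2 == cP q.2) && le (cP p.2) (p.1, vP p.2) (q.1, vP q.2).
have inX (xi : P) : X (cP xi) (vP xi) by apply/XP; exists xi.
have gleE p q : cP p.2 = cP q.2 -> gle p q = le (cP p.2) (p.1, vP p.2) (q.1, vP q.2).
  by rewrite /gle => ->; rewrite ltnn eqxx.
have [] := @rank_total _ gle.
- by move=> p; rewrite gleE //; have [refl _ _ _ _] := hle (cP p.2); apply: refl.
- move=> p q; case: (ltngtP (cP p.2) (cP q.2)) => [pq|pq|/ord_inj pq].
  + by rewrite /gle pq ltnNge (ltnW pq) /= -val_eqE /= gtn_eqF.
  + by rewrite /gle pq ltnNge (ltnW pq) /= -val_eqE /= gtn_eqF.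
  rewrite !gleE // -pq => /andP[pq1 qp1]; have [_ anti _ _ _] := hle (cP p.2).
  have := anti (p.1, vP p.2) (q.1, vP q.2) (inX p.2); rewrite {1}pq => /(_ (inX q.2) pq1 qp1) [e1 /vP_inj e2].
  by rewrite [p]surjective_pairing [q]surjective_pairing e1 e2.
- move=> q p r; rewrite {1 2}/gle; case/orP=> [pq|/andP[/eqP pq lpq]] /orP[qr|/andP[/eqP qr lqr]].
  + by rewrite /gle (ltn_trans pq qr).
  + by rewrite /gle -qr pq.
  + by rewrite /gle pq qr.
  rewrite gleE ?pq // -pq; have [_ _ tr _ _] := hle (cP p.2).
  rewrite -pq in lqr; apply: (tr _ (q.1, vP q.2)) => //=; first by rewrite pq; apply: inX.
  by rewrite pq qr; apply: inX.
- move=> p q; case: (ltngtP (cP p.2) (cP q.2)) => [pq|pq|/ord_inj pq].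
  + by rewrite /gle pq.
  + by rewrite /gle pq orbT.
  rewrite !gleE // -pq; have [_ _ _ tot _] := hle (cP p.2).
  by apply: tot => //=; rewrite pq; apply: inX.
by move=> rk [rk_inj rkE]; exists rk; split=> // p q pq; rewrite rkE gleE.
Qed.

Variables (rk : 'I_n * P -> nat) (rk_inj : injective rk).
Hypothesis rkE : letter_rank rk.

Local Notation Z := (@Alphabet I ('I_n * P)%type (fun p => pdeg (dP p.2)) (fun p => cP p.2) rk rk_inj).

Lemma rk_row (xi : P) (r r' : 'I_n) : (rk (r, xi) <= rk (r', xi))%N -> (r <= r')%N.
Proof.
apply: contraTT; rewrite -!ltnNge => rr; rewrite ltn_neqAle; apply/andP; split.
  by apply: contraTneq rr => /rk_inj[->]; rewrite ltnn.
rewrite rkE //=; have [_ _ _ _ inc] := hle (cP xi); apply: inc => //.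
by apply/XP; exists xi.
Qed.

Variable lam : multipart l n d.

Definition fill (p : word Z) : multifilling A lam :=
  fun i r c => let x := p (place (mknode c)) in (x.1, vP x.2).

Lemma tnth_row_fill p j : tnth (row_word (fill p)) j = (p j).1.
Proof. by rewrite tnth_reading /fill /= mknodeE node_atK. Qed.

Lemma tnth_color_fill p j : tnth (color_word (fill p)) j = vP (p j).2.
Proof. by rewrite tnth_reading /fill /= mknodeE node_atK. Qed.

Lemma evenP xi : evenE (vP xi) <-> ~~ pdeg (dP xi).
Proof. exact: even_pdeg (grP xi) (vP_neq0 xi). Qed.

Lemma oddP xi : oddE (vP xi) <-> pdeg (dP xi).
Proof. exact: odd_pdeg (grP xi) (vP_neq0 xi). Qed.

Lemma fill_std p : stdw p (rows_of lam) (cols_of lam) -> Std X le (fill p).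
Proof.
move=> S i.
have co_i r (c : 'I_(mpart lam i r)) : cP (p (place (mknode c))).2 = i.
  by rewrite [LHS](std_co S) place_rows.
have rk_le r r' (c : 'I_(mpart lam i r)) (c' : 'I_(mpart lam i r')) :
    (rk (p (place (mknode c))) <= rk (p (place (mknode c'))))%N = le i (fill p c) (fill p c').
  have cc : cP (p (place (mknode c))).2 = cP (p (place (mknode c'))).2.
    exact: etrans (co_i r c) (esym (co_i r' c')).
  by have := rkE cc; rewrite (co_i r c).
have sep r (c c' : 'I_(mpart lam i r)) : fill p c = fill p c' -> p (place (mknode c)) = p (place (mknode c')).
  by case=> e1 /vP_inj e2; rewrite [LHS]surjective_pairing [RHS]surjective_pairing e1 e2.
have srow r (c c' : 'I_(mpart lam i r)) : (c < c')%N ->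
    (rk (p (place (mknode c))) <= rk (p (place (mknode c'))))%N /\
    (p (place (mknode c)) = p (place (mknode c')) -> ~~ pdeg (dP (p (place (mknode c))).2)).
  move=> cc; apply: (std_row S (i := place (mknode c)) (j := place (mknode c'))).
    by rewrite !place_rows.
  by rewrite !place_cols.
split.
- split=> [r c|r c c' ncc e]; first by apply/XP; exists (p (place (mknode c))).2.
  have pp := sep r c c' e; rewrite [_.2]/=; apply/evenP.
  case: (ltngtP c c') => [lt|lt|/ord_inj cc]; last by rewrite cc eqxx in ncc.
    exact: (srow r c c' lt).2 pp.
  rewrite pp; exact: (srow r c' c lt).2 (esym pp).
- move=> r c c'; rewrite leq_eqVlt => /orP[/eqP/ord_inj ->|/srow[+ _]].
    have [refl _ _ _ _] := hle i; apply: refl; apply/XP; by exists (p (place (mknode c'))).2.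
  by rewrite [(rk _ <= rk _)%N]rk_le.
move=> r r' c c' rr cc.
have [] := std_col S (i := place (mknode c)) (j := place (mknode c')).
- by rewrite !place_rows.
- by rewrite !place_rows.
- by apply: val_inj; rewrite /= !place_cols.
rewrite [(rk _ <= rk _)%N]rk_le => le1 od; split=> // -[e1 /vP_inj e2]; apply/oddP; apply: od.
by rewrite [LHS]surjective_pairing [RHS]surjective_pairing e1 e2.
Qed.

Lemma std_fill S : Std X le S -> exists2 p, stdw p (rows_of lam) (cols_of lam) & S = fill p.
Proof.
move=> St; pose ent j := S _ _ (ncol (node_at lam j)).
have ex (j : 'I_d) : exists xi, cP xi = ncomp (node_at lam j) /\ vP xi = (ent j).2.
  have [[inX _] _ _] := St (ncomp (node_at lam j)).
  by have /XP[xi] := inX _ (ncol (node_at lam j)); exists xi.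
have [f fE] := choice ex.
pose p : word Z := [ffun j => ((ent j).1, f j)].
have pE j : ((p j).1, vP (p j).2) = ent j by rewrite ffunE /= (fE j).2 -surjective_pairing.
have S_fill : S = fill p.
  apply: functional_extensionality_dep => i; apply: functional_extensionality_dep => r.
  apply: functional_extensionality_dep => c; rewrite /fill pE /ent placeK; by case: c.
have co_j j : cP (p j).2 = (rows_of lam j).1 by rewrite rows_ofE ffunE (fE j).1.
have entE i r (c : 'I_(mpart lam i r)) : ent (place (mknode c)) = S i r c.
  by rewrite /ent placeK.
have atE j : exists i r (c : 'I_(mpart lam i r)), j = place (mknode c).
  by exists _, _, (ncol (node_at lam j)); rewrite mknodeE node_atK.
exists p => //; split.
- by move=> j; exact: co_j.
- exact: node_inj.
- move=> j c lt; have := ltn_trans lt (cols_lt lam j) => /node_exists[j' ej' cj'].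
  by exists j' => //; rewrite ej' -surjective_pairing.
- move=> j r lt; have lt' : (cols_of lam j < mpart lam (rows_of lam j).1 r)%N.
    by apply: leq_trans (cols_lt lam j) _; apply/mpart_anti/ltnW.
  have [j' ej' cj'] := node_exists lt'.
  by exists j' => //; apply: val_inj.
- move=> j j'; have [i [r [c ->]]] := atE j; have [i' [r' [c' ->]]] := atE j'.
  rewrite !place_rows !place_cols => -[ei er]; subst i' r' => cc.
  have [[_ ev] rows _] := St i; split.
    rewrite /= rkE ?co_j ?place_rows //= !pE !entE; apply: rows; exact: ltnW.
  move=> pp; apply/evenP; have := pE (place (mknode c)); rewrite entE => e.
  rewrite [vP _](congr1 snd e); apply: (ev _ c c').
    by apply: contraTneq cc => ->; rewrite ltnn.
  by rewrite -e -[S i r c']entE -pE pp.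
move=> j j'; have [i [r [c ->]]] := atE j; have [i' [r' [c' ->]]] := atE j'.
rewrite !place_rows /= => ei rr cc; subst i'.
have {}cc : c = c' :> nat by rewrite -place_cols cc place_cols.
have [_ _ cols] := St i; have [le1 od] := cols _ _ _ _ rr cc; split.
  by rewrite /= rkE ?co_j ?place_rows //= !pE !entE.
move=> pp; apply/oddP; have := pE (place (mknode c)); rewrite entE => e.
rewrite [vP _](congr1 snd e); apply: od.
by rewrite -e -[S i r' c']entE -pE pp.
Qed.

(** The tableau with [r^(e_i)] in row [r] of component [i]: its letters are even and
    increase down the columns. *)
Lemma initial_stdw (eP : I -> P) : (forall i, cP (eP i) = i) -> (forall i, pdeg (dP (eP i)) = false) ->
  @stdw d n I Z [ffun j => ((rows_of lam j).2, eP (rows_of lam j).1)] (rows_of lam) (cols_of lam).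
Proof.
move=> ceP deP; set p := finfun _.
have pE j : p j = ((rows_of lam j).2, eP (rows_of lam j).1) by rewrite ffunE.
apply: Stdw.
- by move=> j; rewrite /= pE ceP.
- exact: node_inj.
- move=> j c lt; have := ltn_trans lt (cols_lt lam j) => /node_exists[j' ej' cj'].
  by exists j' => //; rewrite ej' -surjective_pairing.
- move=> j r lt; have lt' : (cols_of lam j < mpart lam (rows_of lam j).1 r)%N.
    by apply: leq_trans (cols_lt lam j) _; apply/mpart_anti/ltnW.
  have [j' ej' cj'] := node_exists lt'.
  by exists j' => //; apply: val_inj.
- by move=> j j' ej _; rewrite !pE ej leqnn /= deP.
move=> j j' ej rr _; rewrite !pE ej; split; last by case=> e; rewrite e ltnn in rr.
by rewrite leqNgt; apply/negP => /ltnW/rk_row; rewrite leqNgt rr.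
Qed.

End ColouredTableaux.

(** * The standard heredity data *)

Section IndexedBasis.
Variables (k : comNzRingType) (V : lmodType k) (J : finType) (f : J -> V).
Hypothesis f_indep : forall c : J -> k, \sum_j c j *: f j = 0 -> forall j, c j = 0.

Lemma indep_inj : injective f.
Proof.
move=> i j e'; apply/eqP; apply: contraT => nij.
have := @f_indep (fun m => (m == i)%:R - (m == j)%:R) _ i.
rewrite eqxx (negbTE nij) subr0 => c0; apply/eqP; case/eqP: (oner_neq0 k); apply: c0.
under eq_bigr => m _ do rewrite scalerBl.
have sumE m0 : \sum_m (m == m0)%:R *: f m = f m0.
  rewrite (bigD1 m0) // eqxx scale1r big1 => [|m /negbTE ->]; last exact: scale0r.
  exact: addr0.
by rewrite sumrB !sumE e' subrr.
Qed.

Lemma indep_range (S : set V) : (forall u, S u <-> exists j, u = f j) -> linearly_independent S.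
Proof.
move=> SE s c us sB c0 u us'; have [j uj] := (SE u).1 (sB u us').
have := @f_indep (fun j => if f j \in s then c (f j) else 0) _ j.
rewrite -uj us'; apply; rewrite -[RHS]c0.
under eq_bigr => m _ do rewrite (fun_if (fun x => x *: f m)) scale0r.
rewrite -big_mkcond /= -(big_map f (fun v => v \in s) (fun v => c v *: v)).
rewrite -big_filter; apply: perm_big; apply: uniq_perm => //.
  by rewrite filter_uniq // map_inj_uniq ?index_enum_uniq //; apply: indep_inj.
move=> v; rewrite mem_filter; case vs : (v \in s) => //=.
have [m ->] := (SE v).1 (sB v vs).
by rewrite map_f // mem_index_enum.
Qed.

End IndexedBasis.

Section Heredity.
Variables (k : idomainType) (n d : nat).
Hypothesis k_char0 : [pchar k] =i pred0.
Hypotheses (n_gt0 : (0 < n)%N) (dn : (d <= n)%N).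
Variables (A : superalg k) (a : set A) (l : nat) (leI : rel 'I_l.+1).
Variables (X Y : 'I_l.+1 -> set A) (e : 'I_l.+1 -> A).
Hypothesis ha : conforming leI X Y e a.
Hypothesis leI_nat : forall i j : 'I_l.+1, leI i j -> (i <= j)%N.
Variable D : presentation leI X Y e.
Local Notation hA := (based_hd D).
Variables (leX leY : 'I_l.+1 -> rel ('I_n * A)).
Hypothesis hleX : forall i, letter_order (X i) (leX i).
Hypothesis hleY : forall i, letter_order (Y i) (leY i).
Variables (rX : 'I_n * PX D -> nat) (rY : 'I_n * PY D -> nat).
Hypotheses (rX_inj : injective rX) (rY_inj : injective rY).
Hypothesis rXE : letter_rank (@cX _ _ _ _ _ _ _ D) (@vX _ _ _ _ _ _ _ D) leX rX.
Hypothesis rYE : letter_rank (@cY _ _ _ _ _ _ _ D) (@vY _ _ _ _ _ _ _ D) leY rY.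
Variables (W : superalg k) (t : {ffun 'I_d -> matA A n} -> W).
Hypothesis hW : tensor_power t.
Notation I := 'I_l.+1.
Notation R := (I * 'I_n)%type.
Notation word L := {ffun 'I_d -> L}.
Local Notation ZX := (alphX rX_inj).
Local Notation ZY := (alphY rY_inj).
Local Notation Xw := (@Xw k n d A I leI X Y e D rX rX_inj W t).
Local Notation Yw := (@Yw k n d A I leI X Y e D rY rY_inj W t).
Local Notation Ew := (@Ew k n d A I e W t).
Local Notation TT := (@TT k n d A I leI X Y e D rX rY rX_inj rY_inj W t).

Local Notation fillX lam := (@fill k A l n d (PX D) (@cX _ _ _ _ _ _ _ D) (@vX _ _ _ _ _ _ _ D) (@dX _ _ _ _ _ _ _ D) rX rX_inj lam).
Local Notation fillY lam := (@fill k A l n d (PY D) (@cY _ _ _ _ _ _ _ D) (@vY _ _ _ _ _ _ _ D) (@dY _ _ _ _ _ _ _ D) rY rY_inj lam).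

Lemma tnth_lword (lam : multipart l n d) j : tnth (lword lam) j = (rows_of lam j).2.
Proof. by rewrite tnth_reading rows_ofE. Qed.

Lemma tnth_eword (lam : multipart l n d) j : tnth (eword e lam) j = e (rows_of lam j).1.
Proof. by rewrite tnth_reading rows_ofE. Qed.

Lemma xi_X (lam : multipart l n d) (p : word ZX) : rowword p (rows_of lam) ->
  xi t (color_word ((fillX lam) p)) (row_word ((fillX lam) p)) (lword lam) = Xw p (rows_of lam).
Proof.
move=> [cp gp]; apply: xi_ev => // [i j|i|i].
- rewrite !wzipE !tnth_row_fill !tnth_color_fill !tnth_lword.
  apply/eqP/eqP => [[-> ->] //|[/vX_inj e1 e2 e3]].
  have pij : p i = p j by rewrite [LHS]surjective_pairing [RHS]surjective_pairing e1 e2.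
  by rewrite pij [rows_of lam i]surjective_pairing [rows_of lam j]surjective_pairing e3 -!cp pij.
- by rewrite wzipE /UX tnth_row_fill tnth_color_fill tnth_lword.
- rewrite wzipE tnth_color_fill /rpar /=; apply/esym; apply/asboolP/idP.
  + by move/(odd_pdeg (grX _) (vX_neq0 _)).1.
  + by move/(odd_pdeg (grX _) (vX_neq0 _)).2.
Qed.

Lemma xi_Y (lam : multipart l n d) (p : word ZY) : rowword p (rows_of lam) ->
  xi t (color_word ((fillY lam) p)) (lword lam) (row_word ((fillY lam) p)) = Yw p (rows_of lam).
Proof.
move=> [cp gp]; apply: xi_ev => // [i j|i|i].
- rewrite !wzipE !tnth_row_fill !tnth_color_fill !tnth_lword.
  apply/eqP/eqP => [[-> ->] //|[/vY_inj e1 e3 e2]].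
  have pij : p i = p j by rewrite [LHS]surjective_pairing [RHS]surjective_pairing e1 e2.
  by rewrite pij [rows_of lam i]surjective_pairing [rows_of lam j]surjective_pairing e3 -!cp pij.
- by rewrite wzipE /UY tnth_row_fill tnth_color_fill tnth_lword.
- rewrite wzipE tnth_color_fill /rpar /=; apply/esym; apply/asboolP/idP.
  + by move/(odd_pdeg (grY _) (vY_neq0 _)).1.
  + by move/(odd_pdeg (grY _) (vY_neq0 _)).2.
Qed.

Lemma e_lamE (lam : multipart l n d) : e_lam t e lam = Ew (rows_of lam).
Proof.
apply: xi_ev => [i j|i|i|i j].
- rewrite !tnth_eword !tnth_lword; apply/eqP/eqP => [-> //|[e1 e2 _]].
  rewrite [LHS]surjective_pairing [RHS]surjective_pairing e2; congr (_, _).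
  by rewrite -(ceX D (rows_of lam i).1) -(ceX D (rows_of lam j).1); congr cX; apply: vX_inj; rewrite !veX.
- by rewrite tnth_eword tnth_lword.
- rewrite tnth_eword; apply/esym/asboolP.
  by move/(odd_pdeg (gr_e D _) (e_neq0 D _)).1.
- by [].
Qed.

Lemma calXE lam w : calX t X leX lam w <->
  exists2 p : word ZX, stdw p (rows_of lam) (cols_of lam) & w = Xw p (rows_of lam).
Proof.
split=> [[S St <-]|[p S ->]].
  have [p Sp ->] := std_fill (XP D) (@grX _ _ _ _ _ _ _ D) (@vX_neq0 _ _ _ _ _ _ _ D) rX_inj rXE St.
  by exists p => //; apply/xi_X/(stdw_rowword Sp).
exists ((fillX lam) p); last exact/xi_X/(stdw_rowword S).
by have := fill_std (@vX_inj _ _ _ _ _ _ _ D) (XP D) (@grX _ _ _ _ _ _ _ D) (@vX_neq0 _ _ _ _ _ _ _ D) hleX rXE; apply.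
Qed.

Lemma calYE lam w : calY t Y leY lam w <->
  exists2 q : word ZY, stdw q (rows_of lam) (cols_of lam) & w = Yw q (rows_of lam).
Proof.
split=> [[S St <-]|[q S ->]].
  have [q Sq ->] := std_fill (YP D) (@grY _ _ _ _ _ _ _ D) (@vY_neq0 _ _ _ _ _ _ _ D) rY_inj rYE St.
  by exists q => //; apply/xi_Y/(stdw_rowword Sq).
exists ((fillY lam) q); last exact/xi_Y/(stdw_rowword S).
by have := fill_std (@vY_inj _ _ _ _ _ _ _ D) (YP D) (@grY _ _ _ _ _ _ _ D) (@vY_neq0 _ _ _ _ _ _ _ D) hleY rYE; apply.
Qed.

Local Notation bas := (@bas k n A I leI X Y e D rX rY rX_inj rY_inj).
Local Notation vB := (@vB k n A I leI X Y e D rX rY rX_inj rY_inj).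
Local Notation pB := (@pB k n A I leI X Y e D rX rY rX_inj rY_inj).
Local Notation cty := (@cty k n A I leI X Y e D rX rY rX_inj rY_inj).
Local Notation cmatched := (@cmatched k n A I leI X Y e D rX rY rX_inj rY_inj).

Section Generator.
Variables (g : word bas) (b : d.-tuple A) (r s : d.-tuple 'I_n).
Hypothesis mg : forall i, cmatched (g i).
Hypothesis bE : forall i, tnth b i = vXY ((g i).1.2, (g i).2.2).
Hypothesis rE : forall i, tnth r i = (g i).1.1.
Hypothesis sE : forall i, tnth s i = (g i).2.1.

Lemma same_label i (x : bas) : cmatched x ->
  (g i == x) = ((tnth b i, tnth r i, tnth s i) == (vXY (x.1.2, x.2.2), x.1.1, x.2.1)).
Proof.
move=> mx; rewrite bE rE sE; apply/eqP/eqP => [-> //|[/(vXY_inj (mg i) mx)[e1 e2] e3 e4]].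
case: (g i) x e1 e2 e3 e4 {mx} => [[? ?] [? ?]] [[? ?] [? ?]] /=.
by move=> -> -> -> ->.
Qed.

Lemma even_label i : evenE (tnth b i) <-> ~~ pB (g i).
Proof. by rewrite bE; apply: even_pdeg; [apply: gr_vXY|apply/vXY_neq0/mg]. Qed.

Lemma odd_odd_basisE : odd_odd_basis X Y = [set` [seq vXY x |
  x <- enum [pred x : PX D * PY D | [&& matched x, pdeg (dX x.1) & pdeg (dY x.2)]]]]%classic.
Proof.
apply/seteqP; split=> [_ [i _ [x [/(XP D)[xi ci <-] ox] [y [/(YP D)[eta ceta <-] oy] <-]]]|z /mapP[[xi eta]]].
  apply/mapP; exists (xi, eta) => //; rewrite mem_enum inE /matched /= ci ceta eqxx /=.
  by rewrite ((odd_pdeg (grX xi) (vX_neq0 xi)).1 ox) ((odd_pdeg (grY eta) (vY_neq0 eta)).1 oy).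
rewrite mem_enum inE /matched /= => /and3P[/eqP mx ox oy] ->; exists (cX xi) => //.
exists (vX xi).
  by split; [exact: vXX|exact: (odd_pdeg (grX xi) (vX_neq0 xi)).2].
exists (vY eta) => //; split; first by rewrite mx; exact: vYY.
exact: (odd_pdeg (grY eta) (vY_neq0 eta)).2.
Qed.

Lemma c_factorialE : c_factorial X Y b r s = mult cty g.
Proof.
rewrite /c_factorial odd_odd_basisE -fsbig_seq; last first.
  rewrite map_inj_in_uniq ?enum_uniq // => x y; rewrite !mem_enum !inE => /andP[mx _] /andP[my _].
  exact: vXY_inj.
rewrite big_map big_enum /=; under eq_bigr => x _ do rewrite pair_big.
rewrite pair_big /= /mult [RHS](bigID cmatched) /= [X in (_ * X)%N]big1 ?muln1; last first.
  move=> x /andP[_ nx]; rewrite (eq_card0 (A := [pred i | g i == x])) // => i; rewrite !inE.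
  by apply/eqP => e'; rewrite -e' mg in nx.
pose f (z : (PX D * PY D) * ('I_n * 'I_n)) : bas := ((z.2.1, z.1.1), (z.2.2, z.1.2)).
pose f' (x : bas) : (PX D * PY D) * ('I_n * 'I_n) := ((x.1.2, x.2.2), (x.1.1, x.2.1)).
rewrite [RHS](reindex f) /=; last first.
  by apply: onW_bij; exists f' => -[[? ?] [? ?]].
apply: eq_big => [[[xi eta] [p q]]|[[xi eta] [p q]]] /=.
  by rewrite andbT /cmatched /cty /f /= andbC.
rewrite andbT => /and3P[mx _ _]; congr factorial; apply: eq_card => i; rewrite !inE.
by rewrite same_label.
Qed.

Lemma eta_eltE : goodw pB g -> eta_elt t X Y b r s = (mult cty g)%:R *: ev t vB (orb k pB g).
Proof.
move=> gg; rewrite /eta_elt c_factorialE scaler_nat; congr (_ *+ _); apply: xi_ev => // [i j|i|i].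
- by rewrite same_label // !bE !rE !sE.
- by rewrite /vB bE rE sE.
rewrite bE; apply/esym; apply/asboolP/idP.
  by move/(odd_pdeg (gr_vXY _) (vXY_neq0 (mg i))).1.
by move/(odd_pdeg (gr_vXY _) (vXY_neq0 (mg i))).2.
Qed.

Lemma Tri_good : Tri (hered_basis X Y) b r s <-> goodw pB g.
Proof.
split=> [[_ tri] i j gij oi|gg].
  have [//|nij] := eqVneq i j; have := tri _ _ nij; rewrite even_label oi => h.
  by have /h : (tnth b i, tnth r i, tnth s i) = (tnth b j, tnth r j, tnth s j) by rewrite !bE !rE !sE gij.
split=> [i|i j nij eij]; first by rewrite bE; apply/vXY_basis/mg.
apply/(even_label i)/negP => oi.
have /eqP gij : g i == g j by rewrite same_label // -bE -rE -sE; apply/eqP.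
by rewrite (gg _ _ gij oi) eqxx in nij.
Qed.

End Generator.

(** The words on which [TT] is built are the triples of the definition of [TA], together
    with words that contain an unmatched name and give 0. *)
Lemma TA_TT : TA t X Y = TT.
Proof.
apply/seteqP; split; apply: lspan_min; try exact: lspan_submodule.
  move=> _ [b [r [s [tri ->]]]].
  have ex (i : 'I_d) : exists x : PX D * PY D, matched x /\ tnth b i = vXY x.
    by have [/(_ i)/(hered_basisP D)[x mx bx] _] := tri; exists x.
  have [f fE] := choice ex.
  pose g : word bas := [ffun i => ((tnth r i, (f i).1), (tnth s i, (f i).2))].
  have mg i : cmatched (g i) by rewrite /cmatched ffunE /= -surjective_pairing (fE i).1.
  have bE i : tnth b i = vXY ((g i).1.2, (g i).2.2) by rewrite ffunE /= -surjective_pairing (fE i).2.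
  have rE i : tnth r i = (g i).1.1 by rewrite ffunE.
  have sE i : tnth s i = (g i).2.1 by rewrite ffunE.
  have gg := (Tri_good mg bE rE sE).1 tri.
  by rewrite (eta_eltE mg bE rE sE gg); apply: lspan_in; exists g.
move=> _ [g [gg ->]].
have [mg|/existsNP[i /negP nm]] := pselect (forall i, cmatched (g i)); last first.
  have -> : ev t vB (orb k pB g) = 0.
    apply: big1 => h _.
    have [->|/orb_neq0/samewP[s ->]] := eqVneq (orb k pB g h) 0; first by rewrite scale0r.
    rewrite (@multilinear0 _ _ _ _ _ (tp_multilinear hW) _ (s^-1%g i)) ?scaler0 //.
    by rewrite ffunE [wperm _ _ _]ffunE permKV vB_unmatched.
  by rewrite scaler0; case: (lspan_submodule [set w | exists b r s, Tri (hered_basis X Y) b r s /\ w = eta_elt t X Y b r s]%classic).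
pose b := [tuple vXY ((g i).1.2, (g i).2.2) | i < d].
pose r := [tuple (g i).1.1 | i < d]; pose s := [tuple (g i).2.1 | i < d].
have bE i : tnth b i = vXY ((g i).1.2, (g i).2.2) by rewrite tnth_mktuple.
have rE i : tnth r i = (g i).1.1 by rewrite tnth_mktuple.
have sE i : tnth s i = (g i).2.1 by rewrite tnth_mktuple.
rewrite -(eta_eltE mg bE rE sE gg); apply: lspan_in; exists b, r, s; split=> //.
exact/(Tri_good mg bE rE sE).
Qed.

Definition initX (lam : multipart l n d) : word ZX :=
  [ffun j => ((rows_of lam j).2, eX D (rows_of lam j).1)].
Definition initY (lam : multipart l n d) : word ZY :=
  [ffun j => ((rows_of lam j).2, eY D (rows_of lam j).1)].

Lemma initX_std lam : stdw (initX lam) (rows_of lam) (cols_of lam).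
Proof.
apply: (initial_stdw (XP D) hleX rX_inj rXE); first exact: ceX.
by move=> i; rewrite dX_e.
Qed.

Lemma initY_std lam : stdw (initY lam) (rows_of lam) (cols_of lam).
Proof.
apply: (initial_stdw (YP D) hleY rY_inj rYE); first exact: ceY.
by move=> i; rewrite dY_e.
Qed.

Lemma e_lamX lam : e_lam t e lam = Xw (initX lam) (rows_of lam).
Proof.
rewrite -xi_X; last exact/stdw_rowword/initX_std.
have -> : color_word ((fillX lam) (initX lam)) = eword e lam.
  by apply: eq_from_tnth => j; rewrite tnth_eword tnth_color_fill ffunE /= veX.
have -> // : row_word ((fillX lam) (initX lam)) = lword lam.
by apply: eq_from_tnth => j; rewrite tnth_lword tnth_row_fill ffunE.
Qed.

Lemma e_lamY lam : e_lam t e lam = Yw (initY lam) (rows_of lam).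
Proof.
rewrite -xi_Y; last exact/stdw_rowword/initY_std.
have -> : color_word ((fillY lam) (initY lam)) = eword e lam.
  by apply: eq_from_tnth => j; rewrite tnth_eword tnth_color_fill ffunE /= veY.
have -> // : row_word ((fillY lam) (initY lam)) = lword lam.
by apply: eq_from_tnth => j; rewrite tnth_lword tnth_row_fill ffunE.
Qed.

Local Notation leM := (@multipart_le l n d leI).
Local Notation XM := (calX t X leX).
Local Notation YM := (calY t Y leY).
Local Notation eM := (e_lam t e).

Lemma init_mem lam : XM lam (eM lam) /\ YM lam (eM lam).
Proof.
split.
  by apply/calXE; exists (initX lam); [exact: initX_std|exact: e_lamX].
by apply/calYE; exists (initY lam); [exact: initY_std|exact: e_lamY].
Qed.

Lemma calX_right lam x : XM lam x -> smul x (eM lam) = x.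
Proof. by move=> /calXE[p S ->]; rewrite e_lamE (Xw_E hW) ?samew_refl //; apply: stdw_rowword S. Qed.

Lemma calY_left lam y : YM lam y -> smul (eM lam) y = y.
Proof. by move=> /calYE[q S ->]; rewrite e_lamE (E_Yw hW) ?samew_refl //; apply: stdw_rowword S. Qed.

(** The idempotent acts by a word of idempotents [e_j], each of which fixes or kills the
    colours; the weights so obtained are compared by [weight_le]. *)
Lemma calX_weight lam nu x : XM lam x ->
  smul (eM nu) x = 0 \/ [/\ smul (eM nu) x = x, leM nu lam & nu = lam -> x = eM lam].
Proof.
move=> /calXE[p S ->]; rewrite e_lamE (idem_Xw hW); last exact: stdw_rowword S.
case: asboolP => [/lweightX[v nv wv]|_]; last by left.
right; have co_p i : cX (p i).2 = (rows_of lam i).1 := std_co S i.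
rewrite samew_sym in nv.
have [] := @weight_le l n d leI (hd_poset hA) leI_nat ZX (fun c r => (r, eX D c)) _ _ lam nu p _ v S nv.
- by move=> c r; rewrite /= dX_e.
- by move=> c r r'; exact: (rk_row (XP D) hleX rX_inj rXE (xi := eX D c)).
- by move=> i; have [_ /(weightX (D := D))[]] := wv i; rewrite co_p.
- move=> i vu; have [v2 /(weightX (D := D))[_]] := wv i; rewrite co_p vu v2 => /(_ erefl) e2.
  by rewrite [LHS]surjective_pairing e2.
by move=> le_nl pE; split=> // nl; rewrite e_lamX /initX -(pE nl).
Qed.

Lemma calY_weight lam nu y : YM lam y ->
  smul y (eM nu) = 0 \/ [/\ smul y (eM nu) = y, leM nu lam & nu = lam -> y = eM lam].
Proof.
move=> /calYE[q S ->]; rewrite e_lamE (Yw_idem hW); last exact: stdw_rowword S.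
case: asboolP => [/rweightY[v nv wv]|_]; last by left.
right; have co_q i : cY (q i).2 = (rows_of lam i).1 := std_co S i.
rewrite samew_sym in nv.
have [] := @weight_le l n d leI (hd_poset hA) leI_nat ZY (fun c r => (r, eY D c)) _ _ lam nu q _ v S nv.
- by move=> c r; rewrite /= dY_e.
- by move=> c r r'; exact: (rk_row (YP D) hleY rY_inj rYE (xi := eY D c)).
- by move=> i; have [_ /(weightY (D := D))[]] := wv i; rewrite co_q.
- move=> i vu; have [v2 /(weightY (D := D))[_]] := wv i; rewrite co_q vu v2 => /(_ erefl) e2.
  by rewrite [LHS]surjective_pairing e2.
by move=> le_nl qE; split=> // nl; rewrite e_lamY /initY -(qE nl).
Qed.

Lemma calX_TT lam x : XM lam x -> TT x.
Proof. by move=> /calXE[p S ->]; apply: (Xw_TT rY_inj t (stdw_rowword S)). Qed.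

Lemma calY_TT lam y : YM lam y -> TT y.
Proof. by move=> /calYE[q S ->]; apply: (Yw_TT rX_inj t (stdw_rowword S)). Qed.

(** * The standard basis *)

Definition std_index (z : multipart l n d * (word ZX * word ZY)) : Prop :=
  stdw z.2.1 (rows_of z.1) (cols_of z.1) /\ stdw z.2.2 (rows_of z.1) (cols_of z.1).

Definition index : finType := {z : multipart l n d * (word ZX * word ZY) | `[< std_index z >]}.

Definition prodM (j : index) : W :=
  smul (Xw (val j).2.1 (rows_of (val j).1)) (Yw (val j).2.2 (rows_of (val j).1)).

Lemma prodM_indep (c : index -> k) : \sum_j c j *: prodM j = 0 -> forall j, c j = 0.
Proof.
move=> c0; apply: (products_indep k_char0 hW (w := fun j : index => cols_of (val j).1) _ _ _ c0).
- by case=> z /= /asboolP[].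
- by case=> z /= /asboolP[].
move=> [[lam [p q]] zj] [[mu [p' q']] zj'] /=; have /asboolP[/= S T] := zj; have /asboolP[/= S' T'] := zj'.
move=> pp qq; have lm : lam = mu.
  by apply: rows_of_inj; move: pp => /samew_zipP[s _ ->]; apply: samew_perm.
subst mu; apply: val_inj => /=.
by rewrite (stdw_unique S S' pp) (stdw_unique T T' qq).
Qed.

Lemma prodM_inj : injective prodM.
Proof. exact: indep_inj prodM_indep. Qed.

Lemma prodM_in lam x y : XM lam x -> YM lam y ->
  exists j : index, [/\ smul x y = prodM j, (val j).1 = lam, x = Xw (val j).2.1 (rows_of lam) &
    y = Yw (val j).2.2 (rows_of lam)].
Proof.
move=> /calXE[p S ->] /calYE[q T ->].
have z : `[< std_index (lam, (p, q)) >] by apply/asboolP; split.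
by exists (exist _ (lam, (p, q)) z).
Qed.

Lemma prodM_mem (j : index) : prods XM YM (val j).1 (prodM j).
Proof.
case: j => [[lam [p q]] zj]; have /asboolP[/= S T] := zj.
exists (Xw p (rows_of lam)); first by apply/calXE; exists p.
by exists (Yw q (rows_of lam)) => //; apply/calYE; exists q.
Qed.

Lemma hered_basis_prodM u : hered_basis XM YM u <-> exists j, u = prodM j.
Proof.
split=> [[lam _ [x Xx [y Yy <-]]]|[j ->]].
  by have [j [-> _ _ _]] := prodM_in Xx Yy; exists j.
by exists (val j).1 => //; apply: prodM_mem.
Qed.

Lemma basis_indep : linearly_independent (hered_basis XM YM).
Proof. exact: indep_range prodM_indep _ hered_basis_prodM. Qed.

Lemma Xw_orbit p u p' u' : rowword p u -> samew (wzip p u) (wzip p' u') ->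
  exists c : k, Xw p u = c *: Xw p' u'.
Proof.
move=> [_ gp] /(orb_same k gp)[c _ cE]; exists c; exact: ev_scale.
Qed.

Lemma Yw_orbit q u q' u' : rowword q u -> samew (wzip q u) (wzip q' u') ->
  exists c : k, Yw q u = c *: Yw q' u'.
Proof.
move=> [_ gq] /(orb_same k gq)[c _ cE]; exists c; exact: ev_scale.
Qed.

Lemma basis_span : lspan (hered_basis XM YM) = TT.
Proof.
apply/seteqP; split=> w.
  apply: lspan_min; first exact: lspan_submodule.
  move=> v [lam _ [x /calX_TT Xx [y /calY_TT Yy <-]]].
  exact: (TT_mul k_char0 n_gt0 ha ord0 hW).
move=> /(TT_span k_char0 dn hW); apply: lspan_min; first exact: lspan_submodule.
move=> _ [p [u [q [w1 [z [S T ->]]]]]].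
have [lam lamE] := shape_exists S.
have [s [us Ss]] := stdw_transport S lamE; have [s' [us' Ts]] := stdw_transport T lamE.
have [c ->] : exists c : k, Xw p u = c *: Xw (wperm p s) (rows_of lam).
  by apply: Xw_orbit; [exact: stdw_rowword S|apply/samew_zipP; exists s].
have [c' ->] : exists c : k, Yw q u = c *: Yw (wperm q s') (rows_of lam).
  by apply: Yw_orbit; [exact: stdw_rowword T|apply/samew_zipP; exists s'].
rewrite smulZl smulZr; do 2!apply: (submoduleZ (lspan_submodule _)).
apply: lspan_in; exists lam => //; exists (Xw (wperm p s) (rows_of lam)).
  by apply/calXE; exists (wperm p s).
by exists (Yw (wperm q s') (rows_of lam)) => //; apply/calYE; exists (wperm q s').
Qed.

Lemma basis_distinct i j x x' y y' : XM i x -> YM i y -> XM j x' -> YM j y' ->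
  smul x y = smul x' y' -> [/\ i = j, x = x' & y = y'].
Proof.
move=> Xx Yy Xx' Yy'; have [m [-> mi xE yE]] := prodM_in Xx Yy.
have [m' [-> mj xE' yE']] := prodM_in Xx' Yy' => /prodM_inj mm.
rewrite -mm in mj xE' yE'; have ij : i = j by rewrite -mi -mj.
by rewrite ij in xE yE; rewrite xE yE xE' yE'.
Qed.

Lemma calX_finite lam : finite_set (XM lam).
Proof.
apply: (@sub_finite_set _ _ [set Xw p (rows_of lam) | p in [set: word ZX]]%classic).
  by move=> _ /calXE[p _ ->]; exists p.
exact/finite_image/finite_finset.
Qed.

Lemma calY_finite lam : finite_set (YM lam).
Proof.
apply: (@sub_finite_set _ _ [set Yw q (rows_of lam) | q in [set: word ZY]]%classic).
  by move=> _ /calYE[q _ ->]; exists q.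
exact/finite_image/finite_finset.
Qed.

(** Expand [b x] in the basis and multiply by the idempotent of [lam] on the right, which
    fixes [x]. It kills a basis element unless the shape of the latter is at least [lam],
    and for the shape [lam] only the elements of [calX] remain. *)
Lemma left_cell lam x b : XM lam x -> TT b ->
  exists2 u, lspan (XM lam) u & hered_above leM XM YM lam (smul b x - u).
Proof.
move=> Xx Tb; have Tx := calX_TT Xx.
have := TT_mul k_char0 n_gt0 ha ord0 hW Tb Tx; rewrite -basis_span => Tbx.
pose P := [set v | exists2 u, lspan (XM lam) u & hered_above leM XM YM lam (smul v (eM lam) - u)]%classic.
suff [u Uu above] : P (smul b x) by exists u => //; rewrite -{1}(calX_right Xx) smulA.
apply: (lspan_min (P := P)) Tbx.
  split=> [|c v1 v2 [u1 U1 a1] [u2 U2 a2]].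
    exists 0; first by case: (lspan_submodule (XM lam)).
    by rewrite smul0l subr0; case: (lspan_submodule (\bigcup_(j in [set j | leM lam j && (lam != j)]) prods XM YM j)%classic).
  exists (c *: u1 + u2); first exact: (lspan_submodule (XM lam)).2.
  have -> : smul (c *: v1 + v2) (eM lam) - (c *: u1 + u2)
      = c *: (smul v1 (eM lam) - u1) + (smul v2 (eM lam) - u2).
    by rewrite smul_linl scalerBr opprD addrACA.
  exact: (lspan_submodule _).2.
move=> v [nu _ [x' Xx' [y Yy <-]]]; rewrite /P /mkset -smulA.
have sub0 := lspan_submodule (XM lam).
have aub0 := lspan_submodule (\bigcup_(j in [set j | leM lam j && (lam != j)]) prods XM YM j)%classic.
case: (calY_weight lam Yy) => [->|[-> le_ln ynu]].
  exists 0; first by case: sub0.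
  by rewrite smul0r subr0; case: aub0.
have [ln|ln] := eqVneq lam nu.
  exists x'; first by apply: lspan_in; rewrite ln.
  by rewrite (ynu ln) calX_right // subrr; case: aub0.
exists 0; first by case: sub0.
rewrite subr0; apply: lspan_in; exists nu; first by rewrite /mkset le_ln ln.
by exists x' => //; exists y.
Qed.

Lemma right_cell lam y b : YM lam y -> TT b ->
  exists2 u, lspan (YM lam) u & hered_above leM XM YM lam (smul y b - u).
Proof.
move=> Yy Tb; have Ty := calY_TT Yy.
have := TT_mul k_char0 n_gt0 ha ord0 hW Ty Tb; rewrite -basis_span => Tyb.
pose P := [set v | exists2 u, lspan (YM lam) u & hered_above leM XM YM lam (smul (eM lam) v - u)]%classic.
suff [u Uu above] : P (smul y b) by exists u => //; rewrite -{1}(calY_left Yy) -smulA.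
apply: (lspan_min (P := P)) Tyb.
  split=> [|c v1 v2 [u1 U1 a1] [u2 U2 a2]].
    exists 0; first by case: (lspan_submodule (YM lam)).
    by rewrite smul0r subr0; case: (lspan_submodule (\bigcup_(j in [set j | leM lam j && (lam != j)]) prods XM YM j)%classic).
  exists (c *: u1 + u2); first exact: (lspan_submodule (YM lam)).2.
  have -> : smul (eM lam) (c *: v1 + v2) - (c *: u1 + u2)
      = c *: (smul (eM lam) v1 - u1) + (smul (eM lam) v2 - u2).
    by rewrite smul_linr scalerBr opprD addrACA.
  exact: (lspan_submodule _).2.
move=> v [nu _ [x Xx [y' Yy' <-]]]; rewrite /P /mkset smulA.
have sub0 := lspan_submodule (YM lam).
have aub0 := lspan_submodule (\bigcup_(j in [set j | leM lam j && (lam != j)]) prods XM YM j)%classic.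
case: (calX_weight lam Xx) => [->|[-> le_ln xnu]].
  exists 0; first by case: sub0.
  by rewrite smul0l subr0; case: aub0.
have [ln|ln] := eqVneq lam nu.
  exists y'; first by apply: lspan_in; rewrite ln.
  by rewrite (xnu ln) calY_left // subrr; case: aub0.
exists 0; first by case: sub0.
rewrite subr0; apply: lspan_in; exists nu; first by rewrite /mkset le_ln ln.
by exists x => //; exists y'.
Qed.

Lemma standard_heredity : heredity_data leM XM YM eM (TA t X Y).
Proof.
rewrite TA_TT.
split.
- split; [exact: lspan_submodule|move=> u v; exact: (TT_mul k_char0 n_gt0 ha ord0 hW)|].
  move=> u; exact: (TT_graded hW).
- exact: multipart_le_po (hd_poset hA) leI_nat.
- exact: calX_finite.
- exact: calY_finite.
- move=> lam x Xx; split; first exact: calX_TT Xx.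
  by have /calXE[p _ ->] := Xx; have [g] := gr_Xw (rX_inj := rX_inj) hW p (rows_of lam); exists g.
- move=> lam y Yy; split; first exact: calY_TT Yy.
  by have /calYE[q _ ->] := Yy; have [g] := gr_Yw (rY_inj := rY_inj) hW q (rows_of lam); exists g.
(* An element is its own product with the idempotent of its shape, so the distinctness of
   the products determines the shape. *)
- move=> i j x Xi Xj; have [_ Yi] := init_mem i; have [_ Yj] := init_mem j.
  by have [] := basis_distinct Xi Yi Xj Yj; rewrite ?(calX_right Xi) ?(calX_right Xj).
- move=> i j y Yi Yj; have [Xi _] := init_mem i; have [Xj _] := init_mem j.
  by have [] := basis_distinct Xi Yi Xj Yj; rewrite ?(calY_left Yi) ?(calY_left Yj).
- exact: init_mem.
- exact: basis_distinct.
- exact: basis_indep.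
- exact: basis_span.
- exact: left_cell.
- exact: right_cell.
- exact: calX_right.
- move=> lam x Xx; case: eqP => [->|nx]; first by apply: calX_right; apply: (init_mem lam).1.
  by case: (calX_weight lam Xx) => // -[_ _ /(_ erefl)].
- exact: calY_left.
- move=> lam y Yy; case: eqP => [->|ny]; first by apply: calX_right; apply: (init_mem lam).1.
  by case: (calY_weight lam Yy) => // -[_ _ /(_ erefl)].
- by move=> lam nu x Xx; case: (calX_weight nu Xx) => [->|[-> _ _]]; [right|left].
- by move=> lam nu y Yy; case: (calY_weight nu Yy) => [->|[-> _ _]]; [right|left].
Qed.

End Heredity.

Local Open Scope classical_set_scope.
Local Open Scope ring_scope.

Theorem theorem1 (k : idomainType) (hk : [pchar k] =i pred0)
  (n d : nat) (hn : (0 < n)%N) (hdn : (d <= n)%N)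
  (A : superalg k) (a : set A)
  (l : nat) (leI : rel 'I_l.+1) (X Y : 'I_l.+1 -> set A) (e : 'I_l.+1 -> A)
  (hA : heredity_data leI X Y e [set: A])
  (ha : conforming leI X Y e a)
  (hleI : forall i j : 'I_l.+1, leI i j -> (i <= j)%N)
  (leX leY : 'I_l.+1 -> rel ('I_n * A))
  (hleX : forall i, letter_order (X i) (leX i))
  (hleY : forall i, letter_order (Y i) (leY i))
  (W : superalg k) (t : {ffun 'I_d -> matA A n} -> W) (hW : tensor_power t) :
  heredity_data (@multipart_le l n d leI)
    (calX t X leX) (calY t Y leY) (e_lam t e) (TA t X Y).
Proof.
have [D] := presentation_exists hA.
have [rX [rX_inj rXE]] := letter_rank_exists (@vX_inj _ _ _ _ _ _ _ D) (XP D) hleX.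
have [rY [rY_inj rYE]] := letter_rank_exists (@vY_inj _ _ _ _ _ _ _ D) (YP D) hleY.
exact: (standard_heredity hk hn hdn ha hleI hleX hleY rX_inj rY_inj rXE rYE hW).
Qed.
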